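(* Let $k\ge 0$, $m\ge 1$ be integers and let $T>0$. Suppose that $W$ is an admissible stored energy density, that $D_0,\beta_0,n_L,n_R$ are admissible nutrient data, and that $\mathcal G$ is an admissible growth law (all as defined in the context, for the given $k,m,T$). Then there exists a unique solution $G\in C^m([0,T];C^k([0,L_0]))$ of the one-dimensional growth problem on $[0,T]$, that is, a unique $G\in C^m([0,T];C^k([0,L_0]))$ with $G(t)(X)>0$ for all $t\in[0,T]$, $X\in[0,L_0]$, satisfying $$\dot G(t)=\hat{\mathcal G}(G(t))\quad\text{for } t\in[0,T],\qquad G(0)=1,$$ as an ordinary differential equation in the Banach space $C^k([0,L_0])$.
   Context: Fix integers $k\ge 0$, $m\ge 1$ and real numbers $T,L_0,l_0>0$. $C^j([a,b])$ carries the norm $\sum_{i=0}^{j}\sup|f^{(i)}|$. **Admissible stored energy density.** A function $W:[0,L_0]\times(0,\infty)\to[0,\infty)$, $(X,p)\mapsto W(X,p)$, such that: (i) $W$ is continuous, $W(X,1)=0$ for all $X$, $W(X,\cdot)\in C^1(0,\infty)$ for each fixed $X$, and $\partial_pW\in C^0([0,L_0]\times(0,\infty))$; (ii) there is a convex $\theta:(0,\infty)\to\mathbb R$ with $\theta(p)\to\infty$ as $p\searrow0$ and $\theta(p)/p\to\infty$ as $p\to\infty$ such that $W(X,p)\ge\theta(p)$ for all $X,p$, and $W(X,\cdot)$ is strictly convex for each $X$; (iii) $\int_0^{L_0}W(X,\lambda)\,dX<\infty$ for all $\lambda\in(0,\infty)$; (iv) $\partial_pW\in C^{k+m}([0,L_0]\times(0,\infty);\mathbb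 R)$ and $\partial_{pp}W>0$ on $[0,L_0]\times(0,\infty)$. **Elastic deformation and stress.** Let $C^k_+([0,L_0])=\{G\in C^k([0,L_0]):G>0 \text{ on }[0,L_0]\}$. For $G\in C^k_+([0,L_0])$ let $g:[0,L_0]\to\mathbb R$ satisfy $g'=G$ (the additive constant is immaterial). Let $\phi_G$ be the unique minimizer of $I_G[\phi]=\int_{g(0)}^{g(L_0)}W(g^{-1}(z),\phi'(z))\,dz$ among all $\phi\in W^{1,1}(g(0),g(L_0))$ with $\phi'>0$ a.e., $I_G[\phi]<\infty$, $\phi(g(0))=0$ and $\phi(g(L_0))=l_0$. It is known that $\phi_G$ exists, belongs to $C^{k+1}([g(0),g(L_0)])$, satisfies $\min\phi_G'>0$, and that the stress $\partial_pW(g^{-1}(z),\phi_G'(z))$ is independent of $z$; its constant value is denoted $S(G)\in\mathbb R$. Put $y_G=\phi_G\circ g:[0,L_0]\to[0,l_0]$. **Admissible nutrient data and nutrient concentration.** $D_0,\beta_0\in W^{k+m,\infty}([0,L_0])$ with $D_0(X)\in[D_{min},D_{max}]$ and $\beta_0(X)\in[\beta_{min},\beta_{max}]$ for all $X$, where $D_{min},D_{max},\beta_{min},\beta_{max}\in(0,\infty)$; and $n_L,n_R\ge0$. For $G\in C^k_+([0,L_0])$ set $D_G=(\phi_G'\circ\phi_G^{-1})\,(D_0\circ y_G^{-1})$ and $\beta_G=(\phi_G'\circ\phi_G^{-1})^{-1}(\beta_0\circ y_G^{-1})$ on $[0,l_0]$, and let $n_G\in H^1(0,l_0)$ be the unique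 (weak) solution of $-(D_Gn_G')'+\beta_Gn_G=0$ in $(0,l_0)$, $n_G(0)=n_L$, $n_G(l_0)=n_R$ (one has $n_G\ge0$). Put $N(G)=n_G\circ y_G:[0,L_0]\to[0,\infty)$. **Admissible growth law.** Let $\mathcal L^\infty([0,L_0])$ be the space of bounded measurable functions on $[0,L_0]$ with the sup norm, and $\mathcal L^\infty_+([0,L_0])$ the subset of those that are pointwise positive. A function $\mathcal G:\mathbb R_{>0}\times\mathbb R\times\mathbb R_{\ge0}\times[0,L_0]\to\mathbb R$, $(G,S,N,X)\mapsto\mathcal G(G,S,N,X)$, is admissible if: (a) There are locally Lipschitz functions $\mathcal G_i:(0,\infty)\times[0,L_0]\to\mathbb R$, $i\in\{0,1\}$, such that $\hat{\mathcal G}_i(G)(X)=\mathcal G_i(G(X),X)$ defines locally Lipschitz maps $\hat{\mathcal G}_i:\mathcal L^\infty_+([0,L_0])\to\mathcal L^\infty([0,L_0])$, and the equations $\dot G_i(t)=\hat{\mathcal G}_i(G_i(t))$, $G_i(0)=1$, have solutions $G_i\in C^1([0,T];\mathcal L^\infty([0,L_0]))$ on all of $[0,T]$ with $G_0(t,X)<G_1(t,X)$ for all $X\in[0,L_0]$, $t\in(0,T]$, $\inf_{X\in[0,L_0]}\inf_{t\in[0,T]}G_0(t,X)>0$ and $\sup_{X\in[0,L_0]}\sup_{t\in[0,T]}G_1(t,X)<\infty$. (b) The mixed partial derivatives of $\mathcal G$ of order up to $k+m-1$ in its first and third variables, up to $m-1$ in its second variable and up to $k$ in its fourth variable exist and are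 continuous; moreover $\mathcal G(\cdot,\cdot,\cdot,X)$ is jointly continuous for each fixed $X$. (c) For all $0<\Gamma_0<\Gamma_1$, $\Sigma_0<\Sigma_1$, $0\le H_0<H_1$ and all $X\in[0,L_0]$, the function $(G,S,N)\mapsto\mathcal G(G,S,N,X)$ on $[\Gamma_0,\Gamma_1]\times[\Sigma_0,\Sigma_1]\times[H_0,H_1]$ and its mixed partial derivatives up to order $k$ in the first, third and fourth variables are uniformly Lipschitz continuous and bounded, with constants independent of $X$. (d) For all $G>0$, $S\in\mathbb R$, $N\ge0$, $X\in[0,L_0]$: $\mathcal G_0(G,X)<\mathcal G(G,S,N,X)<\mathcal G_1(G,X)$. **Growth operator.** $\hat{\mathcal G}:C^k_+([0,L_0])\to C^k([0,L_0])$, $\hat{\mathcal G}(G)(X)=\mathcal G(G(X),S(G),N(G)(X),X)$. *)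

(* Defs.v *)
From HB Require Import structures.
From mathcomp Require Import all_boot all_order all_algebra.
From mathcomp Require Import all_classical all_reals all_analysis.

Set Implicit Arguments.
Unset Strict Implicit.
Unset Printing Implicit Defensive.

Import Order.TTheory GRing.Theory Num.Theory.
Import numFieldNormedType.Exports.

Local Open Scope classical_set_scope.
Local Open Scope ring_scope.

(* A function on a set D is a total function R -> R whose values outside D are
   never used. *)

Section Calculus.
Variable R : realType.
Implicit Types (D : set R) (f g : R -> R).

(* Derivatives are relative to D, hence one-sided at an end point of D. *)
Definition derivable_in D f (x : R) : Prop :=
  cvg ((f y - f x) / (y - x) @[y --> within D x^']).

Definition deriv_in D f (x : R) : R :=
  lim ((f y - f x) / (y - x) @[y --> within D x^']).

Definition derivn_in D n f : R -> R := iter n (deriv_in D) f.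

Definition Ck D k f : Prop :=
  (forall i x, (i < k)%N -> D x -> derivable_in D (derivn_in D i f) x) /\
  (forall i, (i <= k)%N -> {within D, continuous (derivn_in D i f)}).

(* Real-valued [sup] is junk on unbounded sets: both norms are only applied to
   differences of elements of the space at hand (bounded functions, resp. C^k
   functions on a compact interval). *)
Definition sup_norm D f : R := sup [set `|f x| | x in D].

Definition Ck_norm D k f : R := \sum_(i < k.+1) sup_norm D (derivn_in D i f).

Definition strictly_convex D f : Prop :=
  forall p q s : R, D p -> D q -> p != q -> 0 < s < 1 ->
    f (s * p + (1 - s) * q) < s * f p + (1 - s) * f q.

Definition inverse_on D f : R -> R := 'pinv_(fun=> 0) D f.

(* Mixed partial derivatives on a product of sets D 0 x ... x D (n-1). The word
   [:: i1; ...; ir] stands for d_{i1} (... (d_{ir} f)), so that an assumption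
   on all the words with given letter counts covers every order of
   differentiation. *)
Definition box n (D : 'I_n -> set R) : set 'rV[R]_n :=
  [set v | forall i, D i (v 0 i)].

Definition subst_coord n (v : 'rV[R]_n) (i : 'I_n) (y : R) : 'rV[R]_n :=
  \row_j (if j == i then y else v 0 j).

Definition partial_in n (D : 'I_n -> set R) (i : 'I_n) (f : 'rV[R]_n -> R) :
    'rV[R]_n -> R :=
  fun v => deriv_in (D i) (fun y => f (subst_coord v i y)) (v 0 i).

Definition mixed_partial n (D : 'I_n -> set R) (w : seq 'I_n)
    (f : 'rV[R]_n -> R) : 'rV[R]_n -> R :=
  foldr (partial_in D) f w.

Definition continuous_partials n (D : 'I_n -> set R) (A : pred (seq 'I_n))
    (f : 'rV[R]_n -> R) : Prop :=
  (forall i w v, A (i :: w) -> box D v ->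
     derivable_in (D i) (fun y => mixed_partial D w f (subst_coord v i y))
       (v 0 i)) /\
  (forall w, A w -> {within box D, continuous (mixed_partial D w f)}).

Definition uncurry2 (f : R -> R -> R) (v : 'rV[R]_2) : R := f (v 0 0) (v 0 1).

Definition uncurry3 (f : R -> R -> R -> R) (v : 'rV[R]_3) : R :=
  f (v 0 0) (v 0 1) (v 0 2).

Definition uncurry4 (f : R -> R -> R -> R -> R) (v : 'rV[R]_4) : R :=
  f (v 0 0) (v 0 1) (v 0 2) (v 0 3).

Definition row4 (a b c d : R) : 'rV[R]_4 := \row_i [:: a; b; c; d]`_i.

End Calculus.

(* A curve in a space V of functions of X is a function u of (t, X); V is
   normed by nrm. *)
Section Curves.
Variables (R : realType) (V : set (R -> R)) (nrm : (R -> R) -> R) (T : R).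

Definition curve_deriv (u : R -> R -> R) (t : R) (v : R -> R) : Prop :=
  nrm (fun X => (u s X - u t X) / (s - t) - v X)
    @[s --> within `[0, T] t^'] --> (0 : R).

Definition curve_continuous (u : R -> R -> R) : Prop :=
  forall t : R, t \in `[0, T] ->
    nrm (fun X => u s X - u t X) @[s --> within `[0, T] (nbhs t)] --> (0 : R).

Fixpoint Cm_curve (m : nat) (u : R -> R -> R) : Prop :=
  (forall t : R, t \in `[0, T] -> V (u t)) /\ curve_continuous u /\
  if m is m'.+1 then
    exists2 u' : R -> R -> R,
      (forall t : R, t \in `[0, T] -> curve_deriv u t (u' t)) & Cm_curve m' u'
  else True.

End Curves.

(* Sobolev spaces on ]a, b[ with the test functions C^1_c(]a, b[). A Sobolev
   function is identified with its continuous representative on [a, b], so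
   that its pointwise (in particular boundary) values make sense. *)
Section Sobolev.
Variable R : realType.
Local Notation mu := (@lebesgue_measure R).
Implicit Types (a b : R) (f g psi : R -> R).

Definition test_function a b psi : Prop :=
  [/\ forall x, derivable psi x 1,
      continuous (derive1 psi)
    & closure [set x | psi x != 0] `<=` `]a, b[].

Definition weak_deriv a b f g : Prop :=
  forall psi, test_function a b psi ->
    \int[mu]_(x in `]a, b[) (f x * derive1 psi x) =
    - \int[mu]_(x in `]a, b[) (g x * psi x).

Definition Lp_on (p : nat) a b f : Prop :=
  measurable_fun `]a, b[ f /\
  mu.-integrable `]a, b[ (fun x => (`|f x| ^+ p)%:E).

Definition Linfty_on a b f : Prop :=
  measurable_fun `]a, b[ f /\
  exists M : R, {ae mu, forall x, x \in `]a, b[ -> `|f x| <= M}.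

(* f is in W^{1,p}(]a, b[) with weak derivative g *)
Definition W1p (p : nat) a b f g : Prop :=
  [/\ {within `[a, b], continuous f}, Lp_on p a b f, Lp_on p a b g
    & weak_deriv a b f g].

(* f is in W^{j,oo}(]a, b[) *)
Fixpoint Wjinfty (j : nat) a b f : Prop :=
  Linfty_on a b f /\
  if j is j'.+1 then
    {within `[a, b], continuous f} /\
    exists2 g, weak_deriv a b f g & Wjinfty j' a b g
  else True.

End Sobolev.

Section StoredEnergy.
Variables (R : realType) (k m : nat) (L0 : R).
Local Notation mu := (@lebesgue_measure R).

Definition dom_W (i : 'I_2) : set R := nth set0 [:: `[0, L0]%classic; `]0, +oo[%classic] i.

(* The derivative of W in p; p ranges over an open set, so the two-sided
   derivative of the library applies. *)
Definition dpW (W : R -> R -> R) (X p : R) : R := derive1 (W X) p.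

Record admissible_energy (W : R -> R -> R) : Prop := AdmissibleEnergy {
  energy_ge0 : forall X p : R, X \in `[0, L0] -> 0 < p -> 0 <= W X p;
  energy_cont : {within box dom_W, continuous (uncurry2 W)};
  energy_natural : forall X : R, X \in `[0, L0] -> W X 1 = 0;
  energy_C1 : forall X : R, X \in `[0, L0] -> Ck `]0, +oo[ 1 (W X);
  energy_dp_cont : {within box dom_W, continuous (uncurry2 (dpW W))};
  energy_growth : exists theta : R -> R,
    [/\ convex_function (`]0, +oo[ : set R) theta,
        theta p @[p --> 0^'+] --> +oo,
        theta p / p @[p --> +oo] --> +oo
      & forall X p : R, X \in `[0, L0] -> 0 < p -> theta p <= W X p];
  energy_convex : forall X : R, X \in `[0, L0] ->
    strictly_convex `]0, +oo[ (W X);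
  energy_fin : forall p : R, 0 < p ->
    (\int[mu]_(X in `[0%R, L0]) (W X p)%:E < +oo)%E;
  energy_dp_smooth :
    continuous_partials dom_W [pred w | (size w <= k + m)%N] (uncurry2 (dpW W));
  energy_dpp_gt0 : forall X p : R, X \in `[0, L0] -> 0 < p -> 0 < derive1 (dpW W X) p
}.

End StoredEnergy.

Section NutrientData.
Variables (R : realType) (k m : nat) (L0 : R).

Record admissible_nutrient (D0 beta0 : R -> R) (nL nR : R) : Prop :=
  AdmissibleNutrient {
  nutrient_D_smooth : Wjinfty (k + m) 0 L0 D0;
  nutrient_beta_smooth : Wjinfty (k + m) 0 L0 beta0;
  nutrient_D_bounds : exists Dmin Dmax : R,
    [/\ 0 < Dmin, 0 < Dmax & forall X : R, X \in `[0, L0] -> Dmin <= D0 X <= Dmax];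
  nutrient_beta_bounds : exists bmin bmax : R,
    [/\ 0 < bmin, 0 < bmax
      & forall X : R, X \in `[0, L0] -> bmin <= beta0 X <= bmax];
  nutrient_left_ge0 : 0 <= nL;
  nutrient_right_ge0 : 0 <= nR
}.

End NutrientData.

Section GrowthLaw.
Variables (R : realType) (k m : nat) (T L0 : R).

(* the space of bounded measurable functions, without a.e. identification *)
Definition calLinfty : set (R -> R) :=
  [set f : R -> R | measurable_fun `[0, L0] f /\ [bounded f X | X in `[0, L0]]].

Definition calLinfty_pos : set (R -> R) :=
  [set f : R -> R | calLinfty f /\ forall X : R, X \in `[0, L0] -> 0 < f X].

Definition pointwise_op (h : R -> R -> R) (f : R -> R) : R -> R :=
  fun X => h (f X) X.

Definition locally_lipschitz_fun (h : R -> R -> R) : Prop :=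
  forall z : R * R, 0 < z.1 -> z.2 \in `[0, L0] ->
    exists2 U : set (R * R), nbhs z U &
      [lipschitz (h x.1 x.2) | x in U `&` (`]0, +oo[ `*` `[0, L0])].

Definition locally_lipschitz_op (h : R -> R -> R) : Prop :=
  (forall f, calLinfty_pos f -> calLinfty (pointwise_op h f)) /\
  (forall f, calLinfty_pos f ->
     exists2 r : R, 0 < r & exists C : R, forall f1 f2,
       calLinfty_pos f1 -> calLinfty_pos f2 ->
       sup_norm `[0, L0] (f1 \- f) < r -> sup_norm `[0, L0] (f2 \- f) < r ->
       sup_norm `[0, L0] (pointwise_op h f1 \- pointwise_op h f2)
         <= C * sup_norm `[0, L0] (f1 \- f2)).

Definition barrier_solution (h : R -> R -> R) (u : R -> R -> R) : Prop :=
  [/\ Cm_curve calLinfty (sup_norm `[0, L0]) T 1 u,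
      forall t : R, t \in `[0, T] -> calLinfty_pos (u t),
      forall t : R, t \in `[0, T] ->
        curve_deriv (sup_norm `[0, L0]) T u t (pointwise_op h (u t))
    & forall X : R, X \in `[0, L0] -> u 0 X = 1].

Definition dom_G (i : 'I_4) : set R :=
  nth set0 [:: `]0, +oo[%classic; setT; `[0, +oo[%classic; `[0, L0]%classic] i.

Definition dom_GSN (i : 'I_3) : set R :=
  nth set0 [:: `]0, +oo[%classic; setT; `[0, +oo[%classic] i.

(* positions of the variables G, S, N, X among the arguments of calG *)
Definition vG : 'I_4 := 0%R.
Definition vS : 'I_4 := 1%R.
Definition vN : 'I_4 := 2%R.
Definition vX : 'I_4 := 3%R.

Definition orders_cont : pred (seq 'I_4) := fun w =>
  [&& (count_mem vG w + count_mem vN w <= (k + m).-1)%N,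
      (count_mem vS w <= m.-1)%N & (count_mem vX w <= k)%N].

Definition orders_lip : pred (seq 'I_4) := fun w =>
  (size w <= k)%N && (vS \notin w).

Record admissible_growth_law (calG : R -> R -> R -> R -> R) : Prop :=
  AdmissibleGrowthLaw {
  growth_barriers : exists G0 G1 : R -> R -> R,
    [/\ locally_lipschitz_fun G0 /\ locally_lipschitz_fun G1,
        locally_lipschitz_op G0 /\ locally_lipschitz_op G1,
        exists u0 u1 : R -> R -> R,
          [/\ barrier_solution G0 u0, barrier_solution G1 u1,
              forall t X : R, t \in `]0, T] -> X \in `[0, L0] -> u0 t X < u1 t X,
              (0 < ereal_inf [set (u0 z.1 z.2)%:E
                             | z in `[0%R, T] `*` `[0%R, L0]])%E
            & (ereal_sup [set (u1 z.1 z.2)%:E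
                         | z in `[0%R, T] `*` `[0%R, L0]] < +oo)%E]
      & forall G S N X : R, 0 < G -> 0 <= N -> X \in `[0, L0] ->
          G0 G X < calG G S N X < G1 G X];
  growth_partials : continuous_partials dom_G orders_cont (uncurry4 calG);
  growth_cont : forall X : R, X \in `[0, L0] ->
    {within box dom_GSN, continuous (uncurry3 (fun G S N => calG G S N X))};
  growth_lip : forall (Gam0 Gam1 Sig0 Sig1 H0 H1 : R) (w : seq 'I_4),
    0 < Gam0 < Gam1 -> Sig0 < Sig1 -> 0 <= H0 < H1 -> orders_lip w ->
    exists C : R, forall X G S N G' S' N' : R, X \in `[0, L0] ->
      G \in `[Gam0, Gam1] -> S \in `[Sig0, Sig1] -> N \in `[H0, H1] ->
      G' \in `[Gam0, Gam1] -> S' \in `[Sig0, Sig1] -> N' \in `[H0, H1] ->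
      let F := mixed_partial dom_G w (uncurry4 calG) in
      `|F (row4 G S N X)| <= C /\
      `|F (row4 G S N X) - F (row4 G' S' N' X)|
        <= C * (`|G - G'| + `|S - S'| + `|N - N'|)
}.

End GrowthLaw.

Section GrowthOperator.
Variables (R : realType) (L0 l0 : R) (W : R -> R -> R) (D0 beta0 : R -> R).
Variables (nL nR : R) (calG : R -> R -> R -> R -> R).
Local Notation mu := (@lebesgue_measure R).

(* the primitive g of G on [0, L0] with g(0) = 0 *)
Definition gmap (G : R -> R) (X : R) : R := \int[mu]_(x in `[0, X]) G x.

Definition ginv (G : R -> R) : R -> R := inverse_on `[0, L0] (gmap G).

Definition elastic_energy (G dphi : R -> R) : \bar R :=
  \int[mu]_(z in `]gmap G 0, gmap G L0[) (W (ginv G z) (dphi z))%:E.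

Definition competitor (G phi dphi : R -> R) : Prop :=
  [/\ W1p 1 (gmap G 0) (gmap G L0) phi dphi,
      {ae mu, forall z : R, z \in `]gmap G 0, gmap G L0[ -> 0 < dphi z},
      (elastic_energy G dphi < +oo)%E,
      phi (gmap G 0) = 0
    & phi (gmap G L0) = l0].

Definition minimizer (G phi : R -> R) : Prop :=
  exists2 dphi, competitor G phi dphi &
    forall psi dpsi, competitor G psi dpsi ->
      (elastic_energy G dphi <= elastic_energy G dpsi)%E.

(* [get P] is a choice of an element of P (junk when P is empty); the objects
   chosen below are unique on their domains. *)
Definition phi_of (G : R -> R) : R -> R := get [set phi | minimizer G phi].

Definition dphi_of (G : R -> R) : R -> R :=
  deriv_in `[gmap G 0, gmap G L0] (phi_of G).

Definition stress (G : R -> R) : R :=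
  get [set s | forall z : R, z \in `[gmap G 0, gmap G L0] ->
                 dpW W (ginv G z) (dphi_of G z) = s].

Definition y_of (G : R -> R) : R -> R := phi_of G \o gmap G.

Definition stretch (G : R -> R) : R -> R :=
  dphi_of G \o inverse_on `[gmap G 0, gmap G L0] (phi_of G).

Definition D_of (G : R -> R) (x : R) : R :=
  stretch G x * D0 (inverse_on `[0, L0] (y_of G) x).

Definition beta_of (G : R -> R) (x : R) : R :=
  (stretch G x)^-1 * beta0 (inverse_on `[0, L0] (y_of G) x).

Definition nutrient_solution (G n : R -> R) : Prop :=
  n 0 = nL /\ n l0 = nR /\
  exists2 dn, W1p 2 0 l0 n dn &
    forall psi, test_function 0 l0 psi ->
      \int[mu]_(x in `]0, l0[)
        (D_of G x * dn x * derive1 psi x + beta_of G x * n x * psi x) = 0.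

Definition n_of (G : R -> R) : R -> R := get [set n | nutrient_solution G n].

Definition nutrient (G : R -> R) : R -> R := n_of G \o y_of G.

Definition growth_op (G : R -> R) : R -> R :=
  fun X => calG (G X) (stress G) (nutrient G X) X.

Definition growth_solution (k m : nat) (T : R) (G : R -> R -> R) : Prop :=
  [/\ Cm_curve (Ck `[0, L0] k) (Ck_norm `[0, L0] k) T m G,
      forall t X : R, t \in `[0, T] -> X \in `[0, L0] -> 0 < G t X,
      forall t : R, t \in `[0, T] ->
        Ck `[0, L0] k (growth_op (G t)) /\
        curve_deriv (Ck_norm `[0, L0] k) T G t (growth_op (G t))
    & forall X : R, X \in `[0, L0] -> G 0 X = 1].

End GrowthOperator.

(* Main.v *)
(* For a fixed growth G the problem is explicit in the material coordinate X.
   By strict convexity a deformation with constant stress s is the minimizer; its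
   stretch is P(X, s), where P(X, .) inverts d_p W(X, .), and the length constraint
   int P(X, s) G dX = l0 determines s = S(G). The nutrient concentration N solves
   the linear system N' = (G / D0) q, q' = beta0 G N with boundary values n_L, n_R,
   hence is a combination of two fundamental solutions. Both S and N are Lipschitz
   in G for the sup norm on { c <= G <= C }.

   Picard iteration therefore solves the growth equation with G truncated to
   [c, C], where c and C are the bounds of the barriers; a solution cannot cross
   a barrier because the inequalities between the growth laws are strict, so the
   truncation is never active. Regularity in X follows by comparing difference
   quotients (through Gronwall's inequality) with the explicit solution of the
   linearized scalar equation in which S and N are regarded as given; regularity
   in t by differentiating the equation, the length constraint and the
   fundamental solutions. *)
Require Import Defs.
From mathcomp Require Import all_boot all_order all_algebra.
From mathcomp Require Import all_classical all_reals all_analysis.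
From mathcomp Require Import measurable_realfun.
From mathcomp Require Import ring lra zify.
Import Order.TTheory GRing.Theory Num.Theory.
Import numFieldNormedType.Exports.
Local Open Scope classical_set_scope.
Local Open Scope ring_scope.

Set Implicit Arguments.
Unset Strict Implicit.
Unset Printing Implicit Defensive.

(** * Limits, derivatives and primitives relative to a set *)

(** The fixed point is sought among continuous functions on [0, T] x [0, L0] only; smoothness is
    recovered afterwards. For a C^m curve in C^k it is enough that the mixed derivatives exist and
    are jointly continuous, since continuity on a compact rectangle is uniform. The obstacle is that
    the growth law has only m - 1 derivatives in the stress, none if m = 1, while the stress is a
    nonlocal function of the growth. Differentiation in X avoids it, because the stress is constant
    in X; and N' = (G / D0) q gives N one X-derivative more than G, so that each round of the
    linearized equation gains a derivative of G. In time, the growth equation itself yields the next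
    derivative, and its right-hand side consumes exactly the available orders k + m - 1, m - 1 and
    k. Time derivatives of S and N come from exact increment formulas (length constraint, variation
    of constants) in which the unknown at the moving time enters only through its continuity.
    Contractions are taken in sup norms with an exponential weight, where one integration gains the
    inverse of the rate. *)

Section Limits.
Variable R : realType.

(** The filter is not deleted: if [A x] holds, a limit at [x] can only be [f x]. This is what gives
    a Carathéodory slope the right value at its base point. *)
Definition limw (U : topologicalType) (A : set U) (f : U -> R) (x : U) (l : R) :=
  f @ within A (nbhs x) --> l.

Definition contw (U : topologicalType) (A : set U) (f : U -> R) :=
  forall x, A x -> limw A f x (f x).

Lemma contwP (U : topologicalType) (A : set U) (f : U -> R) :
  {within A, continuous f} <-> contw A f.
Proof. exact: subspace_continuousP. Qed.

Lemma limwP (U : pseudoMetricType R) (A : set U) (f : U -> R) x l :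
  limw A f x l <->
  forall e, 0 < e -> exists2 d, 0 < d &
    forall y, A y -> ball x d y -> `|f y - l| <= e.
Proof.
split=> [h e e0|h].
  have /cvgrPdist_le /(_ _ e0) := h.
  rewrite near_withinE => /nbhs_ballP[d /= d0 hd].
  by exists d => // y Ay bxy; rewrite distrC; apply: hd.
apply/cvgrPdist_le => e e0; have [d d0 hd] := h _ e0.
rewrite near_withinE; apply/nbhs_ballP; exists d => //= y bxy Ay.
by rewrite distrC; exact: hd.
Qed.

Section Ops.
Variables (U : topologicalType) (A : set U).
Implicit Types (f g : U -> R) (x : U) (a b l : R).

Lemma limw_eq f g x l : (forall y, A y -> f y = g y) -> limw A f x l -> limw A g x l.
Proof.
move=> fg; apply: cvg_trans; apply: near_eq_cvg.
by rewrite near_withinE; apply: nearW => y /fg.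
Qed.

Lemma limw_sub (B : set U) f x l : B `<=` A -> limw A f x l -> limw B f x l.
Proof.
move=> BA; apply: cvg_trans => P; rewrite /limw !nbhs_simpl /within /= => h.
by apply: filterS h => y h By; apply: h; exact: BA.
Qed.

Lemma limw_cst a x : limw A (fun=> a) x a.
Proof. exact: cvg_cst. Qed.

Lemma limwD f g x a b : limw A f x a -> limw A g x b ->
  limw A (fun y => f y + g y) x (a + b).
Proof. exact: cvgD. Qed.

Lemma limwN f x a : limw A f x a -> limw A (fun y => - f y) x (- a).
Proof. exact: cvgN. Qed.

Lemma limwB f g x a b : limw A f x a -> limw A g x b ->
  limw A (fun y => f y - g y) x (a - b).
Proof. exact: cvgB. Qed.

Lemma limwM f g x a b : limw A f x a -> limw A g x b ->
  limw A (fun y => f y * g y) x (a * b).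
Proof. exact: cvgM. Qed.

Lemma limwV f x a : a != 0 -> limw A f x a ->
  limw A (fun y => (f y)^-1) x a^-1.
Proof. by move=> a0; apply: cvgV. Qed.

Lemma limw_comp (V : topologicalType) (B : set V) (f : U -> V) (g : V -> R) x y l :
  (forall z, A z -> B (f z)) -> f @ within A (nbhs x) --> y -> limw B g y l ->
  limw A (g \o f) x l.
Proof.
move=> AB fx gy P /gy BP; have := fx _ BP.
rewrite !nbhs_simpl /within /= => h.
by apply: filterS h => z h Az; apply: (h Az); exact: AB.
Qed.

Lemma contw_eq f g : (forall y, A y -> f y = g y) -> contw A f -> contw A g.
Proof. by move=> fg cf x Ax; apply: (limw_eq fg); rewrite -fg //; exact: cf. Qed.

Lemma contw_cst a : contw A (fun=> a).
Proof. by move=> x _; exact: limw_cst. Qed.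

Lemma contwD f g : contw A f -> contw A g -> contw A (fun y => f y + g y).
Proof. by move=> cf cg x Ax; apply: limwD; [exact: cf|exact: cg]. Qed.

Lemma contwN f : contw A f -> contw A (fun y => - f y).
Proof. by move=> cf x Ax; apply: limwN; exact: cf. Qed.

Lemma contwB f g : contw A f -> contw A g -> contw A (fun y => f y - g y).
Proof. by move=> cf cg; apply: contwD => //; exact: contwN. Qed.

Lemma contwM f g : contw A f -> contw A g -> contw A (fun y => f y * g y).
Proof. by move=> cf cg x Ax; apply: limwM; [exact: cf|exact: cg]. Qed.

Lemma contwV f : (forall x, A x -> f x != 0) -> contw A f ->
  contw A (fun y => (f y)^-1).
Proof. by move=> f0 cf x Ax; apply: limwV; [exact: f0|exact: cf]. Qed.

Lemma contw_comp (V : topologicalType) (B : set V) (f : U -> V) (g : V -> R) :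
  (forall z, A z -> B (f z)) ->
  (forall x, A x -> f @ within A (nbhs x) --> f x) -> contw B g ->
  contw A (g \o f).
Proof. by move=> AB cf cg x Ax; apply: (limw_comp AB (cf _ Ax)); apply/cg/AB. Qed.

Lemma contw_comp_continuous (f : U -> R) (g : R -> R) :
  contw A f -> continuous g -> contw A (g \o f).
Proof. by move=> cf cg x Ax; apply: (cvg_comp _ _ (cf x Ax)); exact: cg. Qed.

Lemma contw_sub (B : set U) f : B `<=` A -> contw A f -> contw B f.
Proof. by move=> BA cf x Bx; apply: (limw_sub BA); apply/cf/BA. Qed.

Lemma continuous_contw f : continuous f -> contw A f.
Proof. by move=> cf x Ax; apply: cvg_within_filter; exact: cf. Qed.

End Ops.

Lemma within_pair (U V W : topologicalType) (A : set U) (f : U -> V) (g : U -> W) (x : U)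
    (y : V) (z : W) :
  f @ within A (nbhs x) --> y -> g @ within A (nbhs x) --> z ->
  (fun u => (f u, g u)) @ within A (nbhs x) --> (y, z).
Proof. exact: cvg_pair. Qed.

(** Heine-Cantor through the near-covering form of compactness: the parameter is the radius, tending
    to 0 from the right, and half of the local radius leaves room for the triangle inequality. *)
Lemma compact_unif (U : pseudoMetricType R) (A : set U) (f : U -> R) e :
  compact A -> contw A f -> 0 < e ->
  exists2 d, 0 < d & forall x y, A x -> A y -> ball x d y -> `|f x - f y| <= e.
Proof.
move=> cA cf e0.
have e20 : 0 < e / 2 by lra.
have /compact_near_coveringP/near_covering_withinP cov := cA.
have : \forall d \near 0^'+, A `<=` [set x | forall y, A y -> ball x d y -> `|f x - f y| <= e].
  apply: cov => x Ax.
  have /limwP /(_ _ e20)[d d0 hd] := cf x Ax.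
  near=> z t => /= Az y Ay bzy.
  have xz : ball x (d / 2) z by near: z; apply: nbhsx_ballx; rewrite divr_gt0.
  have xy : ball x d y.
    rewrite [d]splitr; apply: ball_triangle xz _.
    apply: le_ball bzy; near: t; apply: nbhs_right_le; by rewrite divr_gt0.
  have h1 := hd _ Ay xy.
  have h2 : `|f z - f x| <= e / 2 by apply: hd Az (le_ball _ xz); lra.
  rewrite (_ : f z - f y = (f z - f x) - (f y - f x)); last by ring.
  by rewrite (le_trans (ler_normB _ _)) // [e]splitr lerD.
move=> [d /= d0 hd]; exists (d / 2); first by rewrite divr_gt0.
move=> x y Ax Ay bxy; apply: (hd (d/2)) => //=.
  by rewrite sub0r normrN gtr0_norm ?divr_gt0 // ltr_pdivrMr // ltr_pMr // ltr1n.
by rewrite divr_gt0.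
Unshelve. all: by end_near. Qed.

Lemma compact_bound (U : topologicalType) (A : set U) (f : U -> R) :
  compact A -> contw A f -> exists2 M, 0 < M & forall x, A x -> `|f x| <= M.
Proof.
move=> cA /contwP cf.
have /compact_bounded [M [_ hM]] := continuous_compact cf cA.
exists (Num.max 1 (M + 1)); first by rewrite lt_max ltr01.
move=> x Ax; apply: hM; last by exists x.
by rewrite lt_max ltrDl ltr01 orbT.
Qed.

Lemma compact_pos_bound (U : topologicalType) (A : set U) (f : U -> R) :
  compact A -> contw A f -> (forall x, A x -> 0 < f x) ->
  exists2 c, 0 < c & forall x, A x -> c <= f x.
Proof.
move=> cA cf f0.
have [M M0 hM] := compact_bound cA (contwV (fun x Ax => lt0r_neq0 (f0 x Ax)) cf).
exists M^-1; first by rewrite invr_gt0.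
move=> x Ax; have := hM x Ax; have fx := f0 x Ax.
by rewrite ger0_norm ?invr_ge0 ?(ltW fx) // => h; rewrite -[f x]invrK lef_pV2 // posrE invr_gt0.
Qed.

End Limits.

(** * Derivatives relative to a set, and the mean value theorem *)

Section HasD.
Variable R : realType.
Implicit Types (D : set R) (f g : R -> R) (x y l : R).

(* Carathéodory's form of the derivative relative to [D]. *)
Definition hasD D f x l := exists2 phi : R -> R,
  (forall y, D y -> f y - f x = phi y * (y - x)) & limw D phi x l.

Lemma hasDe D f x l : hasD D f x l <->
  forall e, 0 < e -> exists2 d, 0 < d & forall y, D y -> `|y - x| < d ->
    `|f y - f x - l * (y - x)| <= e * `|y - x|.
Proof.
split=> [[phi hphi /limwP h] e e0|h].
  have [d d0 hd] := h _ e0; exists d => // y Dy yx.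
  rewrite hphi // -mulrBl normrM ler_wpM2r //; apply: hd => //.
  by rewrite /ball /= distrC.
exists (fun y => if y == x then l else (f y - f x) / (y - x)).
  move=> y Dy; case: eqVneq => [->|yx]; first by rewrite !subrr mulr0.
  by rewrite divfK // subr_eq0.
apply/limwP => e e0; have [d d0 hd] := h _ e0; exists d => // y Dy.
rewrite /ball /= distrC => yx; case: eqVneq => [_|nyx].
  by rewrite subrr normr0 ltW.
have nz : y - x != 0 by rewrite subr_eq0.
have := hd _ Dy yx.
have -> : f y - f x - l * (y - x) = ((f y - f x) / (y - x) - l) * (y - x).
  by rewrite mulrBl divfK.
by rewrite normrM ler_pM2r // normr_gt0.
Qed.

Lemma hasD_ratio D f x l :
  hasD D f x l <-> (f y - f x) / (y - x) @[y --> within D x^'] --> l.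
Proof.
split=> [[phi hphi lphi]|h].
  have : phi @ within D x^' --> l.
    apply: cvg_trans lphi => P; rewrite !nbhs_simpl /within /= => hP.
    rewrite nearE /dnbhs /within /=.
    by apply: filterS hP => y hy _; exact: hy.
  apply: cvg_trans; apply: near_eq_cvg; rewrite near_withinE.
  rewrite nearE /dnbhs /within /=; apply: nearW => y yx Dy.
  by rewrite hphi // mulfK // subr_eq0.
apply/hasDe => e e0; have /cvgrPdist_le /(_ _ e0) := h.
rewrite near_withinE nearE /dnbhs /within /= => /nbhs_ballP[d /= d0 hd].
exists d => // y Dy yx; have [->|nyx] := eqVneq y x.
  by rewrite !subrr mulr0 subrr normr0 mulr0.
have nz : y - x != 0 by rewrite subr_eq0.
have := hd y; rewrite /ball /= distrC => /(_ yx nyx Dy).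
rewrite distrC.
have -> : f y - f x - l * (y - x) = ((f y - f x) / (y - x) - l) * (y - x).
  by rewrite mulrBl divfK.
by rewrite normrM ler_pM2r // normr_gt0.
Qed.

Lemma hasD_cont D f x l : hasD D f x l -> limw D f x (f x).
Proof.
move=> [phi hphi lphi].
apply: (@limw_eq _ _ _ (fun y => phi y * (y - x) + f x)).
  by move=> y Dy; rewrite -hphi // subrK.
have -> : limw D (fun y => phi y * (y - x) + f x) x (f x) =
   limw D (fun y => phi y * (y - x) + f x) x (l * (x - x) + f x).
  by rewrite subrr mulr0 add0r.
apply: limwD; last exact: limw_cst.
apply: limwM => //; apply: limwB; last exact: limw_cst.
exact: cvg_within.
Qed.

Lemma hasD_eq D f g x l : D x -> (forall y, D y -> f y = g y) ->
  hasD D f x l -> hasD D g x l.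
Proof.
move=> Dx fg [phi h lp]; exists phi => // y Dy.
by rewrite -!fg // h.
Qed.

Lemma hasD_sub D D' f x l : D' `<=` D -> hasD D f x l -> hasD D' f x l.
Proof.
move=> DD [phi h lp]; exists phi; last exact: limw_sub lp.
by move=> y /DD; exact: h.
Qed.

Lemma hasD_cst D a x : hasD D (fun=> a) x 0.
Proof. by exists (fun=> 0); [move=> y _; rewrite subrr mul0r|exact: limw_cst]. Qed.

Lemma hasD_id D x : hasD D id x 1.
Proof. by exists (fun=> 1); [move=> y _; rewrite mul1r|exact: limw_cst]. Qed.

Lemma hasDD D f g x a b : hasD D f x a -> hasD D g x b ->
  hasD D (fun y => f y + g y) x (a + b).
Proof.
move=> [p hp lp] [q hq lq]; exists (fun y => p y + q y); last exact: limwD.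
by move=> y Dy; rewrite mulrDl -hp // -hq //; ring.
Qed.

Lemma hasDM D f g x a b : hasD D f x a -> hasD D g x b ->
  hasD D (fun y => f y * g y) x (a * g x + f x * b).
Proof.
move=> hf hg; have cg := hasD_cont hg.
case: hf hg => [p hp lp] [q hq lq]; exists (fun y => p y * g y + f x * q y).
  move=> y Dy; rewrite mulrDl mulrAC -hp // -mulrA -hq //; ring.
by apply: limwD; apply: limwM => //; exact: limw_cst.
Qed.

Lemma hasDZ D f x a c : hasD D f x a -> hasD D (fun y => c * f y) x (c * a).
Proof. by move=> /(hasDM (hasD_cst D c x)); rewrite mul0r add0r. Qed.

Lemma hasDN D f x a : hasD D f x a -> hasD D (fun y => - f y) x (- a).
Proof.
move=> /(hasDZ (-1)); rewrite mulN1r.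
by congr hasD; apply/funext => y; rewrite mulN1r.
Qed.

Lemma hasDB D f g x a b : hasD D f x a -> hasD D g x b ->
  hasD D (fun y => f y - g y) x (a - b).
Proof. by move=> hf hg; apply: hasDD => //; exact: hasDN. Qed.

(** In Carathéodory's form the two slope functions multiply, so points with [g y = g x] need no
    separate treatment. *)
Lemma hasD_comp D D' f g x a b : (forall y, D y -> D' (g y)) ->
  hasD D g x b -> hasD D' f (g x) a -> hasD D (f \o g) x (a * b).
Proof.
move=> DD hg; have cg := hasD_cont hg.
case: hg => [q hq lq] [p hp lp].
exists (fun y => p (g y) * q y).
  by move=> y Dy; rewrite /= hp ?hq // ?mulrA //; exact: DD.
by apply: limwM => //; apply: limw_comp DD cg lp.
Qed.

Lemma hasDV D f x a : D x -> (forall y, D y -> f y != 0) -> hasD D f x a ->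
  hasD D (fun y => (f y)^-1) x (- a / (f x ^+ 2)).
Proof.
move=> Dx f0 hf; have cf := hasD_cont hf.
case: hf => [p hp lp]; exists (fun y => - p y * (f y * f x)^-1).
  move=> y Dy; have -> : - p y / (f y * f x) * (y - x) = - (p y * (y - x)) / (f y * f x) by ring.
  rewrite -hp //; field; by rewrite !f0.
apply: limwM; first exact: limwN.
apply: limwV; first by rewrite expf_neq0 // f0.
by rewrite expr2; apply: limwM => //; exact: limw_cst.
Qed.

(** The base point must be an accumulation point of [D]: at an isolated point every number is a
    derivative. *)
Lemma hasD_uniq D f x a b :
  (forall d, 0 < d -> exists y, [/\ D y, y != x & `|y - x| < d]) ->
  hasD D f x a -> hasD D f x b -> a = b.
Proof.
move=> acc /hasDe ha /hasDe hb; apply/eqP; rewrite -subr_eq0 -normr_le0.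
apply/ler_addgt0Pl => e e0; rewrite addr0.
have e20 : 0 < e / 2 by lra.
have [d1 d10 h1] := ha _ e20; have [d2 d20 h2] := hb _ e20.
have [|y [Dy nyx yx]] := acc (Num.min d1 d2); first by rewrite lt_min d10.
move: yx; rewrite lt_min => /andP[y1 y2].
have {}h1 := h1 _ Dy y1; have {}h2 := h2 _ Dy y2.
have p : 0 < `|y - x| by rewrite normr_gt0 subr_eq0.
rewrite -(ler_pM2r p) -normrM.
rewrite (_ : (a - b) * (y - x) = (f y - f x - b * (y - x)) - (f y - f x - a * (y - x))); last by ring.
apply: (le_trans (ler_normB _ _)); rewrite [e]splitr mulrDl; exact: lerD.
Qed.

Lemma itv_acc a b x : a < b -> a <= x <= b -> forall d, 0 < d ->
  exists y, [/\ [set` `[a, b]] y, y != x & `|y - x| < d].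
Proof.
move=> ab /andP[ax xb] d d0.
have [xb'|xb'] := ltP x b.
  exists (x + Num.min (d / 2) (b - x)).
  have p : 0 < Num.min (d / 2) (b - x) by rewrite lt_min divr_gt0 // subr_gt0.
  have p1 : Num.min (d / 2) (b - x) <= d / 2 by rewrite ge_min lexx.
  have p2 : Num.min (d / 2) (b - x) <= b - x by rewrite ge_min lexx orbT.
  split; first by rewrite /= in_itv /=; apply/andP; split; lra.
    by rewrite gt_eqF //; lra.
  by rewrite addrAC subrr add0r gtr0_norm //; lra.
exists (x - Num.min (d / 2) (x - a)).
have p : 0 < Num.min (d / 2) (x - a) by rewrite lt_min divr_gt0 //= subr_gt0; lra.
have p1 : Num.min (d / 2) (x - a) <= d / 2 by rewrite ge_min lexx.
have p2 : Num.min (d / 2) (x - a) <= x - a by rewrite ge_min lexx orbT.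
split; first by rewrite /= in_itv /=; apply/andP; split; lra.
  by rewrite lt_eqF //; lra.
by rewrite addrAC subrr add0r normrN gtr0_norm //; lra.
Qed.

Lemma hasD_itv_uniq (a b : R) f x l l' : a < b -> a <= x <= b ->
  hasD `[a, b] f x l -> hasD `[a, b] f x l' -> l = l'.
Proof. by move=> ab axb; apply: hasD_uniq; exact: itv_acc. Qed.

Lemma hasD_is_derive D f x l : nbhs x D -> hasD D f x l -> is_derive x (1 : R) f l.
Proof.
move=> nD /hasDe h.
have H : h^-1 *: (f (h *: (1:R) + x) - f x) @[h --> (0:R)^'] --> l.
  apply/cvgrPdist_le => e e0; have [d d0 hd] := h _ e0.
  have /nbhs_ballP[d' /= d'0 hd'] := nD.
  rewrite nearE /dnbhs /within /=; apply/nbhs_ballP.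
  exists (Num.min d d'); first by rewrite /= lt_min d0.
  move=> t; rewrite /ball /= sub0r normrN lt_min => /andP[td td'] t0.
  rewrite /GRing.scale /= mulr1 distrC.
  have /hd : D (t + x) by apply: hd'; rewrite /ball /= opprD addrCA subrr addr0 normrN.
  rewrite addrK => /(_ td) {}hd.
  rewrite -(@ler_pM2r _ `|t|) ?normr_gt0 // -normrM mulrBl mulrAC mulVf // mul1r.
  by rewrite addrC addrA -opprB addrC in hd *; rewrite ?opprB in hd *.
split; first by apply/cvg_ex; exists l.
by apply/cvg_lim.
Qed.

Lemma is_derive_hasD D f x l : is_derive x (1 : R) f l -> hasD D f x l.
Proof.
move=> [df fl]; have /cvgrPdist_le H : h^-1 *: (f (h *: (1:R) + x) - f x) @[h --> (0:R)^'] --> l.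
  by rewrite -fl; exact: df.
apply/hasDe => e e0; have := H _ e0.
rewrite nearE /dnbhs /within /= => /nbhs_ballP[d /= d0 hd].
exists d => // y _ yx; have [->|nyx] := eqVneq y x.
  by rewrite !subrr mulr0 subrr normr0 mulr0.
have nz : y - x != 0 by rewrite subr_eq0.
have := hd (y - x); rewrite /ball /= sub0r normrN => /(_ yx nz).
rewrite /GRing.scale /= mulr1 subrK distrC => h.
have -> : f y - f x - l * (y - x) = ((y - x)^-1 * (f y - f x) - l) * (y - x).
  by rewrite mulrBl mulrAC mulVf // mul1r.
by rewrite normrM ler_pM2r // normr_gt0.
Qed.

Lemma hasD_expR D x : hasD D expR x (expR x).
Proof. by apply: is_derive_hasD; exact: is_derive_expR. Qed.

Section MeanValue.
Variables (a b : R) (f f' : R -> R).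
Hypothesis df : forall x, a <= x <= b -> hasD `[a, b] f x (f' x).

Lemma hasD_contw : contw `[a, b]%classic f.
Proof. by move=> x; rewrite /= in_itv /= => /df /hasD_cont. Qed.

Lemma mvt : a <= b -> exists2 c, a <= c <= b & f b - f a = f' c * (b - a).
Proof.
rewrite le_eqVlt => /predU1P[->|ab].
  by exists b; rewrite ?lexx // !subrr mulr0.
have cf : {within `[a, b], continuous f} by apply/contwP; exact: hasD_contw.
have dff x : x \in `]a, b[ -> is_derive x (1 : R) f (f' x).
  move=> xab; apply: (@hasD_is_derive `[a, b]).
    have := near_in_itvoo xab; apply: filterS => z.
    exact: subset_itv_oo_cc.
  by apply: df; move: xab; rewrite in_itv /= => /andP[/ltW -> /ltW ->].
have [c cab ->] := @MVT _ f f' a b ab dff cf.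
by exists c => //; move: cab; rewrite in_itv /= => /andP[/ltW -> /ltW ->].
Qed.

Lemma mvt_bound M : a <= b -> (forall x, a <= x <= b -> `|f' x| <= M) ->
  `|f b - f a| <= M * (b - a).
Proof.
move=> ab hM; have [c cab ->] := mvt ab.
by rewrite normrM (ger0_norm (_ : 0 <= b - a)) ?subr_ge0 // ler_wpM2r ?subr_ge0 // hM.
Qed.

Lemma mvt_le : a <= b -> (forall x, a <= x <= b -> 0 <= f' x) -> f a <= f b.
Proof.
move=> ab h; have [c cab e] := mvt ab.
by rewrite -subr_ge0 e mulr_ge0 ?h ?subr_ge0.
Qed.

End MeanValue.

Lemma itv_subset (a b c d : R) : a <= c -> d <= b -> `[c, d]%classic `<=` `[a, b]%classic.
Proof. by move=> ac db x; rewrite /= !in_itv /= => /andP[cx xd]; rewrite (le_trans ac) // (le_trans xd). Qed.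

Lemma mvt_conv D f f' x y :
  (forall z, Num.min x y <= z <= Num.max x y -> D z) ->
  (forall z, D z -> hasD D f z (f' z)) ->
  exists2 c, Num.min x y <= c <= Num.max x y & f y - f x = f' c * (y - x).
Proof.
move=> cD df; have [xy|yx] := leP x y.
  have [||c cxy e] := @mvt x y f f'; last by exists c.
    move=> z zxy; have Dz : D z by apply: cD; rewrite min_l // max_r.
    apply: hasD_sub (df z Dz) => t; rewrite /= in_itv /= => txy.
    by apply: cD; rewrite min_l // max_r.
  by [].
have yx' := ltW yx.
have [||c cxy e] := @mvt y x f f'.
- move=> z zxy; have Dz : D z by apply: cD; rewrite min_r // max_l.
  apply: hasD_sub (df z Dz) => t; rewrite /= in_itv /= => txy.
  by apply: cD; rewrite min_r // max_l.
- by [].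
by exists c => //; rewrite -opprB e -mulrN opprB.
Qed.

End HasD.

(** * The primitive [gmap] and comparison by monotonicity *)

Section Primitive.
Variable R : realType.
Local Notation mu := (@lebesgue_measure R).
Implicit Types (f g F : R -> R) (L X : R).

Definition clamp (a b x : R) : R := Num.max a (Num.min b x).

Lemma clamp_id a b x : a <= x <= b -> clamp a b x = x.
Proof. by move=> /andP[ax xb]; rewrite /clamp min_r // max_r. Qed.

Lemma clamp_itv a b x : a <= b -> a <= clamp a b x <= b.
Proof.
move=> ab; rewrite /clamp le_max lexx /=.
by rewrite ge_max ab /= ge_min lexx.
Qed.

Lemma clamp_dist a b x y : a <= b -> `|clamp a b x - clamp a b y| <= `|x - y|.
Proof.
move=> ab; rewrite /clamp.
wlog xy : x y / x <= y => [h|].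
  have [/h//|/ltW/h] := leP x y.
  by rewrite distrC (distrC x y).
rewrite (distrC x) (ger0_norm (_ : 0 <= y - x)) ?subr_ge0 //.
rewrite /Order.max /Order.min.
by case: (ltP b x); case: (ltP b y); case: (ltP a b); case: (ltP a x); case: (ltP a y) => *; rewrite ler_norml; apply/andP; split; lra.
Qed.

Lemma continuous_clamp a b : a <= b -> continuous (clamp a b).
Proof.
move=> ab x; apply/cvgrPdist_le => e e0.
apply/nbhs_ballP; exists e => // y bxy.
by rewrite (le_trans (clamp_dist _ _ ab)) // ltW.
Qed.

Lemma contw_clamp (L : R) f : 0 <= L -> contw `[0, L] f -> continuous (f \o clamp 0 L).
Proof.
move=> L0 cf x; apply/cvgrPdist_le => e e0.
have /(cf _)/limwP/(_ _ e0)[d d0 hd] : [set` `[0, L]] (clamp 0 L x).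
  by rewrite /= in_itv /= clamp_itv.
near=> y; rewrite /= distrC; apply: hd; first by rewrite /= in_itv /= clamp_itv.
rewrite /ball /=; apply: (le_lt_trans (clamp_dist _ _ L0)).
near: y; exact: (@cvgr_dist_lt _ _ _ (nbhs x) _ id).
Unshelve. all: by end_near. Qed.

Lemma continuous_itv_integrable (a b : R) f : {within `[a, b], continuous f} ->
  mu.-integrable `[a, b] (EFin \o f).
Proof. by move=> cf; apply: continuous_compact_integrable => //; exact: segment_compact. Qed.

(** Extending the integrand by its end values and starting the integral at -1 makes every point of
    [0, L] interior, so the two-sided fundamental theorem also serves at the end points. *)
Lemma hasD_gmap L f X : contw `[0, L] f -> 0 <= X <= L -> hasD `[0, L] (gmap f) X (f X).
Proof.
move=> cf /andP[X0 XL]; have L0 := le_trans X0 XL.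
pose g := f \o clamp 0 L; have cg := contw_clamp L0 cf.
pose F (y : R) := \int[mu]_(x in `[-1, y]) g x.
have ig (y : R) : mu.-integrable `[-1, y] (EFin \o g).
  by apply: continuous_itv_integrable; apply: continuous_subspaceT.
have dF (y : R) : 0 <= y -> is_derive y (1 : R) F (g y).
  move=> y0; have [||] := @continuous_FTC1_closed R g (-1) y (y + 1) _ (ig _) _ (cg y).
  - by rewrite ltrDl.
  - by lra.
  move=> d1 d2; split; first exact: d1.
  by rewrite -d2 derive1E.
have gE y : [set` `[0, L]] y -> F y - F 0 = gmap f y.
  rewrite /= in_itv /= => /andP[y0 yL]; rewrite /F /gmap.
  rewrite (@Rintegral_itvB R g (BLeft (-1)) (BRight y) 0) //; last first.
    by rewrite bnd_simp; lra.
  rewrite Rintegral_itv_obnd_cbnd; last first.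
    apply: (integrableS _ _ _ (ig y)) => //.
    by apply: subset_itvr; rewrite bnd_simp; lra.
  apply: eq_Rintegral => z; rewrite inE /= in_itv /= => /andP[z0 zy].
  by rewrite /g /= clamp_id // z0 (le_trans zy).
have DX : [set` `[0, L]] X by rewrite /= in_itv /= X0.
apply: (hasD_eq DX gE).
have -> : f X = g X - 0 by rewrite subr0 /g /= clamp_id // X0.
apply: hasDB; last exact: hasD_cst.
by apply: is_derive_hasD; exact: dF.
Qed.

Lemma gmap0 f : gmap f 0 = 0.
Proof. by rewrite /gmap set_itv1 Rintegral_set1. Qed.

Lemma gmap_cst0 X : gmap (fun=> 0 : R) X = 0.
Proof. by rewrite /gmap /Rintegral integral0_eq. Qed.

Lemma contw_gmap L f : contw `[0, L] f -> contw `[0, L] (gmap f).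
Proof.
by move=> cf X DX; apply: hasD_cont; apply: hasD_gmap => //; rewrite /= in_itv /= in DX.
Qed.

Lemma hasD_eq0_const L F : (forall x, 0 <= x <= L -> hasD `[0, L] F x 0) ->
  forall x, 0 <= x <= L -> F x = F 0.
Proof.
move=> h x /andP[x0 xL]; apply/eqP; rewrite -subr_eq0 -normr_le0.
have := @mvt_bound _ 0 x F (fun=> 0) _ 0 x0; rewrite mul0r; apply; last by rewrite normr0.
move=> y /andP[y0 yx].
have : hasD `[0, L] F y 0 by apply: h; rewrite y0 (le_trans yx).
by apply: hasD_sub; exact: itv_subset.
Qed.

Lemma gmap_uniq L F f : contw `[0, L] f ->
  (forall x, 0 <= x <= L -> hasD `[0, L] F x (f x)) ->
  forall x, 0 <= x <= L -> F x = F 0 + gmap f x.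
Proof.
move=> cf h x xL; apply/eqP; rewrite -subr_eq; apply/eqP.
have := @hasD_eq0_const L (fun x => F x - gmap f x) _ x xL.
rewrite gmap0 subr0; apply=> y yL.
by have := hasDB (h y yL) (hasD_gmap cf yL); rewrite subrr.
Qed.

(** [C / lam * expR (lam * x)] has derivative [C * expR (lam * x)], so its sum and its difference
    with [F] are both nondecreasing. In the norm weighted by [expR (lam * x)] one integration thus
    gains the factor [1 / lam]; every contraction below takes [lam] to be at least twice the
    relevant Lipschitz constant. *)
Lemma hasD_exp_bound L F f C lam : 0 < lam -> F 0 = 0 -> 0 <= C ->
  (forall x, 0 <= x <= L -> hasD `[0, L] F x (f x)) ->
  (forall x, 0 <= x <= L -> `|f x| <= C * expR (lam * x)) ->
  forall x, 0 <= x <= L -> `|F x| <= C / lam * expR (lam * x).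
Proof.
move=> l0 F0 C0 dF fb x /andP[x0 xL].
pose E x := C / lam * expR (lam * x).
have dE y : hasD `[0, L] E y (C * expR (lam * y)).
  have -> : C * expR (lam * y) = C / lam * (expR (lam * y) * (lam * 1)).
    by field; rewrite gt_eqF.
  apply: hasDZ; apply: (@hasD_comp _ _ setT expR (fun y => lam * y)) => //.
    by apply: hasDZ; exact: hasD_id.
  exact: hasD_expR.
have E0 : 0 <= E 0 by rewrite /E mulr0 expR0 mulr1 divr_ge0 // ltW.
have sub : `[0, x]%classic `<=` `[0, L]%classic by exact: itv_subset.
have in_ y : 0 <= y <= x -> 0 <= y <= L by move=> /andP[-> /le_trans ->].
rewrite -/(E x) ler_norml; apply/andP; split.
  rewrite lerNl -subr_ge0 opprK.
  have : E 0 + F 0 <= E x + F x.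
    apply: (@mvt_le _ 0 x (fun y => E y + F y) (fun y => C * expR (lam * y) + f y)) => // y yx.
      by apply: (hasD_sub sub); apply: hasDD => //; exact/dF/in_.
    by have := fb _ (in_ _ yx); rewrite ler_norml => /andP[+ _]; lra.
  by rewrite F0; lra.
rewrite -subr_ge0.
have : E 0 - F 0 <= E x - F x.
  apply: (@mvt_le _ 0 x (fun y => E y - F y) (fun y => C * expR (lam * y) - f y)) => // y yx.
    by apply: (hasD_sub sub); apply: hasDB => //; exact/dF/in_.
  by have := fb _ (in_ _ yx); rewrite ler_norml => /andP[_ +]; lra.
by rewrite F0; lra.
Qed.

Lemma hasD_mono L F f : (forall x, 0 <= x <= L -> hasD `[0, L] F x (f x)) ->
  (forall x, 0 <= x <= L -> 0 <= f x) ->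
  forall x y, 0 <= x -> x <= y -> y <= L -> F x <= F y.
Proof.
move=> dF f0 x y x0 xy yL.
apply: (@mvt_le _ x y F f) => // z /andP[xz zy].
  apply: hasD_sub (dF z _); first exact: itv_subset.
  by rewrite (le_trans x0) //= (le_trans zy).
by apply: f0; rewrite (le_trans x0) //= (le_trans zy).
Qed.

Lemma gmap_bound L f C X : contw `[0, L] f -> (forall x, 0 <= x <= L -> `|f x| <= C) ->
  0 <= X <= L -> `|gmap f X| <= C * X.
Proof.
move=> cf fC /andP[X0 XL]; rewrite -[gmap f X]subr0 -(gmap0 f) -{2}[X]subr0.
have in_ y : 0 <= y <= X -> 0 <= y <= L by move=> /andP[-> /le_trans ->].
apply: (@mvt_bound _ 0 X _ f) => // y /in_ yX; last exact: fC.
by apply: hasD_sub (hasD_gmap cf yX); exact: itv_subset.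
Qed.

Lemma gmapB L f g X : contw `[0, L] f -> contw `[0, L] g -> 0 <= X <= L ->
  gmap f X - gmap g X = gmap (fun x => f x - g x) X.
Proof.
move=> cf cg XL; have := @gmap_uniq L (fun x => gmap f x - gmap g x) _ (contwB cf cg).
by move=> ->//; rewrite ?gmap0 ?subrr ?add0r // => x xL; apply: hasDB; exact: hasD_gmap.
Qed.

Lemma gmap_ge L f C X : contw `[0, L] f -> (forall x, 0 <= x <= L -> C <= f x) ->
  0 <= X <= L -> C * X <= gmap f X.
Proof.
move=> cf fC /andP[X0 XL].
have := @hasD_mono L (fun x => gmap f x - C * x) (fun x => f x - C * 1) _ _ 0 X.
rewrite gmap0 mulr0 subr0 subr_ge0; apply => // x xL; last by rewrite mulr1 subr_ge0 fC.
by apply: hasDB; [exact: hasD_gmap|apply: hasDZ; exact: hasD_id].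
Qed.

End Primitive.

(** * Contraction by halving, and Gronwall's inequality *)

Section Halving.
Variable R : realType.

Lemma halving_small (C e : R) : 0 < e -> exists n, C / 2 ^+ n <= e.
Proof.
move=> e0; exists (Num.bound (`|C| / e)).
rewrite ler_pdivrMr ?exprn_gt0 // -ler_pdivrMl // mulrC.
apply: (le_trans (ler_norm _)); rewrite normrM (gtr0_norm (_ : 0 < e^-1)) ?invr_gt0 //.
apply: (le_trans (ltW (archi_boundP _))); first by rewrite divr_ge0 // ltW.
by rewrite -natrX ler_nat ltnW // ltn_expl.
Qed.

Variables (A : Type) (K : set A) (w : A -> R).
Hypothesis w0 : forall a, K a -> 0 < w a.

(** [2 * c] is the fixed point of [D -> D / 2 + c]: iterating the improvement from any first bound
    [D0] leaves an excess [D0 / 2 ^+ n]. With [c = 0] this is a uniqueness principle. *)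
Lemma halving (u : A -> R) (D0 c : R) : 0 <= c -> 0 <= D0 ->
  (forall a, K a -> `|u a| <= D0 * w a) ->
  (forall D, 0 <= D -> (forall a, K a -> `|u a| <= D * w a) ->
     forall a, K a -> `|u a| <= (D / 2 + c) * w a) ->
  forall a, K a -> `|u a| <= 2 * c * w a.
Proof.
move=> c0 D00 uD0 step.
have H n : forall a, K a -> `|u a| <= (D0 / 2 ^+ n + 2 * c) * w a.
  elim: n => [|n IH] a Ka.
    rewrite expr0 divr1 (le_trans (uD0 _ Ka)) // ler_wpM2r ?(ltW (w0 Ka)) //; lra.
  have p : 0 <= D0 / 2 ^+ n by rewrite divr_ge0 // exprn_ge0.
  have := step (D0 / 2 ^+ n + 2 * c) _ IH a Ka.
  rewrite exprS invfM (_ : (_ + _) / 2 + c = D0 * (2^-1 / 2 ^+ n) + 2 * c); last by field; exact: expf_neq0.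
  by apply; lra.
move=> a Ka; apply/ler_addgt0Pl => e e0.
have [n hn] := @halving_small D0 (e / w a) (divr_gt0 e0 (w0 Ka)).
rewrite (le_trans (H n a Ka)) // mulrDl lerD2r.
by rewrite -ler_pdivlMr // w0.
Qed.

(** Banach's fixed point theorem in the sup norm weighted by [w], for bare functions: the limit is
    built pointwise, and [V] only has to be closed under uniform limits in that norm. *)
Lemma fixpoint (V : set (A -> R)) (Phi : (A -> R) -> (A -> R)) (u0 : A -> R) (d0 : R) :
  V u0 -> (forall u, V u -> V (Phi u)) -> 0 <= d0 ->
  (forall a, K a -> `|Phi u0 a - u0 a| <= d0 * w a) ->
  (forall u v d, V u -> V v -> 0 <= d -> (forall a, K a -> `|u a - v a| <= d * w a) ->
     forall a, K a -> `|Phi u a - Phi v a| <= d / 2 * w a) ->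
  (forall (un : nat -> A -> R) u, (forall n, V (un n)) ->
     (forall e, 0 < e -> exists n, forall a, K a -> `|un n a - u a| <= e * w a) -> V u) ->
  exists2 u, V u & forall a, K a -> Phi u a = u a.
Proof.
move=> Vu0 VPhi d00 hd0 contr closed.
pose un n := iter n Phi u0.
have Vun n : V (un n) by elim: n => //= n; exact: VPhi.
have step n : forall a, K a -> `|un n.+1 a - un n a| <= d0 / 2 ^+ n * w a.
  elim: n => [|n IH] a Ka; first by rewrite expr0 divr1; exact: hd0.
  have := contr _ _ _ (Vun n.+1) (Vun n) _ IH a Ka.
  rewrite exprS invfM (_ : d0 / 2 ^+ n / 2 = d0 * (2^-1 / 2 ^+ n)); last by field; exact: expf_neq0.
  by apply; rewrite divr_ge0 // exprn_ge0.
(* From step [n] on, the iterates move by at most the geometric sum [2 * (d0 / 2 ^+ n) * w a]. The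
   intervals [lo n a, hi n a] are therefore nested, and the supremum of their left ends is the
   limit. *)
pose lo n a := un n a - 2 * (d0 / 2 ^+ n) * w a.
pose hi n a := un n a + 2 * (d0 / 2 ^+ n) * w a.
have half n : d0 / 2 ^+ n.+1 = d0 / 2 ^+ n / 2.
  by rewrite exprS invfM; field; exact: expf_neq0.
have lo_mono a : K a -> {homo lo ^~ a : n m / (n <= m)%N >-> n <= m}.
  move=> Ka; apply: homo_leq => [//|x y z|n]; first exact: le_trans.
  have := step n a Ka; rewrite ler_norml => /andP[+ _].
  rewrite /lo half; set x := _ / 2 ^+ n => ?.
  rewrite -subr_ge0; rewrite (_ : _ - _ = (un n.+1 a - un n a) + x * w a); last by field.
  lra.
have hi_mono a : K a -> {homo hi ^~ a : n m / (n <= m)%N >-> m <= n}.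
  move=> Ka; apply: homo_leq => [//|x y z xy yz|n]; first exact: le_trans yz xy.
  have := step n a Ka; rewrite ler_norml => /andP[_ +].
  rewrite /hi half; set x := _ / 2 ^+ n => ?.
  rewrite -subr_ge0; rewrite (_ : _ - _ = x * w a - (un n.+1 a - un n a)); last by field.
  lra.
have lohi a n m : K a -> lo n a <= hi m a.
  move=> Ka; apply: (le_trans (lo_mono a Ka _ _ (leq_maxl n m))).
  apply: le_trans _ (hi_mono a Ka _ _ (leq_maxr n m)).
  rewrite /lo /hi lerD2l (@le_trans _ _ 0) // ?oppr_le0 mulr_ge0 ?(ltW (w0 Ka)) //.
    by rewrite mulr_ge0 // divr_ge0 // exprn_ge0.
  by rewrite mulr_ge0 // divr_ge0 // exprn_ge0.
pose u a := sup (range (lo ^~ a)).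
have hu n a : K a -> `|un n a - u a| <= 2 * (d0 / 2 ^+ n) * w a.
  move=> Ka.
  have ne : range (lo ^~ a) !=set0 by exists (lo 0%N a), 0%N.
  have h1 : lo n a <= u a.
    apply: ub_le_sup; last by exists n.
    by exists (hi 0%N a) => _ [m _ <-]; exact: lohi.
  have h2 : u a <= hi n a by apply: ge_sup => // _ [m _ <-]; exact: lohi.
  by rewrite /lo /hi in h1 h2; rewrite ler_norml; apply/andP; split; lra.
have hue e : 0 < e -> exists n, forall a, K a -> `|un n a - u a| <= e * w a.
  move=> e0; have [n hn] := halving_small (2 * d0) e0; exists n => a Ka.
  by rewrite (le_trans (hu n a Ka)) // ler_wpM2r ?(ltW (w0 Ka)) // mulrA.
have Vu : V u by exact: (closed un).
exists u => // a Ka; apply/eqP; rewrite -subr_eq0 -normr_le0; apply/ler_addgt0Pl => e e0.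
have [n hn] := @halving_small (2 * d0) (e / w a) (divr_gt0 e0 (w0 Ka)).
have nz : 0 <= 2 * (d0 / 2 ^+ n) by rewrite mulr_ge0 // divr_ge0 // exprn_ge0.
have h1 := contr _ _ _ (Vun n) Vu nz (hu n) a Ka.
have h2 := hu n.+1 a Ka.
rewrite (_ : Phi u a - u a = (un n.+1 a - u a) - (Phi (un n) a - Phi u a)); last by rewrite /=; ring.
rewrite (le_trans (ler_normB _ _)) // addr0 (le_trans (lerD h2 h1)) // half.
rewrite -mulrDl (_ : _ + _ = 2 * d0 / 2 ^+ n); last by field; exact: expf_neq0.
by rewrite -ler_pdivlMr // w0.
Qed.

End Halving.

(** A bound [D * expR (2 * A * x)] of [F] bounds [f] by [(A * D + c) * expR (2 * A * x)];
    integrating at rate [2 * A] turns [D] into [D / 2 + c / (2 * A)], and [halving] concludes. *)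
Lemma gronwall (R : realType) (L A c : R) (F f : R -> R) : 0 < A -> 0 <= c -> F 0 = 0 ->
  (forall x, 0 <= x <= L -> hasD `[0, L] F x (f x)) ->
  (forall x, 0 <= x <= L -> `|f x| <= A * `|F x| + c) ->
  forall x, 0 <= x <= L -> `|F x| <= c / A * expR (2 * A * x).
Proof.
move=> A0 c0 F0 dF fb x xL.
have Kx : [set` `[0, L]] x by rewrite /= in_itv.
have e1 y : 0 <= y -> 1 <= expR (2 * A * y).
  by move=> y0; rewrite -expR0 ler_expR mulr_ge0 // mulr_ge0 // ltW.
have [M M0 hM] := compact_bound (@segment_compact R 0 L) (hasD_contw dF).
have cA : 0 <= c / (2 * A) by rewrite divr_ge0 //; lra.
have := @halving R R `[0, L]%classic (fun x => expR (2 * A * x)) _ F M (c / (2 * A)) cA (ltW M0).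
rewrite (_ : 2 * (c / (2 * A)) = c / A); last by field; rewrite gt_eqF.
apply=> //.
- by move=> ? _; exact: expR_gt0.
- move=> y Dy; rewrite (le_trans (hM y Dy)) // ler_peMr ?(ltW M0) // e1 //.
  by move: Dy; rewrite /= in_itv /= => /andP[].
move=> D D0 h y Dy.
rewrite (_ : D / 2 + c / (2 * A) = (A * D + c) / (2 * A)); last by field; rewrite gt_eqF.
rewrite /= in_itv /= in Dy.
have p : 0 < 2 * A by lra.
have q : 0 <= A * D + c by rewrite addr_ge0 // mulr_ge0 // ltW.
apply: (hasD_exp_bound p F0 q dF) => // z zL.
rewrite (le_trans (fb z zL)) // mulrDl lerD //.
  by rewrite -mulrA ler_wpM2l ?(ltW A0) //; apply: h; rewrite /= in_itv.
by rewrite ler_peMr // e1 //; case/andP: zL.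
Qed.

(** * Joint continuity and linear systems on an interval *)

Section JointContinuity.
Variable R : realType.
Implicit Types (A B : set R) (u v : R -> R -> R).

Definition cont2 A B u := contw (A `*` B) (fun z : R * R => u z.1 z.2).

Lemma cont2_unif A B u e : compact A -> compact B -> cont2 A B u -> 0 < e ->
  exists2 d, 0 < d & forall t s X Y, A t -> A s -> B X -> B Y ->
    `|t - s| < d -> `|X - Y| < d -> `|u t X - u s Y| <= e.
Proof.
move=> cA cB cu e0.
have [d d0 hd] := compact_unif (compact_setX cA cB) cu e0.
by exists d => // t s X Y At As BX BY ts XY; apply: (hd (t, X) (s, Y)); split.
Qed.

Lemma cont2_bound A B u : compact A -> compact B -> cont2 A B u ->
  exists2 M, 0 < M & forall t X, A t -> B X -> `|u t X| <= M.
Proof.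
move=> cA cB cu; have [M M0 hM] := compact_bound (compact_setX cA cB) cu.
by exists M => // t X At BX; apply: (hM (t, X)); split.
Qed.

Lemma cont2_comp (U : topologicalType) (C : set U) A B u (f g : U -> R) :
  cont2 A B u -> contw C f -> contw C g -> (forall x, C x -> A (f x)) ->
  (forall x, C x -> B (g x)) -> contw C (fun x => u (f x) (g x)).
Proof.
move=> cu cf cg CA CB x Cx.
apply: (@limw_comp _ _ C _ (A `*` B) (fun x => (f x, g x)) (fun z => u z.1 z.2) x (f x, g x)).
- by move=> z Cz; split; [exact: CA|exact: CB].
- by apply: within_pair; [exact: cf|exact: cg].
- by apply: cu; split; [exact: CA|exact: CB].
Qed.

Lemma contw_id A : contw A id.
Proof. by move=> x _; exact: cvg_within. Qed.

Lemma contw_fst A B : contw (A `*` B) (fun z => z.1).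
Proof. by apply: continuous_contw => z; exact: cvg_fst. Qed.

Lemma contw_snd A B : contw (A `*` B) (fun z => z.2).
Proof. by apply: continuous_contw => z; exact: cvg_snd. Qed.

Lemma cont2_swap A B u : cont2 A B u -> cont2 B A (fun X t => u t X).
Proof.
move=> cu; apply: (cont2_comp cu (@contw_snd B A) (@contw_fst B A)).
  by move=> z [].
by move=> z [].
Qed.

Lemma cont2_row A B u t : A t -> cont2 A B u -> contw B (u t).
Proof.  by move=> At cu; exact (@cont2_comp _ B A B u (fun=> t) id cu (@contw_cst _ _ B t) (@contw_id B) (fun _ _ => At) (fun _ H => H)). Qed.

Lemma cont2_col A B u X : B X -> cont2 A B u -> contw A (u^~ X).
Proof.  by move=> BX cu; exact (@cont2_comp _ A A B u id (fun=> X) cu (@contw_id A) (@contw_cst _ _ A X) (fun _ H => H) (fun _ _ => BX)). Qed.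

Lemma cont2_fst A B (f : R -> R) : contw A f -> cont2 A B (fun t _ => f t).
Proof.
move=> cf z [zA zB]; apply: (@limw_comp _ _ (A `*` B) _ A (fun z : R * R => z.1) f z z.1) => //.
- by move=> ? [].
- by apply: contw_fst; split.
- exact: cf.
Qed.

Lemma cont2_snd A B (f : R -> R) : contw B f -> cont2 A B (fun _ X => f X).
Proof. by move=> cf; apply: (@cont2_swap B A (fun X t => f X)); exact: cont2_fst. Qed.

Lemma cont2_eq A B u v : (forall t X, A t -> B X -> u t X = v t X) ->
  cont2 A B u -> cont2 A B v.
Proof. by move=> uv; apply: contw_eq => z [? ?]; exact: uv. Qed.

Lemma cont2_sub A B A' B' u : A' `<=` A -> B' `<=` B -> cont2 A B u -> cont2 A' B' u.
Proof. by move=> AA BB; apply: contw_sub => z [? ?]; split; [exact: AA|exact: BB]. Qed.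

(** Continuity in the second variable plus continuity in the first that is uniform in the second:
    the form in which Lipschitz estimates of the nonlocal operators deliver joint continuity. *)
Lemma cont2_build A B u : (forall t, A t -> contw B (u t)) ->
  (forall t e, A t -> 0 < e -> exists2 d, 0 < d & forall s, A s -> `|s - t| < d ->
     forall X, B X -> `|u s X - u t X| <= e) -> cont2 A B u.
Proof.
move=> h1 h2 [t X] [/= At BX]; apply/limwP => e e0 /=.
have e20 : 0 < e / 2 by lra.
have [d d0 hd] := h2 t _ At e20.
have /limwP /(_ _ e20)[d' d'0 hd'] := h1 t At X BX.
exists (Num.min d d'); first by rewrite lt_min d0.
move=> [s Y] [/= As BY] [/=]; rewrite /ball /= !lt_min => /andP[st _] /andP[_ XY].
rewrite (_ : _ - _ = (u s Y - u t Y) + (u t Y - u t X)); last by ring.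
rewrite (le_trans (ler_normD _ _)) // [e]splitr lerD //.
  by apply: hd => //; rewrite distrC.
by apply: hd'.
Qed.

Lemma cont2_gmap A L f : compact A -> cont2 A `[0, L] f ->
  cont2 A `[0, L] (fun t X => gmap (f t) X).
Proof.
move=> cA cf; have cI := @segment_compact R 0 L.
apply: cont2_build => [t At|t e At e0].
  by apply: contw_gmap; exact: cont2_row cf.
have [L0|L0] := ltP 0 L; last first.
  exists 1 => // s As _ X; rewrite /= in_itv /= => /andP[X0 XL].
  have -> : X = 0 by apply/eqP; rewrite eq_le X0 (le_trans XL).
  by rewrite !gmap0 subrr normr0 ltW.
have [d d0 hd] := cont2_unif cA cI cf (divr_gt0 e0 L0).
exists d => // s As st X; rewrite /= in_itv /= => XL.
have c1 := cont2_row At cf; have c2 := cont2_row As cf.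
rewrite (gmapB c2 c1) //.
apply: (@le_trans _ _ (e / L * X)).
  apply: (gmap_bound (contwB c2 c1)) => // x xL.
  by apply: hd => //; rewrite ?subrr ?normr0 //= in_itv.
by case/andP: XL => X0 XL; rewrite mulrAC ler_pdivrMr // ler_wpM2l // ltW.
Qed.

(** The mean value theorem in [t] turns the error under the integral into an oscillation of [f'],
    small by uniform continuity. Dividing by [L + 1] instead of [L] covers [L = 0]. *)
Lemma hasD_gmap_param a b L f f' t X :
  cont2 `[a, b] `[0, L] f -> cont2 `[a, b] `[0, L] f' ->
  (forall t x, a <= t <= b -> 0 <= x <= L -> hasD `[a, b] (f^~ x) t (f' t x)) ->
  a <= t <= b -> 0 <= X <= L ->
  hasD `[a, b] (fun t => gmap (f t) X) t (gmap (f' t) X).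
Proof.
move=> cf cf' df tab XL; have cI := @segment_compact R 0 L.
have cA := @segment_compact R a b.
have It s : a <= s <= b -> [set` `[a, b]] s by rewrite /= in_itv.
have IX x : 0 <= x <= L -> [set` `[0, L]] x by rewrite /= in_itv.
apply/hasDe => e e0.
have L0 : 0 < L + 1 by case/andP: XL => ? ?; lra.
have [d d0 hd] := cont2_unif cA cI cf' (divr_gt0 e0 L0).
exists d => // s; rewrite /= in_itv /= => sab st.
have c1 := cont2_row (It _ sab) cf; have c2 := cont2_row (It _ tab) cf.
have c3 := cont2_row (It _ tab) cf'.
have c4 : contw `[0, L] (fun x => f s x - f t x - f' t x * (s - t)).
  by apply: contwB; [apply: contwB|apply: contwM => //; exact: contw_cst].
have -> : gmap (f s) X - gmap (f t) X - gmap (f' t) X * (s - t) =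
   gmap (fun x => f s x - f t x - f' t x * (s - t)) X.
  have := @gmap_uniq _ L (fun X => gmap (f s) X - gmap (f t) X - gmap (f' t) X * (s - t)) _ c4.
  rewrite !gmap0 => -> //; first by rewrite mul0r !subr0 add0r.
  move=> x xL; apply: hasDB.
    by apply: hasDB; exact: hasD_gmap.
  have := hasDM (hasD_gmap c3 xL) (hasD_cst `[0, L] (s - t) x).
  by rewrite mulr0 addr0.
apply: (@le_trans _ _ (e / (L + 1) * `|s - t| * X)).
  apply: (gmap_bound c4) => // x xL.
  have [c cst ->] : exists2 c, Num.min t s <= c <= Num.max t s & f s x - f t x = f' c x * (s - t).
    apply: (@mvt_conv _ `[a, b] (f^~ x) (f'^~ x)).
      move=> z; rewrite /= in_itv /= ge_min le_max => /andP[/orP[] ? /orP[] ?]; lra.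
    by move=> z; rewrite /= in_itv /= => zab; exact: df.
  rewrite -mulrBl normrM ler_wpM2r // hd ?subrr ?normr0 //; try exact: IX.
  - by apply: It; move: cst; rewrite ge_min le_max => /andP[/orP[] ? /orP[] ?]; lra.
  apply: le_lt_trans st; move: cst; rewrite ge_min le_max => /andP[/orP[] ? /orP[] ?];
    rewrite ler_norml lerNl; have := ler_norm (s - t); have := ler_norm (t - s); rewrite (distrC t s) => ? ?; apply/andP; split; lra.
rewrite mulrAC ler_wpM2r // mulrAC ler_pdivrMr // ler_wpM2l ?(ltW e0) //.
by case/andP: XL => ? ?; lra.
Qed.

End JointContinuity.

(** * The linear system for concentration and flux, and its two-point problem *)

Section LinearSystem.
Variables (R : realType) (L : R).
Hypothesis L0 : 0 < L.
Implicit Types (a b N q : R -> R).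

Definition linsys a b N q := forall x, 0 <= x <= L ->
  hasD `[0, L] N x (a x * q x) /\ hasD `[0, L] q x (b x * N x).

Lemma linsys_contw a b N q : linsys a b N q -> contw `[0, L] N /\ contw `[0, L] q.
Proof.
move=> h; split => x; rewrite /= in_itv /= => /h[h1 h2].
  exact: hasD_cont h1.
exact: hasD_cont h2.
Qed.

(** Picard iteration on [N] alone, [q] being recovered as a primitive of [b N]. The iteration stays
    among nonnegative functions, whence the lower bounds by the initial values. With a weight of
    rate [2 * B], each of the two integrations halves the distance. *)
Lemma linsys_exists a b (n0 q0 : R) : contw `[0, L] a -> contw `[0, L] b ->
  (forall x, 0 <= x <= L -> 0 <= a x) -> (forall x, 0 <= x <= L -> 0 <= b x) ->
  0 <= n0 -> 0 <= q0 ->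
  exists N q, [/\ linsys a b N q, N 0 = n0, q 0 = q0,
    forall x, 0 <= x <= L -> n0 <= N x & forall x, 0 <= x <= L -> q0 <= q x].
Proof.
move=> ca cb a0 b0 n00 q00; have cI := @segment_compact R 0 L.
have [Ba Ba0 hBa] := compact_bound cI ca.
have [Bb Bb0 hBb] := compact_bound cI cb.
have IX x : 0 <= x <= L -> [set` `[0, L]] x by rewrite /= in_itv.
pose V := [set N : R -> R | contw `[0, L] N /\ forall x, 0 <= x <= L -> 0 <= N x].
pose qof N := fun x => q0 + gmap (fun y => b y * N y) x.
pose Phi N := fun x => n0 + gmap (fun y => a y * qof N y) x.
pose B := Ba + Bb; have B0 : 0 < B by rewrite addr_gt0.
pose w x := expR (2 * B * x).
have cq N : V N -> contw `[0, L] (qof N).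
  by move=> [cN _]; apply: contwD; [exact: contw_cst|apply: contw_gmap; exact: contwM].
have gmap_ge0 f x : contw `[0, L] f -> (forall x, 0 <= x <= L -> 0 <= f x) ->
    0 <= x <= L -> 0 <= gmap f x.
  by move=> cf f0 xL; have := gmap_ge cf f0 xL; rewrite mul0r.
have q_ge N x : V N -> 0 <= x <= L -> q0 <= qof N x.
  move=> [cN N0] xL; rewrite lerDl; apply: gmap_ge0 => //; first exact: contwM.
  by move=> y yL; rewrite mulr_ge0 ?a0 ?b0 ?N0.
have Phi_ge N x : V N -> 0 <= x <= L -> n0 <= Phi N x.
  move=> VN xL; rewrite lerDl; apply: gmap_ge0 => //; first by apply: contwM => //; exact: cq.
  by move=> y yL; rewrite mulr_ge0 ?a0 // (le_trans q00) // q_ge.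
have VPhi N : V N -> V (Phi N).
  move=> VN; split.
    by apply: contwD; [exact: contw_cst|apply: contw_gmap; apply: contwM => //; exact: cq].
  by move=> x xL; rewrite (le_trans n00) // Phi_ge.
have B20 : 0 < 2 * B by lra.
have contr u v d : V u -> V v -> 0 <= d -> (forall x, [set` `[0, L]] x -> `|u x - v x| <= d * w x) ->
    forall x, [set` `[0, L]] x -> `|Phi u x - Phi v x| <= d / 2 * w x.
  move=> Vu Vv d0 h x; rewrite /= in_itv /= => xL.
  have cu := Vu.1; have cv := Vv.1.
  have hq y : 0 <= y <= L -> `|qof u y - qof v y| <= d / 2 * w y.
    move=> yL.
    have -> : d / 2 * w y = (B * d) / (2 * B) * expR (2 * B * y) by rewrite /w; field; rewrite gt_eqF.
    rewrite /qof opprD addrACA subrr add0r.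
    apply: (@hasD_exp_bound _ L (fun y => gmap (fun z => b z * u z) y - gmap (fun z => b z * v z) y)
      (fun z => b z * u z - b z * v z)) => //.
    - by rewrite !gmap0 subrr.
    - by rewrite mulr_ge0 // ltW.
    - by move=> z zL; apply: hasDB; apply: hasD_gmap => //; exact: contwM.
    - move=> z zL; rewrite -mulrBr normrM -mulrA ler_pM //; last exact/h/IX.
      by rewrite (le_trans (hBb _ (IX _ zL))) // lerDr ltW.
  have dd : 0 <= d / 2 by lra.
  rewrite /Phi opprD addrACA subrr add0r.
  apply: (@le_trans _ _ ((B * (d / 2)) / (2 * B) * expR (2 * B * x))); last first.
    rewrite (_ : _ / (2 * B) = d / 2 / 2); last by field; rewrite gt_eqF.
    by rewrite ler_wpM2r ?expR_ge0 //; lra.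
  apply: (@hasD_exp_bound _ L (fun y => gmap (fun z => a z * qof u z) y - gmap (fun z => a z * qof v z) y)
      (fun z => a z * qof u z - a z * qof v z)) => //.
  - by rewrite !gmap0 subrr.
  - by rewrite mulr_ge0 // ltW.
  - by move=> z zL; apply: hasDB; apply: hasD_gmap => //; apply: contwM => //; exact: cq.
  - move=> z zL; rewrite -mulrBr normrM -mulrA ler_pM //; last exact/hq.
    by rewrite (le_trans (hBa _ (IX _ zL))) // lerDl ltW.
have w1 x : [set` `[0, L]] x -> 1 <= w x.
  rewrite /= in_itv /= => /andP[x0 _]; have B2 := ltW B20; by rewrite /w -[leLHS]expR0 ler_expR mulr_ge0.
have V0 : V (fun=> 0) by split => //; exact: contw_cst.
have [M M0 hM] := compact_bound cI (contwB (VPhi _ V0).1 V0.1).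
have [N VN eN] : exists2 u, V u & forall x, [set` `[0, L]] x -> Phi u x = u x.
  apply: (@fixpoint _ _ `[0, L]%classic w _ V Phi (fun=> 0) M) => //.
  - by move=> x _; exact: expR_gt0.
  - exact: ltW.
  - by move=> x Ix; rewrite (le_trans (hM x Ix)) // ler_peMr ?(ltW M0) // w1.
  - move=> un u Vun h.
    have Cw x : [set` `[0, L]] x -> w x <= expR (2 * B * L).
      rewrite /= in_itv /= => /andP[x0 xL]; rewrite ler_expR ler_wpM2l //; lra.
    have C0 := expR_gt0 (2 * B * L).
    have h' e : 0 < e -> exists n, forall x, [set` `[0, L]] x -> `|un n x - u x| <= e.
      move=> e0; have [n hn] := h _ (divr_gt0 e0 C0); exists n => x Ix.
      by rewrite (le_trans (hn x Ix)) // mulrAC ler_pdivrMr // ler_wpM2l ?(ltW e0) // Cw.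
    split.
      move=> x Ix; apply/limwP => e e0; have e30 : 0 < e / 3 by lra.
      have [n hn] := h' _ e30.
      have /limwP/(_ _ e30)[d d0 hd] := (Vun n).1 x Ix.
      exists d => // y Iy xy; have := hd y Iy xy; have := hn y Iy; have := hn x Ix.
      rewrite !ler_norml => /andP[? ?] /andP[? ?] /andP[? ?]; apply/andP; split; lra.
    move=> x xL; apply/ler_addgt0Pl => e e0; have [n hn] := h' _ e0.
    have := hn x (IX _ xL); have := (Vun n).2 x xL; rewrite ler_norml => ? /andP[? ?]; lra.
exists N, (qof N); split.
- move=> x xL; have Ix := IX _ xL; split.
    apply: (@hasD_eq _ _ (Phi N)) => //.
    have := hasDD (hasD_cst `[0, L] n0 x) (hasD_gmap (contwM ca (cq _ VN)) xL).
    by rewrite add0r.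
  have := hasDD (hasD_cst `[0, L] q0 x) (hasD_gmap (contwM cb VN.1) xL).
  by rewrite add0r.
- by rewrite -eN ?/Phi ?gmap0 ?addr0 //= in_itv /= lexx ltW.
- by rewrite /qof gmap0 addr0.
- by move=> x xL; rewrite -eN ?Phi_ge //= in_itv.
- by move=> x xL; exact: q_ge.
Qed.

(** [(N + q)' = a q + b N] is at most [B (N + q)], so [(N + q) * expR (- B * x)] does not increase;
    nonnegativity then bounds each component by the sum. *)
Lemma linsys_bound a b N q B : 0 <= B -> linsys a b N q ->
  (forall x, 0 <= x <= L -> 0 <= N x /\ 0 <= q x) ->
  (forall x, 0 <= x <= L -> a x <= B /\ b x <= B) ->
  forall x, 0 <= x <= L -> `|N x| <= (N 0 + q 0) * expR (B * L) /\
                          `|q x| <= (N 0 + q 0) * expR (B * L).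
Proof.
move=> B0 h pos ab x xL.
have [x0 xl] := andP xL.
have H : - ((N 0 + q 0) * expR (- B * 0)) <= - ((N x + q x) * expR (- B * x)).
  apply: (@hasD_mono _ L (fun x => - ((N x + q x) * expR (- B * x)))
    (fun x => - ((a x * q x + b x * N x) * expR (- B * x) + (N x + q x) * (expR (- B * x) * (- B * 1))))) => //.
    move=> y yL; have [h1 h2] := h y yL; apply: hasDN; apply: hasDM; first exact: hasDD.
    apply: (@hasD_comp _ _ setT expR (fun y => - B * y)) => //.
      by apply: hasDZ; exact: hasD_id.
    exact: hasD_expR.
  move=> y yL; have [p1 p2] := pos y yL; have [b1 b2] := ab y yL.
  rewrite (_ : - _ = ((B - a y) * q y + (B - b y) * N y) * expR (- B * y)); last by ring.
  by rewrite mulr_ge0 ?expR_ge0 // addr_ge0 // mulr_ge0 // subr_ge0.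
have [p1 p2] := pos x xL.
have S : N x + q x <= (N 0 + q 0) * expR (B * L).
  move: H; rewrite mulr0 expR0 mulr1 lerN2 mulNr expRN -ler_pdivlMr ?invr_gt0 ?expR_gt0 // invrK.
  move=> /le_trans; apply; have [p3 p4] : 0 <= N 0 /\ 0 <= q 0 by apply: pos; rewrite lexx ltW.
  by rewrite ler_wpM2l ?addr_ge0 // ler_expR ler_wpM2l.
by rewrite !ger0_norm //; split; lra.
Qed.

(** Liouville's formula: the matrix of the system has zero trace, so the determinant of two
    solutions is constant. *)
Lemma wronskian a b N1 q1 N2 q2 : linsys a b N1 q1 -> linsys a b N2 q2 ->
  forall x, 0 <= x <= L -> q1 x * N2 x - N1 x * q2 x = q1 0 * N2 0 - N1 0 * q2 0.
Proof.
move=> h1 h2; apply: (@hasD_eq0_const _ L (fun x => q1 x * N2 x - N1 x * q2 x)) => x xL.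
have [d1 d2] := h1 x xL; have [d3 d4] := h2 x xL.
have := hasDB (hasDM d2 d3) (hasDM d1 d4).
by rewrite (_ : _ - _ = 0); last by ring.
Qed.

(* Variation of constants: [N1, q1] and [N2, q2] are the columns of a
   fundamental matrix of determinant [-1] for the perturbed system. *)
Lemma linsys_perturb a b a' b' N q N' q' N1 q1 N2 q2 :
  contw `[0, L] a -> contw `[0, L] b -> contw `[0, L] a' -> contw `[0, L] b' ->
  linsys a b N q -> linsys a' b' N' q' -> N' 0 = N 0 -> q' 0 = q 0 ->
  linsys a' b' N1 q1 -> linsys a' b' N2 q2 ->
  (forall x, 0 <= x <= L -> q1 x * N2 x - N1 x * q2 x = 1) ->
  let r1 x := (a' x - a x) * q x in let r2 x := (b' x - b x) * N x in
  let al := gmap (fun x => q1 x * r1 x - N1 x * r2 x) in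
  let be := gmap (fun x => N2 x * r2 x - q2 x * r1 x) in
  forall x, 0 <= x <= L ->
    N' x - N x = N2 x * al x + N1 x * be x /\
    q' x - q x = q2 x * al x + q1 x * be x.
Proof.
move=> ca cb ca' cb' h h' eN eq h1 h2 wr r1 r2 al be x xL.
have [cN cq] := linsys_contw h.
have [cN1 cq1] := linsys_contw h1; have [cN2 cq2] := linsys_contw h2.
have cr1 : contw `[0, L] r1 by apply: contwM => //; exact: contwB.
have cr2 : contw `[0, L] r2 by apply: contwM => //; exact: contwB.
have e1 : q1 x * (N' x - N x) - N1 x * (q' x - q x) = al x.
  have := @gmap_uniq _ L (fun x => q1 x * (N' x - N x) - N1 x * (q' x - q x))
    (fun x => q1 x * r1 x - N1 x * r2 x) _ _ x xL.
  rewrite eN eq !subrr !mulr0 subrr add0r; apply.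
    by apply: contwB; exact: contwM.
  move=> y yL; have [a1 a2] := h y yL; have [a3 a4] := h' y yL; have [a5 a6] := h1 y yL.
  have := hasDB (hasDM a6 (hasDB a3 a1)) (hasDM a5 (hasDB a4 a2)).
  by congr (hasD _ _ _ _); rewrite /r1 /r2; ring.
have e2 : N2 x * (q' x - q x) - q2 x * (N' x - N x) = be x.
  have := @gmap_uniq _ L (fun x => N2 x * (q' x - q x) - q2 x * (N' x - N x))
    (fun x => N2 x * r2 x - q2 x * r1 x) _ _ x xL.
  rewrite eN eq !subrr !mulr0 subrr add0r; apply.
    by apply: contwB; exact: contwM.
  move=> y yL; have [a1 a2] := h y yL; have [a3 a4] := h' y yL; have [a5 a6] := h2 y yL.
  have := hasDB (hasDM a5 (hasDB a4 a2)) (hasDM a6 (hasDB a3 a1)).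
  by congr (hasD _ _ _ _); rewrite /r1 /r2; ring.
have w := wr x xL.
rewrite -e1 -e2; split.
  by rewrite -[LHS]mul1r -w; ring.
by rewrite -[LHS]mul1r -w; ring.
Qed.

(* The combination vanishing at [L] decreases, as [(h p)' >= 0] and [(h p)(L) = 0] for its flux [p]. *)
Lemma bvp_formula a b nL nR N1 q1 N2 q2 : 0 <= nL -> 0 <= nR ->
  (forall x, 0 <= x <= L -> 0 <= a x) -> (forall x, 0 <= x <= L -> 0 <= b x) ->
  linsys a b N1 q1 -> linsys a b N2 q2 -> N1 0 = 0 -> q1 0 = 1 -> N2 0 = 1 -> q2 0 = 0 ->
  (forall x, 0 <= x <= L -> 0 <= N1 x) -> (forall x, 0 <= x <= L -> 0 <= q1 x) -> 0 < N1 L ->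
  let N x := (nL * (N2 x * N1 L - N2 L * N1 x) + nR * N1 x) / N1 L in
  let q x := (nL * (q2 x * N1 L - N2 L * q1 x) + nR * q1 x) / N1 L in
  [/\ linsys a b N q, N 0 = nL, N L = nR &
      forall x, 0 <= x <= L -> 0 <= N x <= nL + nR].
Proof.
move=> nL0 nR0 a0 b0 h1 h2 N10 q10 N20 q20 pN1 pq1 pos N q.
have nz : N1 L != 0 by rewrite gt_eqF.
have LL : 0 <= L <= L by rewrite lexx ltW.
pose H x := N2 x * N1 L - N2 L * N1 x; pose p x := q2 x * N1 L - N2 L * q1 x.
have hs : linsys a b H p.
  move=> x xL; have [d1 d2] := h1 x xL; have [d3 d4] := h2 x xL; split.
    have := hasDB (hasDM d3 (hasD_cst `[0, L] (N1 L) x)) (hasDZ (N2 L) d1).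
    by congr (hasD _ _ _ _); rewrite /p; ring.
  have := hasDB (hasDM d4 (hasD_cst `[0, L] (N1 L) x)) (hasDZ (N2 L) d2).
  by congr (hasD _ _ _ _); rewrite /H; ring.
have H0 : H 0 = N1 L by rewrite /H N20 N10; ring.
have HL : H L = 0 by rewrite /H; ring.
have [cH cp] := linsys_contw hs.
have Hp x : 0 <= x <= L -> H x * p x <= 0.
  move=> /andP[x0 xL]; have : H x * p x <= H L * p L.
    apply: (@hasD_mono _ L (fun x => H x * p x) (fun x => a x * p x * p x + H x * (b x * H x))) => //.
      by move=> y yL; have [d1 d2] := hs y yL; exact: hasDM.
    move=> y yL; rewrite (_ : _ + _ = a y * p y ^+ 2 + b y * H y ^+ 2); last by ring.
    by rewrite addr_ge0 // mulr_ge0 ?sqr_ge0 ?a0 ?b0.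
  by rewrite HL mul0r.
(* [(H ^+ 2)' = 2 a (H p)], so the sign of [H p] makes [H ^+ 2] nonincreasing. *)
have sq x y : 0 <= x -> x <= y -> y <= L -> H y ^+ 2 <= H x ^+ 2.
  move=> x0 xy yL; rewrite -lerN2.
  apply: (@hasD_mono _ L (fun x => - H x ^+ 2) (fun x => - (a x * p x * H x + H x * (a x * p x)))) => //.
    by move=> z zL; have [d1 d2] := hs z zL; apply: hasDN; exact: hasDM.
  move=> z zL; rewrite (_ : - _ = a z * (- (H z * p z)) * 2); last by ring.
  by rewrite mulr_ge0 // mulr_ge0 ?a0 // oppr_ge0 Hp.
(* A negative value of [H] would be preceded by a zero, since [H 0 > 0]; after that zero the
   nonincreasing [H ^+ 2] would have to stay 0. *)
have Hge x : 0 <= x <= L -> 0 <= H x.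
  move=> /andP[x0 xL]; rewrite leNgt; apply/negP => Hx.
  have [||z] := @IVT R H 0 x 0 x0.
  - by apply/contwP; apply: contw_sub cH; exact: itv_subset.
  - by rewrite H0 ge_min (ltW Hx) orbT le_max (ltW pos).
  rewrite in_itv /= => /andP[z0 zx] Hz.
  have := sq z x z0 zx xL; rewrite Hz expr0n /= leNgt => /negP; apply.
  by rewrite exprn_even_gt0 //= lt_eqF.
have Hle x : 0 <= x <= L -> H x <= N1 L.
  move=> /andP[x0 xL]; have := sq 0 x (lexx _) x0 xL.
  by rewrite H0 ler_sqr ?nnegrE ?(ltW pos) // Hge // x0.
have N1le x : 0 <= x <= L -> N1 x <= N1 L.
  move=> /andP[x0 xL]; apply: (@hasD_mono _ L N1 (fun x => a x * q1 x)) => //.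
    by move=> y yL; case: (h1 y yL).
  by move=> y yL; rewrite mulr_ge0 ?a0 ?pq1.
have NE x : N x = (nL * H x + nR * N1 x) / N1 L by [].
split.
- move=> x xL; have [d1 d2] := h1 x xL; have [d3 d4] := hs x xL; split.
    have := hasDM (hasDD (hasDZ nL d3) (hasDZ nR d1)) (hasD_cst `[0, L] (N1 L)^-1 x).
    by congr (hasD _ _ _ _); rewrite /q -/(p x); ring.
  have := hasDM (hasDD (hasDZ nL d4) (hasDZ nR d2)) (hasD_cst `[0, L] (N1 L)^-1 x).
  by congr (hasD _ _ _ _); rewrite /N -/(H x); ring.
- by rewrite NE H0 N10 mulr0 addr0 mulfK.
- by rewrite NE HL mulr0 add0r mulfK.
move=> x xL; rewrite NE; apply/andP; split.
  by rewrite divr_ge0 ?(ltW pos) // addr_ge0 // mulr_ge0 ?Hge ?pN1.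
by rewrite ler_pdivrMr // mulrDl lerD // ler_wpM2l ?Hle ?N1le.
Qed.

End LinearSystem.

(** * Weak derivatives *)

Section SmoothStep.
Variable R : realType.
Implicit Types (t x e z : R).

Definition pospart t : R := (t + `|t|) / 2.

Lemma pospart_ge0E t : 0 <= t -> pospart t = t.
Proof. by move=> t0; rewrite /pospart ger0_norm //; lra. Qed.

Lemma pospart_le0E t : t <= 0 -> pospart t = 0.
Proof. by move=> t0; rewrite /pospart ler0_norm // subrr mul0r. Qed.

Lemma pospartP t : 0 <= t /\ pospart t = t \/ t <= 0 /\ pospart t = 0.
Proof.
have [t0|/ltW t0] := leP 0 t; first by left; split => //; exact: pospart_ge0E.
by right; split => //; exact: pospart_le0E.
Qed.

Lemma continuous_pospart : continuous pospart.
Proof.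
move=> t; apply: cvgM; last exact: cvg_cst.
by apply: cvgD; [exact: cvg_id|apply: cvg_norm; exact: cvg_id].
Qed.

Lemma hasD_pospart_sqr D t : hasD D (fun t => pospart t ^+ 2) t (2 * pospart t).
Proof.
apply/hasDe => e e0; exists e => // y _ yt.
apply: (@le_trans _ _ (`|y - t| * `|y - t|)); last by rewrite ler_wpM2r // ltW.
have -> : `|y - t| * `|y - t| = (y - t) ^+ 2 by rewrite -expr2 real_normK ?num_real.
have [[t0 ->]|[t0 ->]] := pospartP t; have [[y0 ->]|[y0 ->]] := pospartP y;
  rewrite ler_norml ?expr0n /= ?mulr0 ?mul0r ?subr0 ?sub0r; have h1 := sqr_ge0 y; have h2 := sqr_ge0 t;
  have h3 := sqr_ge0 (y - t); apply/andP; split; nra.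
Qed.

(* A quadratic spline, hence C^1, equal to 0 before 0 and to 1 after 1. *)
Definition step t : R :=
  2 * (pospart t ^+ 2 - 2 * pospart (t - 1/2) ^+ 2 + pospart (t - 1) ^+ 2).

Definition dstep t : R :=
  4 * (pospart t - 2 * pospart (t - 1/2) + pospart (t - 1)).

Ltac pospart_cases t :=
  have [[? ->]|[? ->]] := pospartP t; have [[? ->]|[? ->]] := pospartP (t - 1/2);
  have [[? ->]|[? ->]] := pospartP (t - 1).

Lemma step_le0 t : t <= 0 -> step t = 0.
Proof. by move=> t0; rewrite /step !pospart_le0E ?expr0n /=; lra. Qed.

Lemma step_ge1 t : 1 <= t -> step t = 1.
Proof. by move=> t0; rewrite /step !pospart_ge0E; [field|lra|lra|lra]. Qed.

Lemma step_bound t : 0 <= step t <= 1.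
Proof. by rewrite /step; apply/andP; split; pospart_cases t; rewrite ?expr0n /=; nra. Qed.

Lemma dstep_le0 t : t <= 0 -> dstep t = 0.
Proof. by move=> t0; rewrite /dstep !pospart_le0E; lra. Qed.

Lemma dstep_ge1 t : 1 <= t -> dstep t = 0.
Proof. by move=> t0; rewrite /dstep !pospart_ge0E; lra. Qed.

Lemma dstep_bound t : 0 <= dstep t <= 2.
Proof. by rewrite /dstep; apply/andP; split; pospart_cases t; lra. Qed.

Lemma hasD_shift D (f : R -> R) (l c t : R) : (forall D, hasD D f (t - c) l) ->
  hasD D (fun t => f (t - c)) t l.
Proof.
move=> h; rewrite -[l]mulr1; apply: (@hasD_comp _ D setT f (fun t => t - c)) => //.
by rewrite -[1]subr0; apply: hasDB; [exact: hasD_id|exact: hasD_cst].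
Qed.

Lemma hasD_step D t : hasD D step t (dstep t).
Proof.
have -> : dstep t = 2 * (2 * pospart t - 2 * (2 * pospart (t - 1/2)) + 2 * pospart (t - 1)).
  by rewrite /dstep; ring.
apply: hasDZ; apply: hasDD.
  apply: hasDB; first exact: hasD_pospart_sqr.
  apply: hasDZ; apply: (@hasD_shift D (fun t => pospart t ^+ 2)) => D'; exact: hasD_pospart_sqr.
apply: (@hasD_shift D (fun t => pospart t ^+ 2)) => D'; exact: hasD_pospart_sqr.
Qed.

Lemma continuous_dstep : continuous dstep.
Proof.
move=> t; have c c0 : {for t, continuous (fun t => pospart (t - c0))}.
  apply: (@cvg_comp _ _ _ (fun t => t - c0) pospart (nbhs t) (nbhs (t - c0))).
    by apply: cvgB; [exact: cvg_id|exact: cvg_cst].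
  exact: continuous_pospart.
apply: cvgM; first exact: cvg_cst.
apply: cvgD; last exact: c.
apply: cvgB; first exact: continuous_pospart.
by apply: cvgM; [exact: cvg_cst|exact: c].
Qed.

(** A C^1 Heaviside function rising on [x, x + e]. The difference of the ramps at x < y is a
    smoothed indicator of [x, y], admissible as a test function; its derivative is a difference of
    two one-sided mollifiers of mass 1. *)
Definition ramp x e z : R := step ((z - x) / e).

Definition dramp x e z : R := dstep ((z - x) / e) / e.

Lemma hasD_ramp D x e z : hasD D (ramp x e) z (dramp x e z).
Proof.
apply: (@hasD_comp _ D setT step (fun z => (z - x) / e)) => //; last exact: hasD_step.
have := hasDM (hasDB (hasD_id D z) (hasD_cst D x z)) (hasD_cst D e^-1 z).
by rewrite subr0 mul1r mulr0 addr0.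
Qed.

Lemma continuous_dramp x e : continuous (dramp x e).
Proof.
move=> z; apply: cvgM; last exact: cvg_cst.
apply: (@cvg_comp _ _ _ (fun t => (t - x) / e) dstep (nbhs z) (nbhs ((z - x) / e))).
  apply: cvgM; last exact: cvg_cst.
  by apply: cvgB; [exact: cvg_id|exact: cvg_cst].
exact: continuous_dstep.
Qed.

Lemma continuous_ramp x e : continuous (ramp x e).
Proof.
move=> z; have /hasD_cont := hasD_ramp setT x e z.
by rewrite /limw /within /= => h P /h; rewrite !nbhs_simpl /=; apply: filterS => ?; apply.
Qed.

Lemma ramp_eq0 x e z : 0 < e -> z <= x -> ramp x e z = 0.
Proof. by move=> e0 zx; rewrite /ramp step_le0 // pmulr_lle0 ?invr_gt0 // subr_le0. Qed.

Lemma ramp_eq1 x e z : 0 < e -> x + e <= z -> ramp x e z = 1.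
Proof. by move=> e0 zx; rewrite /ramp step_ge1 // ler_pdivlMr // mul1r; lra. Qed.

Lemma ramp_bound x e z : 0 <= ramp x e z <= 1.
Proof. exact: step_bound. Qed.

Lemma dramp_eq0 x e z : 0 < e -> ~~ (x < z < x + e) -> dramp x e z = 0.
Proof.
move=> e0; rewrite negb_and -!leNgt => /orP[zx|zx]; rewrite /dramp.
  by rewrite dstep_le0 ?mul0r // pmulr_lle0 ?invr_gt0 // subr_le0.
by rewrite dstep_ge1 ?mul0r // ler_pdivlMr // mul1r; lra.
Qed.

Lemma dramp_bound x e z : 0 < e -> 0 <= dramp x e z <= 2 / e.
Proof.
move=> e0; rewrite /dramp; have /andP[b0 b2] := dstep_bound ((z - x) / e).
by rewrite divr_ge0 ?(ltW e0) //= ler_wpM2r // invr_ge0 ltW.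
Qed.

Lemma test_function_ramps (a b x y e : R) : 0 < e -> a < x -> x < y -> y + e < b ->
  test_function a b (fun z => ramp x e z - ramp y e z) /\
  derive1 (fun z => ramp x e z - ramp y e z) = (fun z => dramp x e z - dramp y e z).
Proof.
move=> e0 ax xy yb.
have d z : is_derive z (1 : R) (fun z => ramp x e z - ramp y e z) (dramp x e z - dramp y e z).
  apply: (@hasD_is_derive _ setT); first exact: filterT.
  by apply: hasDB; exact: hasD_ramp.
have dE : derive1 (fun z => ramp x e z - ramp y e z) = (fun z => dramp x e z - dramp y e z).
  by apply/funext => z; rewrite derive1E; apply: derive_val.
split=> //; split.
- by move=> z; have [] := d z.
- rewrite dE => z; apply: cvgB; exact: continuous_dramp.
apply: (@subset_trans _ `[x, y + e]).
  rewrite [X in _ `<=` X](closure_id _).1; last exact: itv_closed.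
  apply: closureS => z /= nz; rewrite in_itv /=.
  have [zx|xz] := ltP z x.
    by move: nz; rewrite !ramp_eq0 ?subrr ?eqxx // ?ltW // (lt_trans zx).
  have [//|yz] := leP z (y + e).
  by move: nz; rewrite !ramp_eq1 ?subrr ?eqxx // ?(ltW yz) //; lra.
move=> z /=; rewrite !in_itv /= => /andP[xz zy].
by rewrite (lt_le_trans ax) // (le_lt_trans zy).
Qed.

End SmoothStep.

Section IntegralFTC.
Variable R : realType.
Local Notation mu := (@lebesgue_measure R).
Implicit Types (a b : R) (f F : R -> R).

Lemma Rintegral_oo_cc a b f : contw `[a, b] f -> \int[mu]_(x in `]a, b[) f x = \int[mu]_(x in `[a, b]) f x.
Proof.
move=> /contwP /continuous_itv_integrable /integrableP[mf _].
rewrite /Rintegral [in RHS]integral_itv_bndoo //.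
by apply: measurable_funS mf => //; exact: subset_itv_oo_cc.
Qed.

Lemma hasD_derivable_oo a b F f : a < b ->
  (forall x, a <= x <= b -> hasD `[a, b] F x (f x)) ->
  derivable_oo_LRcontinuous F a b /\ {in `]a, b[, derive1 F =1 f}.
Proof.
move=> ab dF.
have d x : x \in `]a, b[ -> is_derive x (1 : R) F (f x).
  move=> xab; apply: (@hasD_is_derive _ `[a, b]).
    by have := near_in_itvoo xab; apply: filterS => z; exact: subset_itv_oo_cc.
  by apply: dF; move: xab; rewrite in_itv /= => /andP[/ltW -> /ltW ->].
have cF : {within `[a, b], continuous F} by apply/contwP; exact: hasD_contw dF.
have [_ c1 c2] := (continuous_within_itvP F ab).1 cF.
split; first split => //.
  by move=> x xab; have [] := d x xab.
by move=> x xab; rewrite derive1E; have [_ ->] := d x xab.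
Qed.

Lemma Rintegral_hasD a b F f : a < b -> contw `[a, b] f ->
  (forall x, a <= x <= b -> hasD `[a, b] F x (f x)) ->
  \int[mu]_(x in `[a, b]) f x = F b - F a.
Proof.
move=> ab cf dF; have [d1 d2] := hasD_derivable_oo ab dF.
rewrite /Rintegral (continuous_FTC2 ab _ d1 d2) //.
exact/contwP.
Qed.

Lemma weak_deriv_hasD a b F f : a < b -> contw `[a, b] f ->
  (forall x, a <= x <= b -> hasD `[a, b] F x (f x)) -> weak_deriv a b F f.
Proof.
move=> ab cf dF psi [dpsi cpsi supp].
have [d1 d2] := hasD_derivable_oo ab dF.
have nz x : x \notin `]a, b[ -> psi x = 0.
  move=> xab; apply/eqP; apply: contraNT xab => px.
  by apply: supp; apply: subset_closure.
have cpsi0 : continuous psi by move=> x; apply: differentiable_continuous; apply/derivable1_diffP; exact: dpsi.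
have d3 : derivable_oo_LRcontinuous psi a b.
  split => [x _||]; first exact: dpsi.
    by apply: cvg_at_right_filter; exact: cpsi0.
  by apply: cvg_at_left_filter; exact: cpsi0.
have cF := hasD_contw dF; have cp : contw `[a, b] psi by exact: continuous_contw.
have cp' : contw `[a, b] (derive1 psi) by exact: continuous_contw.
rewrite (Rintegral_oo_cc (contwM cF cp')) (Rintegral_oo_cc (contwM cf cp)).
have -> := @Rintegration_by_parts R F psi f (derive1 psi) a b ab _ d1 d2 _ d3 _.
- by rewrite !nz ?mulr0 ?subrr ?sub0r // in_itv /= ltxx ?andbF.
- exact/contwP.
- exact: continuous_subspaceT.
- by [].
Qed.

End IntegralFTC.

(** * Weak derivatives: the lemma of du Bois-Reymond *)

Section WeakDerivative.
Variable R : realType.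
Local Notation mu := (@lebesgue_measure R).
Implicit Types (a b x y e : R) (h k : R -> R).

Lemma integrable_bounded_mul (D : set R) h k M : measurable D ->
  mu.-integrable D (EFin \o h) -> measurable_fun D k ->
  (forall x, D x -> `|k x| <= M) -> mu.-integrable D (EFin \o (fun x => h x * k x)).
Proof.
move=> mD ih mk kM.
apply: (@le_integrable _ _ _ mu D mD _ (fun x => (`|M|)%:E * (EFin \o h) x)%E).
- apply/measurable_EFinP; apply: measurable_funM => //.
  by case/integrableP : ih => /measurable_EFinP.
- move=> x Dx /=; rewrite lee_fin !normrM mulrC ler_wpM2r // normr_id.
  by rewrite (le_trans (kM x Dx)) // ler_norm.
- exact: integrableZl.
Qed.

Lemma integrable_oo_contw a b h : contw `[a, b] h -> mu.-integrable `]a, b[ (EFin \o h).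
Proof.
move=> /contwP/continuous_itv_integrable ih; apply: (integrableS _ _ _ ih) => //.
exact: subset_itv_oo_cc.
Qed.

Lemma Rintegral_dramp a b x e : a < b -> a < x -> 0 < e -> x + e < b ->
  \int[mu]_(z in `]a, b[) dramp x e z = 1.
Proof.
move=> ab ax e0 xb; have c : contw `[a, b] (dramp x e).
  by apply: continuous_contw; exact: continuous_dramp.
rewrite (Rintegral_oo_cc c) (Rintegral_hasD ab c (F := ramp x e)).
  by rewrite ramp_eq1 ?ramp_eq0 ?subr0 // ltW.
by move=> z _; exact: hasD_ramp.
Qed.

Lemma measurable_dramp (D : set R) x e : measurable_fun D (dramp x e).
Proof.
by apply: measurable_funS measurableT (@subsetT _ _) _; apply: continuous_measurable_fun; exact: continuous_dramp.
Qed.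

Lemma integrable_oo_dramp a b h x e : 0 < e -> mu.-integrable `]a, b[ (EFin \o h) ->
  mu.-integrable `]a, b[ (EFin \o (fun z => h z * dramp x e z)).
Proof.
move=> e0 ih; apply: (@integrable_bounded_mul _ _ _ (2 / e)) => //; first exact: measurable_dramp.
by move=> z _; have /andP[b0 b2] := dramp_bound x z e0; rewrite ger0_norm.
Qed.

(** The kernel has mass 1, is at most [2 / e] and lives in the ball of radius [e], of measure
    [2 * e]. The error is therefore at most 4 times the mean oscillation of [h] around [x], which
    explains [eta / 4]. *)
Lemma Rintegral_dramp_lebesgue a b h x eta :
  mu.-integrable `]a, b[ (EFin \o h) -> a < x < b ->
  lebesgue_pt (h \_ `]a, b[) x -> 0 < eta ->
  exists2 d, 0 < d & forall e, 0 < e -> e < d ->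
    `|\int[mu]_(z in `]a, b[) (h z * dramp x e z) - h x| <= eta.
Proof.
move=> ih /andP[ax xb] lx eta0; have ab := lt_trans ax xb.
set D : set R := `]a, b[%classic; have mD : measurable D by exact: measurable_itv.
have Dx : D x by rewrite /D /= in_itv /= ax.
set g := h \_ D.
have mh : measurable_fun D h by case/integrableP : ih => /measurable_EFinP.
have mg : measurable_fun setT g by apply/(measurable_restrictT _ _).1; [exact: mD|apply: mh].
have gE z : D z -> g z = h z by move=> Dz; rewrite /g patchE mem_set.
have e40 : 0 < eta / 4 by rewrite divr_gt0.
have := lx _ (@nbhs_open_ereal_lt R 0 (fun=> eta / 4) e40).
rewrite nbhs_simpl /= /at_right /within /= => /nbhs_ballP[d /= d0 hd].
exists (Num.min d (b - x)); first by rewrite lt_min d0 subr_gt0.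
move=> e e0; rewrite lt_min => /andP[ed exb].
have {}hd : (davg g x e < (eta / 4)%:E)%E.
  by apply: hd => //; rewrite /ball /= sub0r normrN gtr0_norm.
have xeb : x + e < b by lra.
have ibh := integrable_oo_dramp x e0 ih.
have i1 : mu.-integrable D (EFin \o cst (h x)).
  by apply: integrable_oo_contw; exact: contw_cst.
have -> : \int[mu]_(z in D) (h z * dramp x e z) - h x =
    \int[mu]_(z in D) ((h z - h x) * dramp x e z).
  have ic := integrable_oo_dramp x e0 i1.
  rewrite -[X in _ - X](mulr1) -(Rintegral_dramp ab ax e0 xeb).
  rewrite -RintegralZl //; last first.
    by apply: integrable_oo_contw; apply: continuous_contw; exact: continuous_dramp.
  rewrite -RintegralB //.
  by apply: eq_Rintegral => z _; rewrite mulrBl.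
have id : mu.-integrable D (EFin \o (fun z => (h z - h x) * dramp x e z)).
  apply: integrable_oo_dramp => //.
  exact: (integrableB _ ih i1).
rewrite -lee_fin EFin_normr_Rintegral //.
apply: (le_trans (le_abse_integral _ _ _)) => //.
  by case/integrableP : id.
have mB : measurable (ball x e : set R) by exact: measurable_ball.
have mgx : measurable_fun setT (fun z => (`|g z - g x|)%:E).
  apply/measurable_EFinP; apply: measurableT_comp => //.
  by apply: measurable_funB => //; exact: measurable_cst.
apply: (@le_trans _ _ (\int[mu]_(z in ball x e) ((2 / e)%:E * (`|g z - g x|)%:E)))%E.
  rewrite [leLHS]integral_mkcond [leRHS]integral_mkcond.
  apply: ge0_le_integral => //=.
  - by move=> z _; rewrite patchE; case: ifP => // _; rewrite lee_fin.
  - apply/(measurable_restrictT _ _).1; first exact: mD.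
    have /integrableP[/measurable_EFinP m _] := id.
    by apply/measurable_EFinP; apply: measurableT_comp.
  - apply/(measurable_restrictT _ _).1; first exact: mB.
    apply: measurable_funS measurableT (@subsetT _ _) _ => //.
    exact: measurable_funeM.
  - move=> z _; rewrite !patchE.
    case: ifPn => [Dz|_]; last first.
      by case: ifP => // _; rewrite -EFinM lee_fin mulr_ge0 // divr_ge0 // ltW.
    rewrite inE in Dz; rewrite normrM (gE z Dz) (gE x Dx).
    have /andP[k0 k2] := dramp_bound x z e0.
    case: ifPn => [_|nB].
      by rewrite -EFinM lee_fin mulrC ler_wpM2r // ger0_norm.
    rewrite dramp_eq0 ?normr0 ?mulr0 //; apply: contra nB => /andP[xz ze].
    by rewrite inE /ball /= distrC ger0_norm; lra.
rewrite ge0_integralZl //; last first.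
- by rewrite lee_fin divr_ge0 // ltW.
- by apply: measurable_funS measurableT (@subsetT _ _) _ => //.
move: hd; rewrite /davg /iavg lebesgue_measure_ball ?(ltW e0) //.
have e2 : e *+ 2 != 0 by rewrite mulrn_eq0 /= gt_eqF.
rewrite inver (negbTE e2) => hd.
have -> : (2 / e)%:E = (4%:E * ((e *+ 2)^-1)%:E)%E.
  by rewrite -EFinM; congr EFin; rewrite -mulr_natr; field; rewrite gt_eqF.
rewrite -muleA; apply: (@le_trans _ _ (4%:E * (eta / 4)%:E))%E.
  by apply: lee_wpmul2l => //; exact: ltW.
by rewrite -EFinM lee_fin; lra.
Qed.

(** Dominated convergence with majorant [|k|]. The limit interval is open at [x] and closed at [y]
    because each ramp still vanishes at its own foot. *)
Lemma Rintegral_ramp_cvg a b k x y c : mu.-integrable `]a, b[ (EFin \o k) ->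
  a < x -> x < y -> y < b -> 0 < c ->
  \int[mu]_(z in `]a, b[) (k z * (ramp x (c / n.+1%:R) z - ramp y (c / n.+1%:R) z)) @[n --> \oo]
    --> \int[mu]_(z in `]x, y]) k z.
Proof.
move=> ik ax xy yb c0.
set D : set R := `]a, b[%classic; have mD : measurable D by exact: measurable_itv.
have mk : measurable_fun D k by case/integrableP : ik => /measurable_EFinP.
pose e n : R := c / n.+1%:R; have e0 n : 0 < e n by rewrite divr_gt0.
pose A : set R := `]x, y]%classic.
have AD : A `<=` D by move=> z; rewrite /A /D /= !in_itv /= => /andP[xz zy]; apply/andP; split; lra.
pose f_ n z := (k z * (ramp x (e n) z - ramp y (e n) z))%:E.
have rb n z : `|ramp x (e n) z - ramp y (e n) z| <= 1.
  have /andP[? ?] := ramp_bound x (e n) z; have /andP[? ?] := ramp_bound y (e n) z.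
  by rewrite ler_norml; apply/andP; split; lra.
have mr w n : measurable_fun D (ramp w (e n)).
  by apply: measurable_funS measurableT (@subsetT _ _) _; apply: continuous_measurable_fun; exact: continuous_ramp.
have [|||||i1 _ i3] := @dominated_convergence _ _ _ mu D mD f_ (EFin \o (k \_ A)) (abse \o (EFin \o k)).
- move=> n; apply/measurable_EFinP; apply: measurable_funM => //.
  by apply: measurable_funB; apply: mr.
- apply/measurable_EFinP; apply/measurable_restrict => //; first exact: measurable_itv.
  by apply: measurable_funS mk => // z [].
- apply: aeW => z Dz /=; apply: cvg_near_cst.
  have [xz|zx] := ltP x z; last first.
    apply: nearW => n; rewrite /f_ !ramp_eq0 ?subrr ?mulr0 ?patchE ?(le_trans zx (ltW xy)) //.
    by rewrite memNset // /A /= in_itv /= ltNge zx.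
  have h w : w < z -> \forall n \near \oo, ramp w (e n) z = 1.
    move=> wz; have p : 0 < z - w by lra.
    near=> n; rewrite ramp_eq1 // -lerBrDl /e ler_pdivrMr // -ler_pdivrMl //.
    rewrite mulrC; apply: (@le_trans _ _ n%:R); last by rewrite ler_nat.
    by near: n; exact: nbhs_infty_ger.
  have [yz|zy] := ltP y z.
    near=> n; rewrite /f_ (near (h _ xz) n) // (near (h _ yz) n) // subrr mulr0 patchE memNset //.
    by rewrite /A /= in_itv /= xz /= leNgt yz.
  near=> n; rewrite /f_ (near (h _ xz) n) // (ramp_eq0 _ zy) // subr0 mulr1 patchE mem_set //.
  by rewrite /A /= in_itv /= xz.
- exact: integrable_abse.
- apply: aeW => z n Dz; rewrite /f_ /= lee_fin normrM ler_piMr //.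
have -> : \int[mu]_(z in `]x, y]) k z = \int[mu]_(z in D) ((k \_ A) z).
  by rewrite -Rintegral_mkcondr setIidr.
apply: fine_cvg; rewrite fineK; last exact: integrable_fin_num.
exact: i3.
Unshelve. all: by end_near. Qed.

Lemma integrable_oo_cc a b k : mu.-integrable `]a, b[ (EFin \o k) ->
  mu.-integrable `[a, b] (EFin \o k).
Proof.
move=> /integrableP[mk ik]; apply/integrableP; split.
  exact: emeasurable_fun_itv_cc mk.
rewrite integral_itv_bndoo //; exact: measurableT_comp.
Qed.

Lemma contw_gmap_integrable b k : 0 <= b -> mu.-integrable `]0, b[ (EFin \o k) ->
  contw `[0, b] (gmap k).
Proof.
by move=> b0 /integrable_oo_cc ik; apply/contwP; exact: parameterized_integral_continuous.
Qed.

Lemma gmap_diff b k x y : mu.-integrable `]0, b[ (EFin \o k) ->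
  0 <= x -> x < y -> y <= b -> gmap k y - gmap k x = \int[mu]_(z in `]x, y]) k z.
Proof.
move=> /integrable_oo_cc ik x0 xy yb; rewrite /gmap.
rewrite (@Rintegral_itvB R k (BLeft 0) (BRight y) x) ?bnd_simp //; last exact: ltW.
by apply: integrableS ik => //; apply: subset_itvl; rewrite bnd_simp.
Qed.

(* Du Bois-Reymond: testing against a smoothed indicator of [[x, y]] gives
   [h y - h x = \int_x^y k] at all Lebesgue points [x < y] of [h]. *)
Lemma weak_deriv_ae b h k : mu.-integrable `]0, b[ (EFin \o h) ->
  mu.-integrable `]0, b[ (EFin \o k) -> weak_deriv 0 b h k ->
  exists c, {ae mu, forall x, x \in `]0, b[ -> h x = c + gmap k x}.
Proof.
move=> ih ik wd.
set D : set R := `]0, b[%classic; have mD : measurable D by exact: measurable_itv.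
pose Leb x := lebesgue_pt (h \_ D) x.
have key x y : D x -> D y -> x < y -> Leb x -> Leb y -> h y - h x = gmap k y - gmap k x.
  rewrite /D /= !in_itv /= => /andP[x0 xb] /andP[y0 yb] xy Lx Ly.
  rewrite (gmap_diff ik (ltW x0) xy (ltW yb)).
  (* Half of the room to the right of [y] keeps the support of every test function inside the open
     interval. *)
  have c0 : 0 < (b - y) / 2 by lra.
  have cv := Rintegral_ramp_cvg ik x0 xy yb c0.
  apply/eqP; rewrite -subr_eq0 -normr_le0; apply/ler_addgt0Pl => e e0; rewrite addr0.
  have e30 : 0 < e / 3 by lra.
  have xb' : 0 < x < b by rewrite x0.
  have yb' : 0 < y < b by rewrite y0.
  have [d1 d10 h1] := Rintegral_dramp_lebesgue ih xb' Lx e30.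
  have [d2 d20 h2] := Rintegral_dramp_lebesgue ih yb' Ly e30.
  have /cvgrPdist_le/(_ _ e30) near_ := cv.
  have small d : 0 < d -> \forall n \near \oo, (b - y) / 2 / n.+1%:R < d.
    move=> d0; near=> n; rewrite ltr_pdivrMr // -ltr_pdivrMl // mulrC.
    apply: (@le_lt_trans _ _ n%:R); last by rewrite ltr_nat.
    by near: n; exact: nbhs_infty_ger.
  have [n [n1 n2 n3]] : exists n, [/\ `|\int[mu]_(z in `]x, y]) k z - \int[mu]_(z in D) (k z * (ramp x ((b - y) / 2 / n.+1%:R) z - ramp y ((b - y) / 2 / n.+1%:R) z))| <= e / 3,
     (b - y) / 2 / n.+1%:R < d1 & (b - y) / 2 / n.+1%:R < d2].
    near \oo => n; exists n; split.
    - by near: n.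
    - by near: n; exact: small.
    - by near: n; exact: small.
  set e1 := (b - y) / 2 / n.+1%:R in n1 n2 n3 *.
  have e10 : 0 < e1 by rewrite divr_gt0.
  have ye : y + e1 < b.
    have : e1 <= (b - y) / 2 by rewrite ler_pdivrMr // ler_peMr ?(ltW c0) // ler1n.
    lra.
  have [tf dtf] := test_function_ramps e10 x0 xy ye.
  have := wd _ tf; rewrite dtf.
  have -> : \int[mu]_(z in D) (h z * (dramp x e1 z - dramp y e1 z)) =
     \int[mu]_(z in D) (h z * dramp x e1 z) - \int[mu]_(z in D) (h z * dramp y e1 z).
    rewrite -RintegralB //; try exact: integrable_oo_dramp.
    by apply: eq_Rintegral => z _; rewrite mulrBr.
  have := h1 _ e10 n2; have := h2 _ e10 n3; move: n1.
  rewrite -/D !ler_norml => /andP[? ?] /andP[? ?] /andP[? ?] E.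
  apply/andP; split; lra.
have aeL : {ae mu, forall x, Leb x}.
  by apply: lebesgue_differentiation; exact: integrable_locally_restrict.
(* One Lebesgue point in [D] fixes the constant. If there is none, almost no point lies in [D], and
   any constant will do. *)
have [[x0 [Dx0 Lx0]]|no] := pselect (exists x0, D x0 /\ Leb x0).
  exists (h x0 - gmap k x0); move: aeL; apply: filterS; first exact: (ae_filter_ringOfSetsType mu).
  move=> x Lx Dx.
  have {}Dx : D x by [].
  have [xx|xx|->] := ltgtP x x0; last by ring.
    have := key _ _ Dx Dx0 xx Lx Lx0; lra.
  have := key _ _ Dx0 Dx xx Lx0 Lx; lra.
exists 0; move: aeL; apply: filterS; first exact: (ae_filter_ringOfSetsType mu).
  move=> x Lx Dx.
by exfalso; apply: no; exists x.
Unshelve. all: by end_near. Qed.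

Lemma ae_exists_itv (P : R -> Prop) (c d : R) : {ae mu, forall x, P x} -> c < d ->
  exists2 y, c < y < d & P y.
Proof.
move=> [N [mN N0 sub]] cd; apply: contrapT => no.
have : (mu `]c, d[ <= mu N)%E.
  apply: le_measure; rewrite ?inE //.
  move=> y /=; rewrite in_itv /= => ycd; apply: sub => /= Py.
  by apply: no; exists y.
rewrite [X in (_ <= X)%E]N0 lebesgue_measure_itv /= lte_fin cd -EFinD lee_fin; lra.
Qed.

Lemma ae_eq_contw b f g : 0 < b -> contw `[0, b] f -> contw `[0, b] g ->
  {ae mu, forall x : R, x \in `]0, b[ -> f x = g x} ->
  forall x : R, 0 <= x <= b -> f x = g x :> R.
Proof.
move=> b0 cf cg fg x xb; apply/eqP; rewrite -subr_eq0 -normr_le0.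
apply/ler_addgt0Pl => e e0; rewrite addr0.
have Ix : [set` `[0, b]] x by rewrite /= in_itv.
have /limwP/(_ _ e0)[d d0 hd] := contwB cf cg Ix.
case/andP: xb => x0 xb.
have [y] : exists2 y, Num.max 0 (x - d) < y < Num.min b (x + d) & (y \in `]0, b[ -> f y = g y).
  apply: ae_exists_itv => //; rewrite lt_min !gt_max; repeat (apply/andP; split); lra.
rewrite lt_min gt_max => /andP[/andP[y0 yx] /andP[yb yx']] eq.
have Iy : [set` `[0, b]] y by rewrite /= in_itv /= !ltW.
have := hd y Iy; rewrite eq ?in_itv /= ?y0 // subrr sub0r normrN; apply.
by rewrite /ball /= ltr_norml; apply/andP; split; lra.
Qed.

(** Two continuous functions that agree almost everywhere agree everywhere, so the constant of
    [weak_deriv_ae] is the value at 0 and the identity extends to the end points. *)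
Lemma weak_deriv_gmap b h k : 0 < b -> contw `[0, b] h ->
  mu.-integrable `]0, b[ (EFin \o k) -> weak_deriv 0 b h k ->
  forall x : R, 0 <= x <= b -> h x = h 0 + gmap k x.
Proof.
move=> b0 ch ik wd.
have [c hc] := weak_deriv_ae (integrable_oo_contw ch) ik wd.
have ck : contw `[0, b] (fun x => c + gmap k x).
  by apply: contwD; [exact: contw_cst|apply: contw_gmap_integrable => //; exact: ltW].
have H := ae_eq_contw b0 ch ck hc.
have H0 : h 0 = c by rewrite H ?gmap0 ?addr0 // lexx ltW.
by move=> x xb; rewrite H // H0.
Qed.

End WeakDerivative.

(** * Energy minimizer and nutrient concentration for a fixed growth *)

Section InnerIntegral.
Local Open Scope ereal_scope.
Context d (T : measurableType d) (R : realType) (mu : {measure set T -> \bar R}).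
Implicit Types (D N : set T) (f g : T -> \bar R).
Import HBNNSimple.

(** Monotonicity is read off the definition by simple functions, without measurability. This matters
    for the energy of a competitor: on a null set its derivative may fail to be positive, and
    nothing is known about [W] there. *)
Lemma integral_mono_inner D f g : (forall x, D x -> 0 <= f x) ->
  (forall x, D x -> f x <= g x) -> \int[mu]_(x in D) f x <= \int[mu]_(x in D) g x.
Proof.
move=> f0 fg; have g0 x : D x -> 0 <= g x by move=> Dx; exact: le_trans (f0 x Dx) (fg x Dx).
rewrite !ge0_integralE //; apply: ereal_sup_le => _ [h /= hf <-].
exists h => //= x; apply: (le_trans (hf x)).
by rewrite !patchE; case: ifPn => // /set_mem; exact: fg.
Qed.

Lemma integral_null_support D N f : measurable N -> mu N = 0 ->
  (forall x, D x -> 0 <= f x) -> (forall x, D x -> ~ N x -> f x = 0) ->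
  \int[mu]_(x in D) f x = 0.
Proof.
move=> mN N0 f0 fN; apply/eqP; rewrite eq_le integral_ge0 // andbT.
rewrite ge0_integralE //; apply: ge_ereal_sup => _ [h /= hf <-].
have -> : sintegral mu h = \int[mu]_(x in setT) (h x)%:E.
  by rewrite integral_nnsfun // patch_setT.
rewrite (@ge0_negligible_integral _ _ _ mu setT N) //.
- rewrite integral0_eq // => x [_ Nx]; apply/eqP; rewrite eq_le; apply/andP; split; last first.
    by rewrite lee_fin.
  apply: (le_trans (hf x)); rewrite patchE; case: ifPn => // /set_mem Dx.
  by rewrite fN.
- exact/measurable_EFinP.
- by move=> x _; rewrite lee_fin.
Qed.

(* No measurability of [f] is needed: the integral of a nonnegative function is
   the supremum over the simple functions below it. *)
Lemma integral_ae_lower_bound D N f (u : T -> R) : measurable D -> measurable N -> mu N = 0 ->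
  (forall x, D x -> ~ N x -> 0 <= f x) -> (forall x, D x -> ~ N x -> (u x)%:E <= f x) ->
  mu.-integrable D (EFin \o u) ->
  \int[mu]_(x in D) (u x)%:E <= \int[mu]_(x in D) f x.
Proof.
move=> mD mN N0 f0 uf iu.
rewrite [leRHS]integralE [X in _ - X](@integral_null_support _ N) //; last first.
  by move=> x Dx Nx; rewrite funenegE max_r // leeNl oppe0 f0.
rewrite sube0 [leLHS]integralE.
apply: (@le_trans _ _ (\int[mu]_(x in D) (EFin \o u)^\+ x)).
  by rewrite -[leRHS]sube0 leeB // integral_ge0 // => x _; exact: funeneg_ge0.
rewrite (@ge0_negligible_integral _ _ _ mu D N) //; last first.
  by apply: measurable_funepos; case/integrableP : iu.
rewrite [leLHS]integral_mkcond [leRHS]integral_mkcond.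
apply: integral_mono_inner => x _.
  by rewrite patchE; case: ifP => // _; exact: funepos_ge0.
rewrite !patchE; case: ifPn => [/set_mem[Dx Nx]|_].
  by rewrite mem_set // !funeposE ge_max !le_max lexx orbT (uf x Dx Nx).
by case: ifP => // _; exact: funepos_ge0.
Qed.

End InnerIntegral.

(** * The inverse of an increasing differentiable function *)

Section InverseFunction.
Variables (R : realType) (L : R) (f f' : R -> R).
Hypothesis L0 : 0 < L.
Hypothesis df : forall x, 0 <= x <= L -> hasD `[0, L] f x (f' x).
Hypothesis cf' : contw `[0, L] f'.
Hypothesis f'0 : forall x, 0 <= x <= L -> 0 < f' x.
Hypothesis f0 : f 0 = 0.

Let l := f L.
Let I x : 0 <= x <= L -> [set` `[0, L]] x. Proof. by rewrite /= in_itv. Qed.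

Lemma incr_lt x y : 0 <= x -> x < y -> y <= L -> f x < f y.
Proof.
move=> x0 xy yL; have [c cxy e] : exists2 c, x <= c <= y & f y - f x = f' c * (y - x).
  apply: mvt; last exact: ltW.
  move=> z /andP[xz zy]; apply: hasD_sub (df _); first exact: itv_subset.
  by rewrite (le_trans x0) //= (le_trans zy).
rewrite -subr_gt0 e mulr_gt0 ?subr_gt0 // f'0 //.
by case/andP: cxy => ? ?; apply/andP; split; lra.
Qed.

Lemma incr_le x y : 0 <= x -> x <= y -> y <= L -> f x <= f y.
Proof.
move=> x0; rewrite le_eqVlt => /predU1P[->//|xy yL]; exact/ltW/incr_lt.
Qed.

Lemma incr_itv x : 0 <= x <= L -> 0 <= f x <= l.
Proof. by move=> /andP[x0 xL]; rewrite -[X in X <= _]f0 !incr_le. Qed.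

Lemma incr_end_gt0 : 0 < l.
Proof. by rewrite -f0; apply: incr_lt. Qed.

Lemma inverse_onK x : 0 <= x <= L -> inverse_on `[0, L] f (f x) = x.
Proof.
move=> xL; apply: pinvKV; last by rewrite inE; exact: I.
move=> a b; rewrite !inE /= !in_itv /= => /andP[a0 aL] /andP[b0 bL] e.
have [ab|ab|//] := ltgtP a b.
  by have := incr_lt a0 ab bL; rewrite e ltxx.
by have := incr_lt b0 ab aL; rewrite e ltxx.
Qed.

Lemma inverse_on_ex z : 0 <= z <= l -> exists2 x, 0 <= x <= L & f x = z.
Proof.
move=> zl; have [||x] := @IVT R f 0 L z (ltW L0).
- by apply/contwP; exact: hasD_contw df.
- by rewrite f0 -/l min_l ?max_r ?(ltW incr_end_gt0).
by rewrite in_itv /= => xL fx; exists x.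
Qed.

Lemma inverse_on_itv z : 0 <= z <= l -> 0 <= inverse_on `[0, L] f z <= L.
Proof. by move=> /inverse_on_ex[x xL <-]; rewrite inverse_onK. Qed.

Lemma inverse_on_right z : 0 <= z <= l -> f (inverse_on `[0, L] f z) = z.
Proof. by move=> /inverse_on_ex[x xL <-]; rewrite inverse_onK. Qed.

(** The Carathéodory slope of the inverse is [1 / phi (g y)]. By the mean value theorem [phi] is at
    least [m > 0] away from the base point, and the same estimate makes the inverse Lipschitz with
    constant [1 / m], hence continuous. *)
Lemma inverse_on_hasD z : 0 <= z <= l ->
  hasD `[0, l] (inverse_on `[0, L] f) z (f' (inverse_on `[0, L] f z))^-1.
Proof.
move=> zl; set g := inverse_on _ _.
have f'I x : [set` `[0, L]] x -> 0 < f' x by rewrite /= in_itv /=; exact: f'0.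
have [m m0 hm] := compact_pos_bound (@segment_compact R 0 L) cf' f'I.
have slope x y : 0 <= x <= L -> 0 <= y <= L -> exists2 c, 0 <= c <= L & f y - f x = f' c * (y - x).
  move=> /andP[? ?] /andP[? ?]; have [c cxy e] : exists2 c, Num.min x y <= c <= Num.max x y & f y - f x = f' c * (y - x).
    apply: (@mvt_conv _ `[0, L]).
      move=> c; rewrite /= in_itv /= ge_min le_max => /andP[/orP[] ? /orP[] ?]; apply/andP; split; lra.
    by move=> c; rewrite /= in_itv /=; exact: df.
  exists c => //; move: cxy; rewrite ge_min le_max => /andP[/orP[] ? /orP[] ?]; apply/andP; split; lra.
have lip y : 0 <= y <= l -> `|g y - g z| <= `|y - z| / m.
  move=> yl; rewrite ler_pdivlMr //.
  have [c cL e] := slope (g z) (g y) (inverse_on_itv zl) (inverse_on_itv yl).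
  rewrite !inverse_on_right // in e; rewrite e normrM mulrC ler_wpM2r //.
  by rewrite (le_trans (hm c (I cL))) // ler_norm.
have gz := inverse_on_itv zl.
have [phi hphi lphi] := df gz.
have phim y : 0 <= y <= L -> y != g z -> m <= phi y.
  move=> yL nz; have [c cL e] := slope (g z) y gz yL.
  have := hphi y (I yL); rewrite e => /(mulIf _) <-; first exact/hm/I.
  by rewrite subr_eq0.
have e y : 0 <= y <= l -> y - z = phi (g y) * (g y - g z).
  move=> yl; rewrite -(hphi (g y)) ?inverse_on_right //; exact/I/inverse_on_itv.
exists (fun y => (phi (g y))^-1).
  move=> y; rewrite /= in_itv /= => yl.
  have [->|nyz] := eqVneq y z; first by rewrite !subrr mulr0.
  have ngz : g y != g z.
    by apply: contra_neq nyz => gyz; rewrite -(inverse_on_right yl) -/g gyz inverse_on_right.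
  have p : phi (g y) != 0 by rewrite gt_eqF // (lt_le_trans m0) // phim // inverse_on_itv.
  by rewrite e // mulKf.
apply: limwV; first by rewrite gt_eqF ?f'0.
apply: (@limw_comp _ _ `[0, l]%classic _ `[0, L]%classic g phi z (g z)) => //.
  by move=> y; rewrite /= in_itv /= => yl; apply/I/inverse_on_itv.
apply/(limwP `[0, l]%classic g z (g z)) => eps e0; exists (eps * m); first by rewrite mulr_gt0.
move=> y; rewrite /= in_itv /= => yl; rewrite /ball /= distrC => yz.
by rewrite (le_trans (lip y yl)) // ler_pdivrMr // ltW.
Qed.

End InverseFunction.

Section RowContinuity.
Variable R : realType.

Lemma limw_row (U : topologicalType) (A : set U) n (v : U -> 'rV[R]_n) x (w : 'rV[R]_n) :
  (forall i, limw A (fun u => v u 0 i) x (w 0 i)) -> v @ within A (nbhs x) --> w.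
Proof.
move=> h; apply/cvg_ballP => e e0.
have : \forall u \near within A (nbhs x), forall j, ball (w 0 j) e (v u 0 j).
  by apply: filter_forall => j; have /cvg_ballP/(_ _ e0) := h j.
by apply: filterS => u hu; split => // i j; rewrite (ord1 i).
Qed.

Definition row2 (a b : R) : 'rV[R]_2 := \row_i [:: a; b]`_i.

Lemma uncurry2_row2 (f : R -> R -> R) a b : uncurry2 f (row2 a b) = f a b.
Proof. by rewrite /uncurry2 !mxE. Qed.

Lemma box_row2 (D : 'I_2 -> set R) a b : D 0 a -> D 1 b -> box D (row2 a b).
Proof.
move=> Da Db i; rewrite mxE; case: i => [[|[|//]] hi] /=.
  by rewrite (_ : Ordinal hi = 0) //; exact: val_inj.
by rewrite (_ : Ordinal hi = 1) //; exact: val_inj.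
Qed.

Lemma within_box_cont2 (D : 'I_2 -> set R) (f : R -> R -> R) :
  {within box D, continuous (uncurry2 f)} -> cont2 (D 0) (D 1) f.
Proof.
move=> /contwP cf [a b] [/= Da Db].
have := @limw_comp R _ (D 0 `*` D 1) _ (box D) (fun z => row2 z.1 z.2) (uncurry2 f) (a, b) (row2 a b) (f a b).
rewrite (_ : uncurry2 f \o (fun z => row2 z.1 z.2) = (fun z => f z.1 z.2)); last first.
  by apply/funext => z; rewrite /= uncurry2_row2.
apply.
- by move=> [x y] [/= Dx Dy]; exact: box_row2.
- apply: limw_row => i; case: i => [[|[|//]] hi] /=.
    rewrite [X in limw _ X](_ : _ = fun z : R * R => z.1); last by apply/funext => z; rewrite !mxE.
    by rewrite mxE; apply: (@contw_fst R (D 0) (D 1) (a, b)); split.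
  rewrite [X in limw _ X](_ : _ = fun z : R * R => z.2); last by apply/funext => z; rewrite !mxE.
  by rewrite mxE; apply: (@contw_snd R (D 0) (D 1) (a, b)); split.
by have := cf _ (box_row2 Da Db); rewrite uncurry2_row2.
Qed.

End RowContinuity.

Section DefinedOnDeleted.
Variable R : realType.

Lemma derivable_in_hasD (D : set R) f x : derivable_in D f x -> exists l, hasD D f x l.
Proof. by move=> /cvg_ex[l fl]; exists l; apply/hasD_ratio. Qed.

Lemma hasD_derivable_in (D : set R) f x l : hasD D f x l -> derivable_in D f x.
Proof. by move=> /hasD_ratio fl; apply/cvg_ex; exists l. Qed.

(** [deriv_in] is a [lim] along a deleted filter; accumulation of [D] at [x] makes that filter
    proper, hence the limit unique. *)
Lemma hasD_deriv_in (D : set R) f x l :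
  (forall d, 0 < d -> exists y, [/\ D y, y != x & `|y - x| < d]) ->
  hasD D f x l -> deriv_in D f x = l.
Proof.
move=> acc /hasD_ratio fl.
have PF : ProperFilter (within D x^').
  split; last exact: within_filter.
  rewrite /within /dnbhs /= => /nbhs_ballP[d /= d0 hd].
  have [y [Dy nyx yx]] := acc d d0.
  by apply: (hd y) => //; rewrite /ball /= distrC.
exact: (cvg_lim _ fl).
Qed.

Lemma deriv_in_hasD (D : set R) f x :
  (forall d, 0 < d -> exists y, [/\ D y, y != x & `|y - x| < d]) ->
  derivable_in D f x -> hasD D f x (deriv_in D f x).
Proof.
by move=> acc /derivable_in_hasD[l hl]; rewrite (hasD_deriv_in acc hl).
Qed.

End DefinedOnDeleted.

Lemma integrable_oo_Z (R : realType) (a b c : R) (f : R -> R) :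
  (@lebesgue_measure R).-integrable `]a, b[ (EFin \o f) ->
  (@lebesgue_measure R).-integrable `]a, b[ (EFin \o (fun x => c * f x)).
Proof.
move=> i; rewrite (_ : _ \o _ = (fun x => c%:E * (EFin \o f) x)%E).
  by apply: integrableZl => //; exact: measurable_itv.
by apply/funext => x; rewrite /= EFinM.
Qed.

Lemma integrable_oo_D (R : realType) (a b : R) (f g : R -> R) :
  (@lebesgue_measure R).-integrable `]a, b[ (EFin \o f) ->
  (@lebesgue_measure R).-integrable `]a, b[ (EFin \o g) ->
  (@lebesgue_measure R).-integrable `]a, b[ (EFin \o (fun x => f x + g x)).
Proof.
move=> i j; rewrite (_ : EFin \o _ = (fun x => (EFin \o f) x + (EFin \o g) x)%E).
  by apply: integrableD => //; exact: measurable_itv.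
by apply/funext => x; rewrite /= EFinD.
Qed.

Section GmapAe.
Variable R : realType.
Local Notation mu := (@lebesgue_measure R).

Lemma Rintegral_oo_gmap (b : R) k : measurable_fun (`]0, b[%classic : set R) k ->
  \int[mu]_(z in `]0, b[) k z = gmap k b.
Proof. by move=> mk; rewrite /gmap /Rintegral [in RHS]integral_itv_bndoo //; exact/measurable_EFinP. Qed.

Lemma gmap_ae (b : R) f k : 0 < b -> mu.-integrable `]0, b[ (EFin \o f) ->
  mu.-integrable `]0, b[ (EFin \o k) ->
  {ae mu, forall z, z \in `]0, b[ -> f z = k z} ->
  forall z, 0 <= z <= b -> gmap f z = gmap k z.
Proof.
move=> b0 /integrableP[/measurable_EFinP mf _] /integrableP[/measurable_EFinP mk _] ae z zb.
have sub : `]0, z[%classic `<=` (`]0, b[%classic : set R).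
  by apply: subset_itvl; rewrite bnd_simp; case/andP: zb.
have m1 : measurable_fun (`]0, z[%classic : set R) f by apply: measurable_funS mf.
have m2 : measurable_fun (`]0, z[%classic : set R) k by apply: measurable_funS mk.
rewrite -(Rintegral_oo_gmap m1) -(Rintegral_oo_gmap m2).
congr fine; apply: ae_eq_integral => //; try exact/measurable_EFinP.
move: ae; apply: filterS; first exact: (ae_filter_ringOfSetsType mu).
by move=> x h /= /sub xl; rewrite h.
Qed.

End GmapAe.

(** * The deformation of constant stress is the unique minimizer *)

Section Minimizer.
Variables (R : realType) (L l0 : R) (W : R -> R -> R) (G p : R -> R) (s : R).
Local Notation mu := (@lebesgue_measure R).
Hypothesis L0 : 0 < L.
Hypothesis l00 : 0 < l0.
Hypothesis Wcont : cont2 `[0, L]%classic `]0, +oo[%classic W.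
Hypothesis W_ge0 : forall X q, 0 <= X <= L -> 0 < q -> 0 <= W X q.
Hypothesis Wdiff : forall X q, 0 <= X <= L -> 0 < q -> hasD `]0, +oo[ (W X) q (dpW W X q).
Hypothesis dpW_mono : forall X q r, 0 <= X <= L -> 0 < q -> q <= r -> dpW W X q <= dpW W X r.
Hypothesis Wconvex : forall X, 0 <= X <= L -> strictly_convex `]0, +oo[ (W X).
Hypothesis Gcont : contw `[0, L] G.
Hypothesis Gpos : forall x, 0 <= x <= L -> 0 < G x.
Hypothesis pcont : contw `[0, L] p.
Hypothesis ppos : forall x, 0 <= x <= L -> 0 < p x.
Hypothesis pstress : forall x, 0 <= x <= L -> dpW W x (p x) = s.
Hypothesis plen : gmap (fun x => p x * G x) L = l0.

Local Notation g := (gmap G).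
Local Notation l := (gmap G L).
Local Notation gi := (ginv L G).
Local Notation Y := (gmap (fun x => p x * G x)).
(** The stretch and the deformation of constant stress [s], transported from the material coordinate
    X to the grown coordinate z = g(X). *)
Let ph z := p (gi z).
Let phi z := Y (gi z).

Let pG : contw `[0, L] (fun x => p x * G x). Proof. exact: contwM. Qed.
Let dg x : 0 <= x <= L -> hasD `[0, L] g x (G x). Proof. exact: hasD_gmap. Qed.
Let dY x : 0 <= x <= L -> hasD `[0, L] Y x (p x * G x). Proof. exact: hasD_gmap. Qed.
Let lpos : 0 < l. Proof. exact: (incr_end_gt0 L0 dg Gpos (gmap0 G)). Qed.
Let gi_itv z : 0 <= z <= l -> 0 <= gi z <= L.
Proof. exact: (inverse_on_itv L0 dg Gpos (gmap0 G)). Qed.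
Let giK z : 0 <= z <= l -> g (gi z) = z.
Proof. exact: (inverse_on_right L0 dg Gpos (gmap0 G)). Qed.
Let Kgi x : 0 <= x <= L -> gi (g x) = x.
Proof. exact: (inverse_onK dg Gpos). Qed.
Let dgi z : 0 <= z <= l -> hasD `[0, l] gi z (G (gi z))^-1.
Proof. exact: (inverse_on_hasD L0 dg Gcont Gpos (gmap0 G)). Qed.
Let g_itv x : 0 <= x <= L -> 0 <= g x <= l.
Proof. exact: (incr_itv dg Gpos (gmap0 G)). Qed.
Let gi_maps z : [set` `[0, l]] z -> [set` `[0, L]] (gi z).
Proof. by rewrite /= !in_itv /=; exact: gi_itv. Qed.
Let gi_cont : contw `[0, l] gi. Proof. exact: hasD_contw dgi. Qed.
Let contw_gi (f : R -> R) : contw `[0, L] f -> contw `[0, l] (fun z => f (gi z)).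
Proof.
by move=> cf; apply: (@contw_comp _ _ `[0, l]%classic _ `[0, L]%classic gi f gi_maps).
Qed.

Lemma deformation_hasD z : 0 <= z <= l -> hasD `[0, l] phi z (ph z).
Proof.
move=> zl; have gz := gi_itv zl.
have := @hasD_comp _ `[0, l]%classic `[0, L]%classic Y gi z _ _ gi_maps (dgi zl) (dY gz).
by rewrite mulfK // gt_eqF // Gpos.
Qed.

Lemma deformation_comp x : 0 <= x <= L -> phi (g x) = Y x.
Proof. by move=> xL; rewrite /phi Kgi. Qed.

Let LL : 0 <= L <= L. Proof. by rewrite lexx ltW. Qed.
Let ll : 0 <= l <= l. Proof. by rewrite lexx ltW. Qed.
Let O0 : 0 <= (0 : R) <= l. Proof. by rewrite lexx ltW. Qed.
Let OL : 0 <= (0 : R) <= L. Proof. by rewrite lexx ltW. Qed.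
Let phi0 : phi 0 = 0. Proof. by have := deformation_comp OL; rewrite !gmap0. Qed.
Let phil : phi l = l0. Proof. by rewrite deformation_comp. Qed.
Let phpos z : 0 <= z <= l -> 0 < ph z. Proof. by move=> zl; exact/ppos/gi_itv. Qed.
Let phcont : contw `[0, l] ph. Proof. exact: contw_gi. Qed.

Let in0y (q : R) : 0 < q -> [set` `]0, +oo[] q. Proof. by rewrite /= in_itv /= andbT. Qed.

Let conv0y (x y : R) : 0 < x -> 0 < y ->
  forall z, Num.min x y <= z <= Num.max x y -> [set` `]0, +oo[] z.
Proof.
move=> x0 y0 z /andP[zx _]; apply: in0y; apply: lt_le_trans zx.
by rewrite lt_min x0.
Qed.

Let W_mvt X q r : 0 <= X <= L -> 0 < q -> 0 < r ->
  exists2 c, Num.min q r <= c <= Num.max q r & W X r - W X q = dpW W X c * (r - q).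
Proof.
move=> XL q0 r0; apply: mvt_conv; first exact: conv0y.
by move=> z; rewrite /= in_itv /= andbT => z0; exact: Wdiff.
Qed.

Lemma energy_tangent X q r : 0 <= X <= L -> 0 < q -> 0 < r ->
  W X q + dpW W X q * (r - q) <= W X r.
Proof.
move=> XL q0 r0; have [c + e] := W_mvt XL q0 r0.
have [qr|rq] := leP q r => /andP[c1 c2].
  have := dpW_mono XL q0 c1; have : 0 <= r - q by lra.
  by move: e; nra.
have c0 : 0 < c by lra.
have := dpW_mono XL c0 c2; have : 0 <= q - r by lra.
by move: e; nra.
Qed.

Lemma energy_tangent_strict X q r : 0 <= X <= L -> 0 < q -> 0 < r -> q != r ->
  W X q + dpW W X q * (r - q) < W X r.
Proof.
move=> XL q0 r0 qr.
have h : 0 < (1 / 2 : R) < 1 by apply/andP; split; lra.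
have := Wconvex XL (in0y q0) (in0y r0) qr h.
have m0 : 0 < 1 / 2 * q + (1 - 1 / 2) * r by lra.
have := energy_tangent XL q0 m0; nra.
Qed.

(** The height of [W X] above its tangent at [p X]; the slope of that tangent is [s] for every
    [X]. *)
Let excess X q := W X q - W X (p X) - s * (q - p X).

Let excess_mono X q r : 0 <= X <= L -> 0 < q -> 0 < r ->
  (p X <= q <= r \/ r <= q <= p X) -> excess X q <= excess X r.
Proof.
move=> XL q0 r0 h; have := energy_tangent XL q0 r0; rewrite /excess.
case: h => /andP[h1 h2].
  have := dpW_mono XL (ppos XL) h1; rewrite pstress //.
  have : 0 <= r - q by lra.
  nra.
have := dpW_mono XL q0 h2; rewrite pstress //.
have : 0 <= q - r by lra.
nra.
Qed.

(** The excess grows away from [p X], so at distance at least [d] it dominates its value at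
    [p X + d] or at [p X - d]. These two are positive continuous functions of [X] on a compact
    interval. *)
Lemma energy_gap d : 0 < d -> (forall X, 0 <= X <= L -> d < p X) ->
  exists2 c, 0 < c & forall X q, 0 <= X <= L -> 0 < q -> d <= `|q - p X| ->
    W X (p X) + s * (q - p X) + c <= W X q.
Proof.
move=> d0 dp; have cI := @segment_compact R 0 L.
have Ix X : [set` `[0, L]] X -> 0 <= X <= L by rewrite /= in_itv.
have cW (f : R -> R) : contw `[0, L] f -> (forall X, 0 <= X <= L -> 0 < f X) ->
    contw `[0, L] (fun X => W X (f X)).
  move=> cf f0; apply: (@cont2_comp _ _ `[0, L]%classic `[0, L]%classic `]0, +oo[%classic W id f) => //.
    exact: contw_id.
  by move=> x /Ix xL; apply/in0y/f0.
have cex (f : R -> R) : contw `[0, L] f -> (forall X, 0 <= X <= L -> 0 < f X) ->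
    contw `[0, L] (fun X => excess X (f X)).
  move=> cf f0; apply: contwB; first by apply: contwB; exact: cW.
  by apply: contwM; [exact: contw_cst|exact: contwB].
have pos1 X : 0 <= X <= L -> 0 < p X + d by move=> XL; have := ppos XL; lra.
have pos2 X : 0 <= X <= L -> 0 < p X - d by move=> XL; have := dp X XL; lra.
have expos X q : 0 <= X <= L -> 0 < q -> q != p X -> 0 < excess X q.
  move=> XL q0 nq; have := energy_tangent_strict XL (ppos XL) q0; rewrite pstress // eq_sym.
  by rewrite /excess => /(_ nq); lra.
have [c1 c10 h1] : exists2 c, 0 < c & forall X, [set` `[0, L]] X -> c <= excess X (p X + d).
  apply: (compact_pos_bound cI).
    by apply: cex => //; apply: contwD => //; exact: contw_cst.
  by move=> X /Ix XL; apply: expos; rewrite ?pos1 // gt_eqF //; lra.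
have [c2 c20 h2] : exists2 c, 0 < c & forall X, [set` `[0, L]] X -> c <= excess X (p X - d).
  apply: (compact_pos_bound cI).
    by apply: cex => //; apply: contwB => //; exact: contw_cst.
  by move=> X /Ix XL; apply: expos; rewrite ?pos2 // lt_eqF //; lra.
exists (Num.min c1 c2); first by rewrite lt_min c10.
move=> X q XL q0 dq.
have IX : [set` `[0, L]] X by rewrite /= in_itv.
suff : Num.min c1 c2 <= excess X q by rewrite /excess; lra.
have [pq|qp] := leP (p X) q.
  rewrite ger0_norm ?subr_ge0 // in dq.
  apply: (@le_trans _ _ (excess X (p X + d))); first by rewrite ge_min h1.
  by apply: excess_mono; rewrite ?pos1 //; left; apply/andP; split; lra.
rewrite ltr0_norm ?subr_lt0 // in dq.
apply: (@le_trans _ _ (excess X (p X - d))); first by rewrite ge_min h2 ?orbT.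
by apply: excess_mono; rewrite ?pos2 //; right; apply/andP; split; lra.
Qed.

Let E0 := \int[mu]_(z in `]0, l[) W (gi z) (ph z).

Let Wph_cont : contw `[0, l] (fun z => W (gi z) (ph z)).
Proof.
apply: (@cont2_comp _ _ `[0, l]%classic `[0, L]%classic `]0, +oo[%classic W gi ph) => // z.
by rewrite /= in_itv /= => zl; exact/in0y/phpos.
Qed.

Let energy_phE : elastic_energy L W G ph = E0%:E.
Proof.
rewrite /elastic_energy gmap0 /E0 /Rintegral fineK //.
apply: integrable_fin_num; [exact: measurable_itv|exact: (integrable_oo_contw Wph_cont)].
Qed.

Lemma competitor_deformation : competitor L l0 W G phi ph.
Proof.
rewrite /competitor gmap0; split => //.
- have iL f : contw `[0, l] f -> Lp_on 1 0 l f.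
    move=> cf; have ic := integrable_oo_contw cf; split.
      by case/integrableP : ic => /measurable_EFinP.
    apply: (integrable_oo_contw (h := fun x => `|f x| ^+ 1)).
    under [X in contw _ X]eq_fun do rewrite expr1.
    by apply: (contw_comp_continuous cf); exact: norm_continuous.
  have cphi : contw `[0, l] phi by exact: hasD_contw deformation_hasD.
  split; [exact/contwP|exact: iL|exact: iL|].
  by apply: weak_deriv_hasD => //; exact: deformation_hasD.
- by apply: aeW => z; rewrite in_itv /= => /andP[/ltW ? /ltW ?] ; apply: phpos; apply/andP.
- by rewrite energy_phE ltry.
Qed.

Let dev dpsi (d : R) : set R := 
  [set z : R | (0 < z < l) /\ (d <= `|dpsi z - ph z|)].

Lemma competitor_facts psi dpsi : competitor L l0 W G psi dpsi ->
  [/\ contw `[0, l] psi, mu.-integrable `]0, l[ (EFin \o dpsi),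
      forall x, 0 <= x <= l -> psi x = gmap dpsi x &
      exists N : set R, [/\ measurable N, mu N = 0 & forall z, z \in `]0, l[ -> ~ N z -> 0 < dpsi z]].
Proof.
rewrite /competitor gmap0 => -[[/contwP cpsi _ [mdpsi idpsi] wd] pos _ e0 el].
have idpsi' : mu.-integrable `]0, l[ (EFin \o dpsi).
  apply: (@le_integrable _ _ _ mu _ _ _ _ _ _ idpsi) => //.
    exact/measurable_EFinP.
  by move=> x _ /=; rewrite lee_fin expr1 normr_id.
split => //.
  by move=> x xl; rewrite (weak_deriv_gmap lpos cpsi idpsi' wd) // e0 add0r.
have [N [mN N0 sub]] := pos; exists N; split => // z zl nN.
by apply: contrapT => h; apply: nN; apply: sub => /= /(_ zl).
Qed.

(** Integrate the tangent inequality along the competitor. As the slope [s] does not depend on the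
    point, the linear term integrates to [s * (l0 - l0) = 0], and only the gain [c] on the deviation
    set remains. *)
Lemma energy_lower psi dpsi d c : competitor L l0 W G psi dpsi -> 0 <= c ->
  (forall X q, 0 <= X <= L -> 0 < q -> d <= `|q - p X| ->
    W X (p X) + s * (q - p X) + c <= W X q) ->
  measurable (dev dpsi d) /\
  ((E0 + c * fine (mu (dev dpsi d)))%:E <= elastic_energy L W G dpsi)%E.
Proof.
move=> cp c0 gap; have [cpsi idpsi psiE [N [mN N0 pos]]] := competitor_facts cp.
set D : set R := `]0, l[%classic; have mdpsi : measurable_fun D dpsi.
  by case/integrableP : idpsi => /measurable_EFinP.
have iph : mu.-integrable D (EFin \o ph) := integrable_oo_contw phcont.
have mph : measurable_fun D ph by case/integrableP : iph => /measurable_EFinP.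
have mA : measurable (dev dpsi d).
  have : measurable_fun D (fun z => `|dpsi z - ph z|).
    by apply: measurableT_comp => //; exact: measurable_funB.
  move=> /(_ (measurable_itv _) `[d, +oo[%classic (measurable_itv _)).
  rewrite (_ : _ `&` _ = dev dpsi d) //.
  by apply/seteqP; split => z /=; rewrite in_itv /= andbT.
split => //.
pose u z := W (gi z) (ph z) + s * (dpsi z - ph z) + c * \1_(dev dpsi d) z.
have i1 : mu.-integrable D (EFin \o (fun z => W (gi z) (ph z))) := integrable_oo_contw Wph_cont.
have i2 : mu.-integrable D (EFin \o (fun z => dpsi z - ph z)) by exact: (integrableB _ idpsi iph).
have i2' : mu.-integrable D (EFin \o (fun z => s * (dpsi z - ph z))) by exact: integrable_oo_Z.
have i3 : mu.-integrable D (EFin \o (\1_(dev dpsi d) : R -> R)).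
  have -> : (\1_(dev dpsi d) : R -> R) = (fun x => cst 1 x * \1_(dev dpsi d) x).
    by apply/funext => x; rewrite /= mul1r.
  apply: (@integrable_bounded_mul R D (cst 1) _ 1) => //.
  - exact: measurable_itv.
  - by apply: integrable_oo_contw; exact: contw_cst.
  - by move=> z _; rewrite indicE; case: (_ \in _); rewrite ?normr1 ?normr0.
have i3' : mu.-integrable D (EFin \o (fun z => c * (\1_(dev dpsi d) z : R))) by exact: integrable_oo_Z.
have i12 : mu.-integrable D (EFin \o (fun z => W (gi z) (ph z) + s * (dpsi z - ph z))).
  exact: integrable_oo_D.
have iu : mu.-integrable D (EFin \o u) by exact: integrable_oo_D.
have subD : dev dpsi d `<=` D by move=> z [].
have -> : (E0 + c * fine (mu (dev dpsi d)))%:E = (\int[mu]_(z in D) (u z)%:E)%E.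
  rewrite -[RHS]fineK; last first.
    by apply: integrable_fin_num => //; exact: measurable_itv.
  congr EFin; rewrite -/(Rintegral mu D u) /u.
  rewrite (@RintegralD _ _ _ mu D _ _ (measurable_itv _) i12 i3') (@RintegralD _ _ _ mu D _ _ (measurable_itv _) i1 i2').
  rewrite (@RintegralZl _ _ _ mu D _ _ (measurable_itv _) i2) (@RintegralZl _ _ _ mu D _ _ (measurable_itv _) i3).
  rewrite (@RintegralB _ _ _ mu D _ _ (measurable_itv _) idpsi iph).
  rewrite (Rintegral_oo_gmap mdpsi) (Rintegral_oo_gmap mph).
  have [_ _ _ _ el] := cp.
  have -> : gmap dpsi l = l0 by rewrite -psiE.
  have -> : gmap ph l = l0.
    by rewrite -phil (gmap_uniq phcont deformation_hasD) // phi0 add0r.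
  rewrite subrr mulr0 addr0; congr (_ + c * _).
  rewrite /Rintegral integral_indic ?setIidl //; exact: measurable_itv.
rewrite /elastic_energy gmap0; apply: (@integral_ae_lower_bound _ _ _ mu D N (fun z => (W (gi z) (dpsi z))%:E) u (measurable_itv _) mN N0) => //.
- move=> z Dz nN; rewrite lee_fin W_ge0 ?pos //; apply: gi_itv.
  by move: Dz; rewrite /D /= in_itv /= => /andP[/ltW -> /ltW ->].
move=> z Dz nN; rewrite lee_fin /u.
have XL : 0 <= gi z <= L.
  by apply: gi_itv; move: Dz; rewrite /D /= in_itv /= => /andP[/ltW -> /ltW ->].
have dz := pos z Dz nN.
rewrite indicE; case: (boolP (z \in dev dpsi d)) => [|_].
  by rewrite inE => -[_ dd]; rewrite mulr1; exact: gap.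
by rewrite mulr0 addr0; have := energy_tangent XL (ppos XL) dz; rewrite pstress.
Qed.

Lemma minimizer_deformation : minimizer L l0 W G phi.
Proof.
exists ph; first exact: competitor_deformation.
move=> psi dpsi cp; rewrite energy_phE.
have [|_] := @energy_lower psi dpsi 0 0 cp (lexx _); last by rewrite mul0r addr0.
move=> X q XL q0 _; rewrite addr0; have := energy_tangent XL (ppos XL) q0.
by rewrite pstress.
Qed.

(** A second minimizer cannot pay for the gain [c] on [dev dpsi d], so this set is null for every
    small [d]. Countably many such [d] give [dpsi = ph] almost everywhere, and both deformations are
    primitives starting from 0. *)
Lemma minimizer_uniq psi : minimizer L l0 W G psi ->
  forall z, 0 <= z <= l -> psi z = phi z.
Proof.
move=> [dpsi cp min]; have := min _ _ competitor_deformation; rewrite energy_phE => le_E.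
have [cpsi idpsi psiE _] := competitor_facts cp.
have [c c0 hc] : exists2 c, 0 < c & forall x, 0 <= x <= L -> c <= p x.
  have [c c0 hc] := compact_pos_bound (@segment_compact R 0 L) pcont
    (fun x Ix => ppos (etrans (esym (in_itv _ _)) Ix)).
  by exists c => // x xL; apply: hc; rewrite /= in_itv.
have null d : 0 < d -> d < c -> measurable (dev dpsi d) /\ mu (dev dpsi d) = 0.
  move=> d0 dc; have [|e e0 gap] := @energy_gap d d0.
    by move=> X XL; rewrite (lt_le_trans dc) // hc.
  have [mA lowE] := energy_lower cp (ltW e0) gap; split => //.
  have le1 := le_trans lowE le_E.
  move: le1; rewrite lee_fin gerDl pmulr_rle0 // => le0.
  have fA : mu (dev dpsi d) \is a fin_num.
    rewrite ge0_fin_numE //; apply: (@le_lt_trans _ _ (mu `]0, l[)).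
      by apply: le_measure; rewrite ?inE //; move=> z [].
    by rewrite lebesgue_measure_itv /= lte_fin lpos -EFinD ltry.
  rewrite -(fineK fA); congr EFin; apply/eqP; rewrite eq_le le0.
  exact: fine_ge0.
have ae : {ae mu, forall z, z \in `]0, l[ -> dpsi z = ph z}.
  pose e n : R := c / 2 / n.+1%:R.
  have e0 n : 0 < e n by rewrite divr_gt0 // divr_gt0.
  have ec n : e n < c.
    apply: (@le_lt_trans _ _ (c / 2)); last by lra.
    by rewrite /e ler_pdivrMr // ler_peMr ?ler1n //; lra.
  have : mu.-negligible (\bigcup_n dev dpsi (e n)).
    apply: negligible_bigcup => n; exists (dev dpsi (e n)).
    by have [mA A0] := null _ (e0 n) (ec n); split.
  apply: negligibleS => z /= /not_implyP[zl nz].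
  have nz' : 0 < `|dpsi z - ph z| by rewrite normr_gt0 subr_eq0; exact/eqP.
  exists (Num.bound (c / 2 / `|dpsi z - ph z|)) => //; split => //.
  rewrite /e ler_pdivrMr // [leRHS]mulrC -ler_pdivrMr //.
  apply: (le_trans (ltW (archi_boundP _))); last by rewrite ler_nat.
  by rewrite divr_ge0 //; lra.
move=> z zl; rewrite psiE // (gmap_uniq phcont deformation_hasD) // phi0 add0r.
exact: (gmap_ae lpos idpsi (integrable_oo_contw phcont) ae).
Qed.

Lemma phi_ofE z : 0 <= z <= l -> phi_of L l0 W G z = phi z.
Proof.
by apply: minimizer_uniq; apply: (@getPex _ (minimizer L l0 W G)); exists phi; exact: minimizer_deformation.
Qed.

Lemma dphi_ofE x : 0 <= x <= L -> dphi_of L l0 W G (g x) = p x.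
Proof.
move=> xL; rewrite /dphi_of gmap0.
have -> : p x = ph (g x) by rewrite /ph Kgi.
have gxl := g_itv xL.
apply: hasD_deriv_in; first exact: (itv_acc lpos gxl).
apply: (@hasD_eq _ _ phi); first by rewrite /= in_itv.
  by move=> y; rewrite /= in_itv /= => yl; rewrite phi_ofE.
exact: deformation_hasD.
Qed.

Lemma stressE : stress L l0 W G = s.
Proof.
have h : exists s, forall z : R, z \in `[g 0, g L] -> dpW W (gi z) (dphi_of L l0 W G z) = s.
  exists s => z; rewrite gmap0 in_itv /= => zl; rewrite -{2}(giK zl) dphi_ofE ?gi_itv //.
  by rewrite pstress ?gi_itv.
have := getPex h; rewrite -/(stress L l0 W G) => /(_ 0); rewrite gmap0 in_itv /= O0 => <- //.
have gi0 : gi 0 = 0 by rewrite -[X in gi X](gmap0 G) Kgi.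
by rewrite gi0 -[X in dphi_of _ _ _ _ X](gmap0 G) dphi_ofE // pstress.
Qed.

Lemma y_ofE x : 0 <= x <= L -> y_of L l0 W G x = Y x.
Proof. by move=> xL; rewrite /y_of /= phi_ofE ?g_itv // deformation_comp. Qed.

Let pGpos x : 0 <= x <= L -> 0 < p x * G x.
Proof. by move=> xL; rewrite mulr_gt0 ?ppos ?Gpos. Qed.

Let Yitv x : 0 <= x <= L -> 0 <= Y x <= l0.
Proof. by move=> xL; have := incr_itv dY pGpos (gmap0 _) xL; rewrite plen. Qed.

Let dphi_of_hasD z : 0 <= z <= l -> hasD `[0, l] (phi_of L l0 W G) z (ph z).
Proof.
move=> zl; apply: (@hasD_eq _ _ phi); first by rewrite /= in_itv.
  by move=> y; rewrite /= in_itv /= => yl; rewrite phi_ofE.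
exact: deformation_hasD.
Qed.

Lemma stretch_comp x : 0 <= x <= L -> stretch L l0 W G (Y x) = p x.
Proof.
move=> xL; rewrite /stretch /= gmap0.
have gx := g_itv xL.
have -> : Y x = phi_of L l0 W G (g x) by rewrite phi_ofE // deformation_comp.
by rewrite (inverse_onK dphi_of_hasD phpos) // dphi_ofE.
Qed.

Lemma inverse_y_comp x : 0 <= x <= L -> inverse_on `[0, L] (y_of L l0 W G) (Y x) = x.
Proof.
move=> xL; rewrite -(y_ofE xL); apply: (@inverse_onK _ L _ (fun x => p x * G x)) => //.
move=> y yL; apply: (@hasD_eq _ _ Y); first by rewrite /= in_itv.
  by move=> z; rewrite /= in_itv /= => zL; rewrite y_ofE.
exact: dY.
Qed.


(** * The nutrient problem pulled back to the material coordinate *)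

Section Nutrient.
Variables (D0 beta0 N q : R -> R) (nL nR : R).
Hypothesis D0cont : contw `[0, L] D0.
Hypothesis D0pos : forall x, 0 <= x <= L -> 0 < D0 x.
Hypothesis b0cont : contw `[0, L] beta0.
Hypothesis b0pos : forall x, 0 <= x <= L -> 0 < beta0 x.
Hypothesis Nsys : linsys L (fun x => G x / D0 x) (fun x => beta0 x * G x) N q.
Hypothesis N0 : N 0 = nL.
Hypothesis NL : N L = nR.

Let yi := inverse_on `[0, L] Y.
Let Dz z := p (yi z) * D0 (yi z).
Let bz z := (p (yi z))^-1 * beta0 (yi z).

Let pGcont : contw `[0, L] (fun x => p x * G x). Proof. exact: pG. Qed.
Let yi_itv z : 0 <= z <= l0 -> 0 <= yi z <= L.
Proof. by rewrite -plen; exact: (inverse_on_itv L0 dY pGpos (gmap0 _)). Qed.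
Let yiK z : 0 <= z <= l0 -> Y (yi z) = z.
Proof. by rewrite -plen; exact: (inverse_on_right L0 dY pGpos (gmap0 _)). Qed.
Let Kyi x : 0 <= x <= L -> yi (Y x) = x.
Proof. exact: (inverse_onK dY pGpos). Qed.
Let dyi z : 0 <= z <= l0 -> hasD `[0, l0] yi z (p (yi z) * G (yi z))^-1.
Proof. by rewrite -plen; exact: (inverse_on_hasD L0 dY pGcont pGpos (gmap0 _)). Qed.
Let yi_maps z : [set` `[0, l0]] z -> [set` `[0, L]] (yi z).
Proof. by rewrite /= !in_itv /=; exact: yi_itv. Qed.
Let contw_yi (f : R -> R) : contw `[0, L] f -> contw `[0, l0] (fun z => f (yi z)).
Proof.
by move=> cf; apply: (@contw_comp _ _ `[0, l0]%classic _ `[0, L]%classic yi f yi_maps) => //; exact: hasD_contw dyi.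
Qed.
Let Il0 z : [set` `[0, l0]] z -> 0 <= z <= l0. Proof. by rewrite /= in_itv. Qed.

Let D_ofE z : 0 <= z <= l0 -> D_of L l0 W D0 G z = Dz z.
Proof.
move=> zl; have xL := yi_itv zl; rewrite /D_of /Dz -[in LHS](yiK zl).
by rewrite stretch_comp // inverse_y_comp.
Qed.

Let beta_ofE z : 0 <= z <= l0 -> beta_of L l0 W beta0 G z = bz z.
Proof.
move=> zl; have xL := yi_itv zl; rewrite /beta_of /bz -[in LHS](yiK zl).
by rewrite stretch_comp // inverse_y_comp.
Qed.

Let Dzpos z : 0 <= z <= l0 -> 0 < Dz z.
Proof. by move=> /yi_itv xL; rewrite mulr_gt0 ?ppos ?D0pos. Qed.
Let bzpos z : 0 <= z <= l0 -> 0 < bz z.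
Proof. by move=> /yi_itv xL; rewrite mulr_gt0 ?invr_gt0 ?ppos ?b0pos. Qed.
Let Dzcont : contw `[0, l0] Dz.
Proof. by apply: contwM; exact: contw_yi. Qed.
Let bzcont : contw `[0, l0] bz.
Proof.
apply: contwM; last exact: contw_yi.
apply: contwV; last exact: contw_yi.
by move=> z /Il0/yi_itv xL; rewrite gt_eqF ?ppos.
Qed.

(** Concentration and flux read at the deformed point. Dividing by [y' = p G] removes [G] from the
    material system and leaves exactly the coefficients [Dz] and [bz], so [Q = Dz n']. *)
Let n z := N (yi z).
Let Q z := q (yi z).

Let dn z : 0 <= z <= l0 -> hasD `[0, l0] n z (Q z / Dz z).
Proof.
move=> zl; have xL := yi_itv zl; have [d1 _] := Nsys xL.
have := hasD_comp yi_maps (dyi zl) d1.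
congr (hasD _ _ _ _); rewrite /Q /Dz; field.
by rewrite !gt_eqF ?ppos ?Gpos ?D0pos.
Qed.

Let dQ z : 0 <= z <= l0 -> hasD `[0, l0] Q z (bz z * n z).
Proof.
move=> zl; have xL := yi_itv zl; have [_ d2] := Nsys xL.
have := hasD_comp yi_maps (dyi zl) d2.
congr (hasD _ _ _ _); rewrite /n /bz; field.
by rewrite !gt_eqF ?ppos ?Gpos.
Qed.

Let ncont : contw `[0, l0] n. Proof. exact: hasD_contw dn. Qed.
Let Qcont : contw `[0, l0] Q. Proof. exact: hasD_contw dQ. Qed.
Let dncont : contw `[0, l0] (fun z => Q z / Dz z).
Proof.
apply: contwM => //; apply: contwV => // z /Il0 zl.
by rewrite gt_eqF ?Dzpos.
Qed.
Let bncont : contw `[0, l0] (fun z => bz z * n z).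
Proof. exact: contwM. Qed.

Let oo_cc z : z \in (`]0, l0[%classic : set R) -> 0 <= z <= l0.
Proof. by rewrite inE /= in_itv /= => /andP[/ltW -> /ltW ->]. Qed.

Let test_cont psi : test_function 0 l0 psi ->
  contw `[0, l0] psi /\ contw `[0, l0] (derive1 psi).
Proof.
move=> [dpsi cpsi _]; split; last exact: continuous_contw.
apply: continuous_contw => x; apply: differentiable_continuous.
by apply/derivable1_diffP; exact: dpsi.
Qed.

Let n0E : n 0 = nL. Proof. by rewrite /n -[X in yi X](gmap0 (fun x => p x * G x)) Kyi. Qed.
Let nlE : n l0 = nR. Proof. by rewrite /n -plen Kyi. Qed.

Lemma nutrient_solution_pullback : nutrient_solution L l0 W D0 beta0 nL nR G n.
Proof.
split => //; split => //; exists (fun z => Q z / Dz z).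
  have iL f : contw `[0, l0] f -> Lp_on 2 0 l0 f.
    move=> cf; have ic := integrable_oo_contw cf; split.
      by case/integrableP : ic => /measurable_EFinP.
    apply: (integrable_oo_contw (h := fun x => `|f x| ^+ 2)).
    apply: (@contw_eq _ _ _ (fun x => `|f x| * `|f x|)) => [x _|]; first by rewrite expr2.
    by apply: contwM; apply: (contw_comp_continuous cf); exact: norm_continuous.
  split; [exact/contwP|exact: iL|exact: iL|].
  exact: weak_deriv_hasD.
move=> psi tpsi; have [cpsi cpsi'] := test_cont tpsi.
have wd := weak_deriv_hasD l00 bncont dQ tpsi.
transitivity (\int[mu]_(z in `]0, l0[) (Q z * derive1 psi z + bz z * n z * psi z)).
  apply: eq_Rintegral => z zl; rewrite D_ofE ?beta_ofE ?oo_cc //; congr (_ * _ + _).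
  by rewrite mulrC divfK // gt_eqF // Dzpos // oo_cc.
rewrite RintegralD //; first by rewrite wd addNr.
  by apply: integrable_oo_contw; exact: contwM.
by apply: integrable_oo_contw; exact: contwM.
Qed.

(* For the difference [e] of two solutions with flux difference [P],
   [(e P)' = P^2 / D + beta e^2 >= 0] and [e P] vanishes at both ends. *)
Lemma nutrient_solution_uniq m : nutrient_solution L l0 W D0 beta0 nL nR G m ->
  forall z, 0 <= z <= l0 -> m z = n z.
Proof.
move=> [m0 [ml [dm [/contwP cm _ [mdm idm2] wd] weak]]].
have idm : mu.-integrable `]0, l0[ (EFin \o dm).
  have i1 : mu.-integrable `]0, l0[ (EFin \o cst (1 : R)).
    by apply: integrable_oo_contw; exact: contw_cst.
  apply: (@le_integrable _ _ _ mu _ _ _ _ _ _ (integrable_oo_D i1 idm2)) => //.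
    exact/measurable_EFinP.
  move=> x _; rewrite /= lee_fin; apply: le_trans (ler_norm _).
  have := sqr_ge0 (`|dm x| - 1); have := normr_ge0 (dm x).
  by set y := `|dm x|; nra.
(* The weak equation says that the flux [h] has the weak derivative [bz * m]. By du Bois-Reymond it
   agrees almost everywhere with the C^1 function [Qm], so [m] is a classical solution of the same
   first order system as [n]. *)
pose h z := Dz z * dm z.
have [MD MD0 hMD] := compact_bound (@segment_compact R 0 l0) Dzcont.
have mDz : measurable_fun (`]0, l0[%classic : set R) Dz.
  by have /integrableP[/measurable_EFinP] := integrable_oo_contw Dzcont.
have ih : mu.-integrable `]0, l0[ (EFin \o h).
  have -> : h = (fun z => dm z * Dz z) by apply/funext => z; rewrite /h mulrC.
  apply: (@integrable_bounded_mul _ _ _ _ MD) => // z zl.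
  by apply: hMD; rewrite /= in_itv /=; apply: oo_cc; rewrite inE.
have ck : contw `[0, l0] (fun z => bz z * m z) by exact: contwM.
have ik := integrable_oo_contw ck.
have wh : weak_deriv 0 l0 h (fun z => bz z * m z).
  move=> psi tpsi; have [cpsi cpsi'] := test_cont tpsi.
  have := weak psi tpsi.
  have -> : \int[mu]_(z in `]0, l0[) (D_of L l0 W D0 G z * dm z * derive1 psi z +
      beta_of L l0 W beta0 G z * m z * psi z) =
    \int[mu]_(z in `]0, l0[) (h z * derive1 psi z + bz z * m z * psi z).
    by apply: eq_Rintegral => z zl; rewrite D_ofE ?beta_ofE ?oo_cc.
  have [MP MP0 hMP] := compact_bound (@segment_compact R 0 l0) cpsi'.
  have mP : measurable_fun (`]0, l0[%classic : set R) (derive1 psi).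
    by have /integrableP[/measurable_EFinP] := integrable_oo_contw cpsi'.
  rewrite RintegralD //.
  - by move=> /eqP; rewrite addr_eq0 => /eqP.
  - apply: (@integrable_bounded_mul _ _ _ _ MP) => // z zl.
    by apply: hMP; rewrite /= in_itv /=; apply: oo_cc; rewrite inE.
  - by apply: integrable_oo_contw; exact: contwM.
have [c hc] := weak_deriv_ae ih ik wh.
pose Qm z := c + gmap (fun z => bz z * m z) z.
have dQm z : 0 <= z <= l0 -> hasD `[0, l0] Qm z (bz z * m z).
  move=> zl; have := hasDD (hasD_cst `[0, l0] c z) (hasD_gmap ck zl).
  by rewrite add0r.
have cQm : contw `[0, l0] Qm by exact: hasD_contw dQm.
have cdm : contw `[0, l0] (fun z => Qm z / Dz z).
  apply: contwM => //; apply: contwV => // z /Il0 zl.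
  by rewrite gt_eqF ?Dzpos.
have aedm : {ae mu, forall z, z \in `]0, l0[ -> dm z = Qm z / Dz z}.
  move: hc; apply: filterS; first exact: (ae_filter_ringOfSetsType mu).
  move=> z hz zl; have zl' : 0 <= z <= l0 by apply: oo_cc; rewrite inE.
  by rewrite -[Qm z]/(c + _) -hz // /h mulrC mulKf // gt_eqF // Dzpos.
have mE z : 0 <= z <= l0 -> m z = nL + gmap (fun z => Qm z / Dz z) z.
  move=> zl; rewrite (weak_deriv_gmap l00 cm idm wd) // m0; congr (_ + _).
  exact: (gmap_ae l00 idm (integrable_oo_contw cdm) aedm).
have dm' z : 0 <= z <= l0 -> hasD `[0, l0] m z (Qm z / Dz z).
  move=> zl; apply: (@hasD_eq _ _ (fun z => nL + gmap (fun z => Qm z / Dz z) z)).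
  - by rewrite /= in_itv.
  - by move=> y /Il0 yl; rewrite mE.
  - by have := hasDD (hasD_cst `[0, l0] nL z) (hasD_gmap cdm zl); rewrite add0r.
pose e z := m z - n z; pose P z := Qm z - Q z.
have de z : 0 <= z <= l0 -> hasD `[0, l0] e z (P z / Dz z).
  by move=> zl; have := hasDB (dm' z zl) (dn zl); rewrite -mulrBl.
have dP z : 0 <= z <= l0 -> hasD `[0, l0] P z (bz z * e z).
  by move=> zl; have := hasDB (dQm z zl) (dQ zl); rewrite -mulrBr.
have e0 : e 0 = 0 by rewrite /e m0 n0E subrr.
have el : e l0 = 0 by rewrite /e ml nlE subrr.
have eP_mono x y : 0 <= x -> x <= y -> y <= l0 -> e x * P x <= e y * P y.
  apply: (@hasD_mono _ l0 (fun z => e z * P z) (fun z => P z / Dz z * P z + e z * (bz z * e z))) => z zl.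
    exact: hasDM (de z zl) (dP z zl).
  rewrite (_ : _ + _ = P z ^+ 2 / Dz z + bz z * e z ^+ 2); last by ring.
  have dz := ltW (Dzpos zl); have bz0 := ltW (bzpos zl).
  by apply: addr_ge0; [apply: divr_ge0 => //; exact: sqr_ge0|apply: mulr_ge0 => //; exact: sqr_ge0].
have eP z : 0 <= z <= l0 -> e z * P z = 0.
  move=> /andP[z0 zl]; apply/eqP; rewrite eq_le.
  have := eP_mono 0 z (lexx _) z0 zl; rewrite e0 mul0r => ->.
  by have := eP_mono z l0 z0 zl (lexx _); rewrite el mul0r => ->.
have e2 z : 0 <= z <= l0 -> e z * e z = 0.
  move=> zl; rewrite (@hasD_eq0_const _ l0 (fun z => e z * e z)) // ?e0 ?mul0r // => y yl.
  have := hasDM (de y yl) (de y yl).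
  by rewrite (_ : _ + _ = 2 * (e y * P y) / Dz y); [rewrite eP // mulr0 mul0r|ring].
move=> z zl; apply/eqP; rewrite -subr_eq0 -/(e z).
by have /eqP := e2 z zl; rewrite mulf_eq0 orbb.
Qed.

Lemma nutrientE x : 0 <= x <= L -> nutrient L l0 W D0 beta0 nL nR G x = N x.
Proof.
move=> xL; rewrite /nutrient /= y_ofE // -[in RHS](Kyi xL) -/(n (Y x)).
apply: nutrient_solution_uniq; last exact: Yitv.
apply: (@getPex _ (nutrient_solution L l0 W D0 beta0 nL nR G)).
by exists n; exact: nutrient_solution_pullback.
Qed.

End Nutrient.

End Minimizer.

(** * The stress as a function of the growth *)

(** Because [G s - G t] vanishes at [s = t], continuity of the factor [p] in time is enough. This
    permits a [p] that depends on the very quantity whose time derivative is sought, as for the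
    stress and for the fundamental solutions. *)
Lemma gmap_increment_hasD (R : realType) (T L : R) (p G Gt : R -> R -> R) (t X : R) :
  0 < L -> 0 <= t <= T -> 0 <= X <= L ->
  cont2 `[0, T] `[0, L] p -> cont2 `[0, T] `[0, L] G -> cont2 `[0, T] `[0, L] Gt ->
  (forall s x, 0 <= s <= T -> 0 <= x <= L -> hasD `[0, T] (G^~ x) s (Gt s x)) ->
  hasD `[0, T] (fun s => gmap (fun x => p s x * (G s x - G t x)) X) t
    (gmap (fun x => p t x * Gt t x) X).
Proof.
move=> L0 tT XL cp Gcont Gtcont dG.
have cI := @segment_compact R 0 L; have cT := @segment_compact R 0 T.
have inT (s : R) : 0 <= s <= T -> `[0, T]%classic s by rewrite /= in_itv.
have inI (x : R) : 0 <= x <= L -> `[0, L]%classic x by rewrite /= in_itv.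
have It := inT t tT; have cGt := cont2_row It Gcont.
pose A s := gmap (fun x => p s x * (G s x - G t x)) X.
pose A1 s := gmap (fun x => p t x * (G s x - G t x)) X.
have dA1 : hasD `[0, T] A1 t (gmap (fun x => p t x * Gt t x) X).
  apply: (@hasD_gmap_param _ 0 T L (fun s x => p t x * (G s x - G t x)) (fun s x => p t x * Gt s x)) => //.
  - apply: contwM; first by apply: cont2_snd; exact: cont2_row It cp.
    by apply: contwB => //; exact: cont2_snd.
  - by apply: contwM => //; apply: cont2_snd; exact: cont2_row It cp.
  move=> s x sT xL; apply: hasDZ.
  by have := hasDB (dG s x sT xL) (hasD_cst `[0, T] (G t x) s); rewrite subr0.
have [M M0 hM] := cont2_bound cT cI Gtcont.
apply/hasDe => e e0; have e20 : 0 < e / 2 by lra.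
have [d1 d10 h1] := (hasDe _ _ _ _).1 dA1 _ e20.
(* Since [|G s - G t|] is at most [M * |s - t|], replacing [p s] by [p t] under the integral costs
   at most the oscillation of [p] times [M * L * |s - t|]. *)
have eML : 0 < e / 2 / (M * L) by rewrite divr_gt0 // mulr_gt0.
have [d2 d20 h2] := cont2_unif cT cI cp eML.
exists (Num.min d1 d2); first by rewrite lt_min d10.
move=> s sT'; have sT : 0 <= s <= T by move: sT'; rewrite /= in_itv.
rewrite lt_min => /andP[sd1 sd2].
have A0 : A t = 0 by rewrite /A (_ : (fun x => _) = (fun=> 0)) ?gmap_cst0 //; apply/funext => x; rewrite subrr mulr0.
have A10 : A1 t = 0 by rewrite /A1 (_ : (fun x => _) = (fun=> 0)) ?gmap_cst0 //; apply/funext => x; rewrite subrr mulr0.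
have := h1 s sT' sd1; rewrite A10 -/(A s) -/(A t) A0 !subr0.
have cGs := cont2_row sT' Gcont.
have cd : contw `[0, L] (fun x => G s x - G t x) by exact: contwB.
have cps := cont2_row sT' cp; have cpt := cont2_row It cp.
have : `|A s - A1 s| <= e / 2 * `|s - t|.
  rewrite /A /A1 (@gmapB _ L) //; try by exact: contwM.
  apply: (@le_trans _ _ (e / 2 / (M * L) * (M * `|s - t|) * X)); last first.
    apply: (@le_trans _ _ (e / 2 / (M * L) * (M * `|s - t|) * L)).
      by rewrite ler_wpM2l ?(andP XL).2 // mulr_ge0 ?(ltW eML) // mulr_ge0 // ltW.
    by rewrite le_eqVlt; apply/orP; left; apply/eqP; field; rewrite !gt_eqF.
  apply: (@gmap_bound _ L) => //.
    by apply: contwB; exact: contwM.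
  move=> x xL; rewrite -mulrBl normrM ler_pM //.
    by apply: h2; rewrite ?subrr ?normr0 //; exact: inI.
  have [xi xiT ->] : exists2 xi, Num.min t s <= xi <= Num.max t s & G s x - G t x = Gt xi x * (s - t).
    apply: (@mvt_conv _ `[0, T]%classic (G^~ x) (Gt^~ x)).
      move=> z; rewrite /= in_itv /= ge_min le_max; move/andP: sT => [? ?]; move/andP: tT => [? ?].
      by move=> /andP[/orP[] ? /orP[] ?]; apply/andP; split; lra.
    by move=> z; rewrite /= in_itv /= => zT; exact: dG.
  rewrite normrM ler_wpM2r // hM; [by []| |exact: inI]; apply: inT.
  move: xiT; rewrite ge_min le_max; move/andP: sT => [? ?]; move/andP: tT => [? ?].
  by move=> /andP[/orP[] ? /orP[] ?]; apply/andP; split; lra.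
move=> h3 h4.
rewrite (_ : A s - _ = (A s - A1 s) + (A1 s - gmap (fun x => p t x * Gt t x) X * (s - t))); last by ring.
by apply: (le_trans (ler_normD _ _)); have := lerD h3 h4; rewrite -mulrDl -splitr.
Qed.

(** * Solving the length constraint for the stress *)

Section StressSolve.
Variables (R : realType) (L : R) (w1 w2 : R -> R -> R).
Local Notation I := (`[0, L]%classic : set R).
Local Notation J := (`]0, +oo[%classic : set R).
Hypothesis L0 : 0 < L.
Hypothesis w1cont : cont2 I J w1.
Hypothesis w2cont : cont2 I J w2.
Hypothesis dw1 : forall X q, 0 <= X <= L -> 0 < q -> hasD J (w1 X) q (w2 X q).
Hypothesis w2pos : forall X q, 0 <= X <= L -> 0 < q -> 0 < w2 X q.
Hypothesis w1low : forall X s, 0 <= X <= L -> exists2 q, 0 < q & w1 X q <= s.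
Hypothesis w1high : forall X s, 0 <= X <= L -> exists2 q, 0 < q & s <= w1 X q.

Let inJ (q : R) : 0 < q -> J q. Proof. by rewrite /= in_itv /= andbT. Qed.
Let inI (x : R) : 0 <= x <= L -> I x. Proof. by rewrite /= in_itv. Qed.
Let Iin (x : R) : I x -> 0 <= x <= L. Proof. by rewrite /= in_itv. Qed.

Let w1mvt X q r : 0 <= X <= L -> 0 < q -> q <= r ->
  exists2 c, q <= c <= r & w1 X r - w1 X q = w2 X c * (r - q).
Proof.
move=> XL q0 qr; apply: mvt => // z /andP[qz zr].
have z0 := lt_le_trans q0 qz.
apply: hasD_sub (dw1 XL z0) => t; rewrite /= in_itv /= => /andP[qt _].
exact/inJ/(lt_le_trans q0).
Qed.

Lemma w1_lt X q r : 0 <= X <= L -> 0 < q -> q < r -> w1 X q < w1 X r.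
Proof.
move=> XL q0 qr; have [c /andP[qc cr] e] := w1mvt XL q0 (ltW qr).
by rewrite -subr_gt0 e mulr_gt0 ?subr_gt0 // w2pos // (lt_le_trans q0).
Qed.

Lemma w1_le X q r : 0 <= X <= L -> 0 < q -> q <= r -> w1 X q <= w1 X r.
Proof. by move=> XL q0; rewrite le_eqVlt => /predU1P[->//|qr]; exact/ltW/w1_lt. Qed.

Definition pinv_stress X s : R := get [set p | 0 < p /\ w1 X p = s].
Local Notation P := pinv_stress.

Lemma pinv_spec X s : 0 <= X <= L -> 0 < P X s /\ w1 X (P X s) = s.
Proof.
move=> XL; apply: (@getPex _ [set p | 0 < p /\ w1 X p = s]).
have [a a0 wa] := w1low s XL; have [b b0 wb] := w1high s XL.
have [ab|ba] := leP a b; last first.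
  by exists a; split => //; apply/eqP; rewrite eq_le wa (le_trans wb) // w1_le // ltW.
have sub : `[a, b]%classic `<=` J.
  by move=> t; rewrite /= in_itv /= => /andP[at_ _]; exact/inJ/(lt_le_trans a0).
have [||c] := @IVT R (w1 X) a b s ab.
- apply/contwP; apply: contw_sub sub _; exact: cont2_row (inI XL) w1cont.
- by rewrite min_l ?max_r ?w1_le // wa.
by rewrite in_itv /= => /andP[ac _] wc; exists c; split => //; exact: lt_le_trans ac.
Qed.

Lemma pinv_gt0 X s : 0 <= X <= L -> 0 < P X s. Proof. by move=> /(pinv_spec s)[]. Qed.

Lemma pinvE X s : 0 <= X <= L -> w1 X (P X s) = s. Proof. by move=> /(pinv_spec s)[]. Qed.

Lemma pinv_lt X s q : 0 <= X <= L -> 0 < q -> s < w1 X q -> P X s < q.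
Proof.
move=> XL q0 sq; rewrite ltNge; apply/negP => qp.
by have := w1_le XL q0 qp; rewrite pinvE // leNgt sq.
Qed.

Lemma pinv_gt X s q : 0 <= X <= L -> 0 < q -> w1 X q < s -> q < P X s.
Proof.
move=> XL q0 sq; rewrite ltNge; apply/negP => qp.
by have := w1_le XL (pinv_gt0 s XL) qp; rewrite pinvE // leNgt sq.
Qed.

Lemma pinv_le X s q : 0 <= X <= L -> 0 < q -> s <= w1 X q -> P X s <= q.
Proof.
move=> XL q0 sq; rewrite leNgt; apply/negP => qp.
by have := w1_lt XL q0 qp; rewrite pinvE // ltNge sq.
Qed.

Lemma pinv_ge X s q : 0 <= X <= L -> 0 < q -> w1 X q <= s -> q <= P X s.
Proof.
move=> XL q0 sq; rewrite leNgt; apply/negP => qp.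
by have := w1_lt XL (pinv_gt0 s XL) qp; rewrite pinvE // ltNge sq.
Qed.

(** At the two fixed stretches [p - h] and [p + h] the function [w1 X] straddles [s], and [w1] is
    continuous in [X] there. For (Y, r) near (X, s) it still straddles [r], and monotonicity traps
    [P Y r]; one third of each margin serves the change of [X] and one third that of [s]. *)
Lemma pinv_cont : cont2 I setT P.
Proof.
move=> [X s] [/= /Iin XL _]; apply/limwP => e e0 /=.
have p0 := pinv_gt0 s XL.
set p := P X s in p0 *; pose h := Num.min e (p / 2).
have h0 : 0 < h by rewrite lt_min e0 divr_gt0.
have he : h <= e by rewrite ge_min lexx.
have hp : 0 < p - h by have : h <= p / 2 by [rewrite ge_min lexx orbT]; lra.
have lo : w1 X (p - h) < s by rewrite -(pinvE s XL) w1_lt //; rewrite -/p; lra.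
have hi : s < w1 X (p + h) by rewrite -[X in X < _](pinvE s XL) w1_lt //; rewrite -/p; lra.
have [c1 c2] : contw I (w1^~ (p - h)) /\ contw I (w1^~ (p + h)).
  by split; apply: cont2_col w1cont; apply: inJ; lra.
pose e1 := Num.min ((s - w1 X (p - h)) / 3) ((w1 X (p + h) - s) / 3).
have e10 : 0 < e1 by rewrite lt_min !divr_gt0 //; lra.
have e1a : e1 <= (s - w1 X (p - h)) / 3 by rewrite ge_min lexx.
have e1b : e1 <= (w1 X (p + h) - s) / 3 by rewrite ge_min lexx orbT.
clearbody e1.
have /limwP/(_ _ e10)[d1 d10 h1] := c1 X (inI XL).
have /limwP/(_ _ e10)[d2 d20 h2] := c2 X (inI XL).
exists (Num.min e1 (Num.min d1 d2)); first by rewrite !lt_min e10 d10.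
move=> [Y r] [/= IY _] [/=]; rewrite /ball /= !lt_min => /and3P[_ b1 b2] /and3P[b3 _ _].
have YL := Iin IY.
have := h1 Y IY b1; have := h2 Y IY b2; move/ltW: b3; rewrite !ler_norml => /andP[? ?] /andP[? ?] /andP[? ?].
have q1 : P Y r < p + h by apply: pinv_lt => //; lra.
have q2 : p - h < P Y r by apply: pinv_gt => //; lra.
apply/andP; split; lra.
Qed.

(** The compliance, i.e. the derivative of the stretch with respect to the stress. *)
Definition kappa X s : R := (w2 X (P X s))^-1.

Lemma kappa_gt0 X s : 0 <= X <= L -> 0 < kappa X s.
Proof. by move=> XL; rewrite invr_gt0 w2pos // pinv_gt0. Qed.

Lemma kappa_cont : cont2 I setT kappa.
Proof.
apply: contwV => [[X s] [/= /Iin XL _]|].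
  by rewrite gt_eqF // w2pos // pinv_gt0.
apply: (@cont2_comp _ _ _ I J w2 (fun z => z.1) (fun z => P z.1 z.2)) => //.
- exact: contw_fst.
- exact: pinv_cont.
- by move=> z [].
- by move=> [X s] [/= /Iin XL _]; apply: inJ; exact: pinv_gt0.
Qed.

Lemma pinv_hasD D X s : 0 <= X <= L -> hasD D (P X) s (kappa X s).
Proof.
move=> XL; have p0 := pinv_gt0 s XL; have [phi hphi lphi] := dw1 XL p0.
have e r : r - s = phi (P X r) * (P X r - P X s).
  by rewrite -hphi ?pinvE //; exact/inJ/pinv_gt0.
(* Away from [s] a vanishing slope would force [r = s]; at the base point the slope equals [w2],
   because its limit is not deleted. *)
have nz r : phi (P X r) != 0.
  have [->|ne] := eqVneq (P X r) (P X s).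
    have -> : phi (P X s) = w2 X (P X s).
      apply/eqP; rewrite -subr_eq0 -normr_le0; apply/ler_addgt0Pl => eps eps0; rewrite addr0.
      have /limwP/(_ _ eps0)[d d0 hd] := lphi.
      by apply: hd; [exact: inJ|exact: ballxx].
    by rewrite gt_eqF // w2pos.
  apply: contra_neq ne => h; have := e r; rewrite h mul0r => /eqP.
  by rewrite subr_eq0 => /eqP ->.
exists (fun r => (phi (P X r))^-1).
  by move=> r _; rewrite e mulKf.
apply: limwV; first by rewrite gt_eqF // w2pos.
apply: (@limw_comp _ _ D _ J (P X) phi s (P X s)) => //.
  by move=> r _; exact/inJ/pinv_gt0.
have : contw [set: R] (P X) by exact: cont2_row (inI XL) pinv_cont.
by move=> /(_ s Logic.I); apply: limw_sub.
Qed.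


Section Balance.
Variables (l0 c C : R).
Hypothesis l00 : 0 < l0.
Hypothesis c0 : 0 < c.

Definition total_length G s := gmap (fun x => P x s * G x) L.

Definition between G := contw I G /\ forall x, 0 <= x <= L -> c <= G x <= C.

Let Pcont s : contw I (P^~ s). Proof. exact: (@cont2_col _ I setT P s Logic.I pinv_cont). Qed.
Let LL : 0 <= L <= L. Proof. by rewrite lexx ltW. Qed.

Lemma total_length_hasD G a b s : contw I G -> a <= s <= b ->
  hasD `[a, b] (total_length G) s (gmap (fun x => kappa x s * G x) L).
Proof.
move=> cG sab.
apply: (@hasD_gmap_param _ a b L (fun s x => P x s * G x) (fun s x => kappa x s * G x)) => //.
- apply: contwM; last exact: cont2_snd.
  by apply: cont2_sub (cont2_swap pinv_cont).
- apply: contwM; last exact: cont2_snd.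
  by apply: cont2_sub (cont2_swap kappa_cont).
move=> r x rab xL; have := hasDM (pinv_hasD `[a, b] r xL) (hasD_cst `[a, b] (G x) r).
by rewrite mulr0 addr0.
Qed.

(** The stretches [l0 / (M * L)] and [l0 / (m * L)] make the deformed length at most, resp. at
    least, [l0] whatever [G] between [m] and [M]. [- B1] is below all stresses of the first and [B2]
    above all those of the second; the minimum with [B2] only orders the two ends for the
    intermediate value theorem. *)
Lemma total_length_exists G : contw I G -> (forall x, 0 <= x <= L -> 0 < G x) ->
  exists s, total_length G s = l0.
Proof.
have cI := @segment_compact R 0 L.
move=> cG G0.
have [m m0 hm] := compact_pos_bound cI cG (fun x Ix => G0 x (Iin Ix)).
have [M M0 hM] := compact_bound cI cG.
have qm0 : 0 < l0 / (M * L) by rewrite divr_gt0 // mulr_gt0.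
have qp0 : 0 < l0 / (m * L) by rewrite divr_gt0 // mulr_gt0.
have [B1 _ hB1] := compact_bound cI (cont2_col (inJ qm0) w1cont).
have [B2 _ hB2] := compact_bound cI (cont2_col (inJ qp0) w1cont).
pose s1 := Num.min (- B1) B2; pose s2 := B2.
have s12 : s1 <= s2 by rewrite ge_min lexx orbT.
have cc s : contw I (fun x => P x s * G x) by exact: contwM.
have le1 : total_length G s1 <= l0.
  rewrite /total_length; apply: (le_trans (ler_norm _)).
  apply: (@le_trans _ _ (l0 / (M * L) * M * L)); last first.
    by rewrite (_ : _ * L = l0) //; field; rewrite !gt_eqF.
  apply: (gmap_bound (cc s1)) => // x xL; rewrite normrM ler_pM ?hM ?inI //.
  rewrite ger0_norm ?(ltW (pinv_gt0 _ xL)) // pinv_le //.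
  have := hB1 x (inI xL); rewrite ler_norml => /andP[h _].
  by apply: le_trans h; rewrite ge_min lexx.
have le2 : l0 <= total_length G s2.
  rewrite /total_length; apply: (@le_trans _ _ (l0 / (m * L) * m * L)).
    by rewrite (_ : _ * L = l0) //; field; rewrite !gt_eqF.
  apply: (gmap_ge (cc s2)) => // x xL.
  rewrite ler_pM ?(ltW qp0) ?(ltW m0) ?hm ?inI // pinv_ge //.
  by have := hB2 x (inI xL); rewrite ler_norml => /andP[_].
have [||s _ hs] := @IVT R (total_length G) s1 s2 l0 s12.
- apply/contwP; apply: hasD_contw => s; exact: total_length_hasD.
- by rewrite min_l ?max_r ?(le_trans le1) // le1.
by exists s.
Qed.

Lemma total_length_lt G s r : contw I G -> (forall x, 0 <= x <= L -> 0 < G x) ->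
  s < r -> total_length G s < total_length G r.
Proof.
move=> cG G0 sr.
have [e _ eq] : exists2 e, s <= e <= r & total_length G r - total_length G s =
    gmap (fun x => kappa x e * G x) L * (r - s).
  apply: mvt; last exact: ltW.
  by move=> e er; exact: total_length_hasD.
rewrite -subr_gt0 eq mulr_gt0 ?subr_gt0 //.
have cI := @segment_compact R 0 L.
have ck : contw I (fun x => kappa x e * G x).
  by apply: contwM => //; exact: (@cont2_col _ I setT kappa e Logic.I kappa_cont).
have [m m0 hm] := compact_pos_bound cI ck (fun x Ix => mulr_gt0 (kappa_gt0 e (Iin Ix)) (G0 x (Iin Ix))).
apply: (@lt_le_trans _ _ (m * L)); first exact: mulr_gt0.
by apply: (gmap_ge ck) => // x xL; exact/hm/inI.
Qed.

Lemma total_length_inj G s r : contw I G -> (forall x, 0 <= x <= L -> 0 < G x) ->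
  total_length G s = total_length G r -> s = r.
Proof.
move=> cG G0 e; have [sr|rs|//] := ltgtP s r.
  by have := total_length_lt cG G0 sr; rewrite e ltxx.
by have := total_length_lt cG G0 rs; rewrite e ltxx.
Qed.

Lemma between_pos G : between G -> contw I G /\ forall x, 0 <= x <= L -> 0 < G x.
Proof. by move=> [cG h]; split => // x xL; have /andP[+ _] := h x xL; exact: lt_le_trans. Qed.

(** At a fixed stress a larger growth makes the body longer, so it needs a smaller stress to have
    length [l0]. The constant growths [C] and [c] therefore give the extreme stresses. *)
Lemma stress_bounds : c <= C -> exists a b, forall G s, between G -> total_length G s = l0 -> a <= s <= b.
Proof.
move=> cC; have C0 := lt_le_trans c0 cC.
have bc : between (fun=> c) by split; [exact: contw_cst|move=> x _; rewrite lexx].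
have bC : between (fun=> C) by split; [exact: contw_cst|move=> x _; rewrite lexx andbT].
have [ccc cp] := between_pos bc; have [cCC Cp] := between_pos bC.
have [sa ha] := total_length_exists cCC Cp; have [sb hb] := total_length_exists ccc cp.
exists sa, sb => G s bG hs; have [cG Gp] := between_pos bG.
have mono G1 G2 r : contw I G1 -> contw I G2 -> (forall x, 0 <= x <= L -> G1 x <= G2 x) ->
    total_length G1 r <= total_length G2 r.
  move=> c1 c2 h; rewrite -subr_ge0 /total_length (@gmapB _ L) //; try exact: contwM.
  rewrite -[leLHS](mul0r L); apply: (@gmap_ge _ L) => //; first by apply: contwB; exact: contwM.
  by move=> x xL; rewrite -mulrBr mulr_ge0 ?subr_ge0 ?h // ltW // pinv_gt0.
apply/andP; split; rewrite leNgt; apply/negP => lt.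
  have := total_length_lt cG Gp lt; rewrite hs ltNge => /negP; apply.
  by rewrite -ha; apply: mono => // x xL; have /andP[] := bG.2 x xL.
have := total_length_lt cG Gp lt; rewrite hs ltNge => /negP; apply.
by rewrite -hb; apply: mono => // x xL; have /andP[] := bG.2 x xL.
Qed.

(** With [G] fixed, the mean value theorem in the stress bounds the change of length below by
    [k * c * L * |s - r|]. As both constraints equal [l0], this change is also the change of length
    from [G] to [H] at the stress [r], at most [p1 * d * L]. *)
Lemma stress_lipschitz : c <= C -> exists2 K, 0 <= K & forall G H s r d,
  between G -> between H -> total_length G s = l0 -> total_length H r = l0 -> 0 <= d ->
  (forall x, 0 <= x <= L -> `|G x - H x| <= d) -> `|s - r| <= K * d.
Proof.
move=> cC; have [a [b hab]] := stress_bounds cC.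
have cI := @segment_compact R 0 L; have cA := @segment_compact R a b.
have [p1 p10 hp1] := cont2_bound cI cA (cont2_sub (@subset_refl _ I) (@subsetT _ `[a, b]%classic) pinv_cont).
have [k k0 hk] : exists2 k, 0 < k & forall z, (I `*` `[a, b]%classic) z -> k <= kappa z.1 z.2.
  apply: compact_pos_bound; first exact: compact_setX.
    exact: (cont2_sub (@subset_refl _ I) (@subsetT _ `[a, b]%classic) kappa_cont).
  by move=> [x s] [/= /Iin xL _]; exact: kappa_gt0.
exists (p1 / (k * c)); first by rewrite divr_ge0 ?mulr_ge0 ?ltW.
move=> G H s r d bG bH hs hr d0 GH.
have [cG Gp] := between_pos bG; have [cH Hp] := between_pos bH.
have sab := hab _ _ bG hs; have rab := hab _ _ bH hr.
have [e eab eq] : exists2 e, a <= e <= b & total_length G s - total_length G r =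
    gmap (fun x => kappa x e * G x) L * (s - r).
  have [e er eq] : exists2 e, Num.min r s <= e <= Num.max r s & total_length G s - total_length G r =
      gmap (fun x => kappa x e * G x) L * (s - r).
    apply: (@mvt_conv _ `[a, b]%classic (total_length G)).
      move=> z; rewrite /= in_itv /= ge_min le_max; move/andP: sab => [? ?]; move/andP: rab => [? ?].
      by move=> /andP[/orP[] ? /orP[] ?]; apply/andP; split; lra.
    by move=> z; rewrite /= in_itv /=; exact: total_length_hasD.
  exists e => //; move: er; rewrite ge_min le_max; move/andP: sab => [? ?]; move/andP: rab => [? ?].
  by move=> /andP[/orP[] ? /orP[] ?]; apply/andP; split; lra.
have ck : contw I (fun x => kappa x e * G x).
  by apply: contwM => //; exact: (@cont2_col _ I setT kappa e Logic.I kappa_cont).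
have low : k * c * L <= gmap (fun x => kappa x e * G x) L.
  apply: (gmap_ge ck) => // x xL; apply: ler_pM; rewrite ?(ltW k0) ?(ltW c0) //.
    by apply: (hk (x, e)); split; rewrite /= in_itv.
  by have /andP[] := bG.2 x xL.
have up : `|total_length G s - total_length G r| <= p1 * d * L.
  rewrite hs -hr /total_length (@gmapB _ L) //; try exact: contwM.
  apply: (@gmap_bound _ L) => //; first by apply: contwB; exact: contwM.
  move=> x xL; rewrite -mulrBr normrM ler_pM //; last by rewrite distrC GH.
  by apply: hp1; [exact: inI|rewrite /= in_itv].
have kcL : 0 < k * c * L by rewrite !mulr_gt0.
rewrite mulrAC ler_pdivlMr ?mulr_gt0 // -(ler_pM2r L0) -mulrA mulrC.
apply: le_trans up; rewrite eq normrM ler_wpM2r //.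
by apply: (le_trans low); exact: ler_norm.
Qed.

End Balance.

(** * The stress along a curve of growths *)

Section StressInTime.
Variables (l0 T : R) (G Gt : R -> R -> R) (S : R -> R).
Local Notation J' := (`[0, T]%classic : set R).
Hypothesis Gcont : cont2 J' I G.
Hypothesis Gtcont : cont2 J' I Gt.
Hypothesis Gpos : forall t x, 0 <= t <= T -> 0 <= x <= L -> 0 < G t x.
Hypothesis dG : forall t x, 0 <= t <= T -> 0 <= x <= L -> hasD J' (G^~ x) t (Gt t x).
Hypothesis Scont : contw J' S.
Hypothesis Slen : forall t, 0 <= t <= T -> total_length (G t) (S t) = l0.

Let LL : 0 <= L <= L. Proof. by rewrite lexx ltW. Qed.
Let inT (t : R) : 0 <= t <= T -> J' t. Proof. by rewrite /= in_itv. Qed.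
Let pi t x := P x (S t).

Lemma stretch_cont2 : cont2 J' I pi.
Proof.
apply: (@cont2_comp _ _ _ I setT P (fun z => z.2) (fun z => S z.1)) => //.
- exact: pinv_cont.
- exact: contw_snd.
- exact: cont2_fst.
- by move=> z [].
Qed.

(** Implicit differentiation from mere continuity of [S]. Subtracting the constraints at [s] and [t]
    gives [total_length (G t) (S s) - total_length (G t) (S t) = - A s]; the left side is a
    Carathéodory slope, nonzero along [S], times [S s - S t], and the right side is differentiable
    by [gmap_increment_hasD] although it contains the unknown [S s]. *)
Lemma stress_hasD t : 0 <= t <= T ->
  hasD J' S t (- gmap (fun x => Gt t x * pi t x) L / gmap (fun x => G t x / w2 x (pi t x)) L).
Proof.
move=> tT; have It := inT tT; have cI := @segment_compact R 0 L; have cT := @segment_compact R 0 T.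
have cpi := stretch_cont2.
have cGt := cont2_row It Gcont.
pose A s := gmap (fun x => pi s x * (G s x - G t x)) L.
have [al hal lal] : hasD J' A t (gmap (fun x => Gt t x * pi t x) L).
  have -> : gmap (fun x => Gt t x * pi t x) L = gmap (fun x => pi t x * Gt t x) L.
    by congr gmap; apply/funext => x; rewrite mulrC.
  exact: (@gmap_increment_hasD _ T L).
have A0 : A t = 0 by rewrite /A (_ : (fun x => _) = (fun=> 0)) ?gmap_cst0 //; apply/funext => x; rewrite subrr mulr0.
pose F := total_length (G t).
have Gp x : 0 <= x <= L -> 0 < G t x by exact: Gpos.
pose dF s := gmap (fun x => kappa x s * G t x) L.
have dFpos s : 0 < dF s.
  have ck : contw I (fun x => kappa x s * G t x).
    by apply: contwM => //; exact: (@cont2_col _ I setT kappa s Logic.I kappa_cont).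
  have [m m0 hm] := compact_pos_bound cI ck (fun x Ix => mulr_gt0 (kappa_gt0 s (Iin Ix)) (Gp x (Iin Ix))).
  apply: (@lt_le_trans _ _ (m * L)); first exact: mulr_gt0.
  by apply: (gmap_ge ck) => // x xL; exact/hm/inI.
have [B B0 hB] := compact_bound cT Scont.
have SB s : 0 <= s <= T -> - B <= S s <= B by move=> /inT /hB; rewrite ler_norml.
have [phi hphi lphi] := total_length_hasD cGt (SB t tT).
have e s : 0 <= s <= T -> phi (S s) * (S s - S t) = - (al s * (s - t)).
  move=> sT; have SS : [set` `[- B, B]] (S s) by rewrite /= in_itv /= SB.
  rewrite -hphi // -hal ?A0 ?subr0; last exact: inT.
  rewrite (Slen tT) -(Slen sT) /A.
  have cGs := cont2_row (inT sT) Gcont; have cps := cont2_row (inT sT) cpi.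
  rewrite /total_length -[RHS]mulN1r.
  have -> : gmap (fun x => pi s x * (G s x - G t x)) L = gmap (fun x => pi s x * G s x) L - gmap (fun x => pi s x * G t x) L.
    rewrite (@gmapB _ L) //; try exact: contwM.
    by congr gmap; apply/funext => x; rewrite mulrBr.
  by rewrite mulN1r opprB.
have phipos s : 0 <= s <= T -> phi (S s) != 0.
  move=> sT; have [->|ne] := eqVneq (S s) (S t).
    have -> : phi (S t) = dF (S t).
      apply/eqP; rewrite -subr_eq0 -normr_le0; apply/ler_addgt0Pl => eps eps0; rewrite addr0.
      have /limwP/(_ _ eps0)[d d0 hd] := lphi.
      by apply: hd; [rewrite /= in_itv /= SB|exact: ballxx].
    by rewrite gt_eqF // dFpos.
  have SS : [set` `[- B, B]] (S s) by rewrite /= in_itv /= SB.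
  apply: contra_neq ne => h; have := hphi _ SS; rewrite h mul0r => /eqP.
  by rewrite subr_eq0 => /eqP; exact: total_length_inj.
exists (fun s => - al s / phi (S s)).
  move=> s sT'; have sT : 0 <= s <= T by move: sT'; rewrite /= in_itv.
  have ph := phipos s sT.
  by rewrite mulrAC mulNr -e // mulrAC mulfV // mul1r.
have -> : gmap (fun x => G t x / w2 x (pi t x)) L = dF (S t).
  by congr gmap; apply/funext => x; rewrite mulrC.
apply: limwM; first exact: limwN.
apply: limwV; first by rewrite gt_eqF.
apply: (@limw_comp _ _ J' _ `[- B, B]%classic S phi t (S t)) => //.
exact: Scont.
Qed.

Lemma stretch_hasD t x s' : 0 <= t <= T -> 0 <= x <= L -> hasD J' S t s' ->
  hasD J' (pi^~ x) t (s' / w2 x (pi t x)).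
Proof.
move=> tT xL dS.
have := @hasD_comp _ J' setT (P x) S t _ _ (fun _ _ => Logic.I) dS (pinv_hasD setT (S t) xL).
by rewrite mulrC.
Qed.

End StressInTime.

End StressSolve.

(** * Curves of functions with finitely many derivatives *)

Section Regularity.
Variables (R : realType) (T L : R).
Local Notation J := (`[0, T]%classic : set R).
Local Notation I := (`[0, L]%classic : set R).
Hypothesis T0 : 0 < T.
Hypothesis L0 : 0 < L.
Implicit Types (u v : R -> R -> R) (f g : R -> R).

Let inJ (t : R) : 0 <= t <= T -> J t. Proof. by rewrite /= in_itv. Qed.
Let Jin (t : R) : J t -> 0 <= t <= T. Proof. by rewrite /= in_itv. Qed.
Let inI (x : R) : 0 <= x <= L -> I x. Proof. by rewrite /= in_itv. Qed.
Let Iin (x : R) : I x -> 0 <= x <= L. Proof. by rewrite /= in_itv. Qed.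
Let cJ : compact J := @segment_compact R 0 T.
Let cI : compact I := @segment_compact R 0 L.

Definition partialX u ux := forall t x, J t -> I x -> hasD I (u t) x (ux t x).
Definition partialT u ut := forall t x, J t -> I x -> hasD J (u^~ x) t (ut t x).

(** Derivatives are carried by witnesses that are again regular, so closure properties follow by
    induction without iterating [deriv_in]. [regX] asks for joint continuity in (t, X) at every
    order; [reg i j] takes the time derivatives outermost, each of them with [j] derivatives in
    [X]. *)
Fixpoint regX j u : Prop := cont2 J I u /\
  if j is j'.+1 then exists2 ux, partialX u ux & regX j' ux else True.

Fixpoint reg i j u : Prop := regX j u /\
  if i is i'.+1 then exists2 ut, partialT u ut & reg i' j ut else True.

Lemma regX_cont j u : regX j u -> cont2 J I u.
Proof. by case: j => [|j] []. Qed.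

Lemma reg_regX i j u : reg i j u -> regX j u.
Proof. by case: i => [|i] []. Qed.

Lemma reg_cont i j u : reg i j u -> cont2 J I u.
Proof. by move=> /reg_regX/regX_cont. Qed.

Lemma regX_le j j' u : (j' <= j)%N -> regX j u -> regX j' u.
Proof.
elim: j' j u => [|j' IH] [|j] u //=; first by move=> _ [].
by move=> jj [cu [ux dux rux]]; split => //; exists ux => //; exact: IH rux.
Qed.

Lemma reg_le i i' j j' u : (i' <= i)%N -> (j' <= j)%N -> reg i j u -> reg i' j' u.
Proof.
elim: i' i u => [|i' IH] [|i] u //= ii jj [ru]; do ?by split => //; exact: regX_le ru.
by move=> [ut dut rut]; split; [exact: regX_le ru|exists ut => //; exact: IH rut].
Qed.

Lemma partialX_eq u v ux : (forall t x, J t -> I x -> u t x = v t x) -> partialX u ux -> partialX v ux.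
Proof. by move=> uv du t x Jt Ix; apply: (hasD_eq Ix _ (du t x Jt Ix)) => y Iy; exact: uv. Qed.

Lemma partialT_eq u v ut : (forall t x, J t -> I x -> u t x = v t x) -> partialT u ut -> partialT v ut.
Proof.
by move=> uv du t x Jt Ix; apply: (@hasD_eq _ J (u^~ x)) (du t x Jt Ix) => // s Js; exact: uv.
Qed.

Lemma regX_eq j u v : (forall t x, J t -> I x -> u t x = v t x) -> regX j u -> regX j v.
Proof.
case: j => [|j] uv [cu]; first by split => //; exact: cont2_eq cu.
by move=> [ux dux rux]; split; [exact: cont2_eq cu|exists ux => //; exact: partialX_eq dux].
Qed.

Lemma reg_eq i j u v : (forall t x, J t -> I x -> u t x = v t x) -> reg i j u -> reg i j v.
Proof.
case: i => [|i] uv [ru]; first by split => //; exact: regX_eq ru.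
by move=> [ut dut rut]; split; [exact: regX_eq ru|exists ut => //; exact: partialT_eq dut].
Qed.

Lemma cont2_cst (A B : set R) a : cont2 A B (fun _ _ => a : R).
Proof. by move=> z _; exact: limw_cst. Qed.

Lemma regX_cst j a : regX j (fun _ _ => a).
Proof.
elim: j a => [|j IH] a; split => //; try exact: cont2_cst.
by exists (fun _ _ => 0) => // t x _ _; exact: hasD_cst.
Qed.

Lemma reg_cst i j a : reg i j (fun _ _ => a).
Proof.
elim: i a => [|i IH] a; split => //; try exact: regX_cst.
by exists (fun _ _ => 0) => // t x _ _; exact: hasD_cst.
Qed.

Lemma regX_D j u v : regX j u -> regX j v -> regX j (fun t x => u t x + v t x).
Proof.
elim: j u v => [|j IH] u v [cu hu] [cv hv]; split => //; try exact: contwD.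
case: hu hv => [ux dux rux] [vx dvx rvx].
exists (fun t x => ux t x + vx t x); last exact: IH.
by move=> t x Jt Ix; apply: hasDD; [exact: dux|exact: dvx].
Qed.

Lemma reg_D i j u v : reg i j u -> reg i j v -> reg i j (fun t x => u t x + v t x).
Proof.
elim: i u v => [|i IH] u v [cu hu] [cv hv]; split => //; try exact: regX_D.
case: hu hv => [ux dux rux] [vx dvx rvx].
exists (fun t x => ux t x + vx t x); last exact: IH.
by move=> t x Jt Ix; apply: hasDD; [exact: dux|exact: dvx].
Qed.

Lemma regX_M j u v : regX j u -> regX j v -> regX j (fun t x => u t x * v t x).
Proof.
elim: j u v => [|j IH] u v ru rv; have [cu hu] := ru; have [cv hv] := rv; split => //; try exact: contwM.
case: hu hv => [ux dux rux] [vx dvx rvx].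
exists (fun t x => ux t x * v t x + u t x * vx t x).
  by move=> t x Jt Ix; apply: hasDM; [exact: dux|exact: dvx].
by apply: regX_D; apply: IH => //; [exact: regX_le rv|exact: regX_le ru].
Qed.

Lemma reg_M i j u v : reg i j u -> reg i j v -> reg i j (fun t x => u t x * v t x).
Proof.
elim: i u v => [|i IH] u v ru rv; have [cu hu] := ru; have [cv hv] := rv; split => //; try exact: regX_M.
case: hu hv => [ut dut rut] [vt dvt rvt].
exists (fun t x => ut t x * v t x + u t x * vt t x).
  by move=> t x Jt Ix; apply: (@hasDM _ J (u^~ x) (v^~ x)); [exact: dut|exact: dvt].
by apply: reg_D; apply: IH => //; [exact: reg_le rv|exact: reg_le ru].
Qed.

Lemma reg_N i j u : reg i j u -> reg i j (fun t x => - u t x).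
Proof.
move=> ru; apply: reg_eq (reg_M (reg_cst i j (-1)) ru) => t x _ _.
by rewrite mulN1r.
Qed.

Lemma reg_B i j u v : reg i j u -> reg i j v -> reg i j (fun t x => u t x - v t x).
Proof. by move=> ru rv; apply: reg_D => //; exact: reg_N. Qed.

Lemma regX_V j u : (forall t x, J t -> I x -> u t x != 0) -> regX j u ->
  regX j (fun t x => (u t x)^-1).
Proof.
move=> u0; elim: j => [|j IH] ru; have [cu hu] := ru; split => //;
  try by apply: contwV => // -[t x] [Jt Ix]; exact: u0.
case: hu => [ux dux rux].
exists (fun t x => - ux t x * ((u t x)^-1 * (u t x)^-1)).
  move=> t x Jt Ix; have := hasDV Ix (u0 t ^~ Jt) (dux t x Jt Ix).
  by rewrite expr2 invfM.
have ri : regX j (fun t x => (u t x)^-1) by apply: IH; exact: regX_le ru.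
apply: regX_M; last exact: regX_M.
by apply: regX_eq (regX_M (regX_cst j (-1)) rux) => t x _ _; rewrite mulN1r.
Qed.

Lemma reg_V i j u : (forall t x, J t -> I x -> u t x != 0) -> reg i j u ->
  reg i j (fun t x => (u t x)^-1).
Proof.
move=> u0; elim: i => [|i IH] ru; have [cu hu] := ru; split => //; try exact: regX_V.
case: hu => [ut dut rut].
exists (fun t x => - ut t x * ((u t x)^-1 * (u t x)^-1)).
  move=> t x Jt Ix; have := @hasDV _ J (u^~ x) t _ Jt (fun s Js => u0 s x Js Ix) (dut t x Jt Ix).
  by rewrite expr2 invfM.
have ri : reg i j (fun t x => (u t x)^-1) by apply: IH; exact: reg_le ru.
by apply: reg_M; [exact: reg_N|exact: reg_M].
Qed.

Lemma regX_exp j u : regX j u -> regX j (fun t x => expR (u t x)).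
Proof.
elim: j u => [|j IH] u ru; have [cu hu] := ru; split => //;
  try by apply: (contw_comp_continuous cu); exact: continuous_expR.
case: hu => [ux dux rux].
exists (fun t x => expR (u t x) * ux t x).
  move=> t x Jt Ix; apply: (@hasD_comp _ I setT expR (u t)) => //; first exact: dux.
  exact: hasD_expR.
by apply: regX_M => //; apply: IH; exact: regX_le ru.
Qed.

Lemma regX_sum j (A : eqType) (s : seq A) (F : A -> R -> R -> R) :
  (forall a, a \in s -> regX j (F a)) -> regX j (fun t x => \sum_(a <- s) F a t x).
Proof.
elim: s => [|a s IH] rF.
  by apply: regX_eq (regX_cst j 0) => t x _ _; rewrite big_nil.
have rs : regX j (fun t x => \sum_(a <- s) F a t x).
  by apply: IH => b bs; apply: rF; rewrite inE bs orbT.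
by apply: regX_eq (regX_D (rF a (mem_head _ _)) rs) => t x _ _; rewrite big_cons.
Qed.

Lemma reg_sum i j (A : eqType) (s : seq A) (F : A -> R -> R -> R) :
  (forall a, a \in s -> reg i j (F a)) -> reg i j (fun t x => \sum_(a <- s) F a t x).
Proof.
elim: s => [|a s IH] rF.
  by apply: reg_eq (reg_cst i j 0) => t x _ _; rewrite big_nil.
have rs : reg i j (fun t x => \sum_(a <- s) F a t x).
  by apply: IH => b bs; apply: rF; rewrite inE bs orbT.
by apply: reg_eq (reg_D (rF a (mem_head _ _)) rs) => t x _ _; rewrite big_cons.
Qed.

Lemma regX_fst j (f : R -> R) : contw J f -> regX j (fun t _ => f t).
Proof.
case: j => [|j] cf; split => //; try exact: cont2_fst.
by exists (fun _ _ => 0); [move=> t x _ _; exact: hasD_cst|exact: regX_cst].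
Qed.

(** The value at a fixed point is constant in [X], so every spatial order [j] is available whatever
    [j'] is. *)
Lemma reg_slice i j j' u x0 : I x0 -> reg i j' u -> reg i j (fun t _ => u t x0).
Proof.
move=> Ix0; elim: i u => [|i IH] u ru; have [cu hu] := ru; split => //;
  try by apply: regX_fst; exact: (cont2_col Ix0 (reg_cont ru)).
case: hu => [ut dut rut]; exists (fun t _ => ut t x0); last exact: IH.
by move=> t x Jt _; exact: dut.
Qed.

Fixpoint smoothX j (f : R -> R) : Prop := contw I f /\
  if j is j'.+1 then exists2 f', (forall x, I x -> hasD I f x (f' x)) & smoothX j' f' else True.

Lemma regX_snd j f : smoothX j f -> regX j (fun _ x => f x).
Proof.
elim: j f => [|j IH] f [cf hf]; split => //; try exact: cont2_snd.
case: hf => [f' df sf]; exists (fun _ x => f' x); last exact: IH.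
by move=> t x _ Ix; exact: df.
Qed.

Lemma reg_snd i j f : smoothX j f -> reg i j (fun _ x => f x).
Proof.
move=> sf; case: i => [|i]; split => //; try exact: regX_snd.
by exists (fun _ _ => 0); [move=> t x _ _; exact: hasD_cst|exact: reg_cst].
Qed.

Lemma smoothX_id j : smoothX j id.
Proof.
have cst n (a : R) : smoothX n (fun=> a).
  elim: n a => [|n IH] a; split => //; try exact: contw_cst.
  by exists (fun=> 0) => // x _; exact: hasD_cst.
case: j => [|j]; split => //; try exact: contw_id.
by exists (fun=> 1) => // x _; exact: hasD_id.
Qed.

Lemma regX_row j u t : J t -> regX j u -> smoothX j (u t).
Proof.
move=> Jt; elim: j u => [|j IH] u [cu hu]; split => //; try exact: (cont2_row Jt cu).
case: hu => [ux dux rux]; exists (ux t); last exact: IH.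
by move=> x Ix; exact: dux.
Qed.

Definition intX u := fun t x => gmap (u t) x.
Definition intT u := fun t x => gmap (u^~ x) t.

Lemma cont2_intX u : cont2 J I u -> cont2 J I (intX u).
Proof. exact: cont2_gmap. Qed.

Lemma cont2_intT u : cont2 J I u -> cont2 J I (intT u).
Proof. by move=> /cont2_swap/(cont2_gmap cI)/cont2_swap. Qed.

Lemma partialX_intX u : cont2 J I u -> partialX (intX u) u.
Proof. by move=> cu t x Jt /Iin; apply: hasD_gmap; exact: (cont2_row Jt cu). Qed.

Lemma partialT_intT u : cont2 J I u -> partialT (intT u) u.
Proof. by move=> cu t x /Jin Jt Ix; apply: hasD_gmap => //; exact: (cont2_col Ix cu). Qed.

Lemma partialT_intX u ut : cont2 J I u -> cont2 J I ut -> partialT u ut ->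
  partialT (intX u) (intX ut).
Proof.
move=> cu cut du t x /Jin Jt /Iin Ix; by apply: (@hasD_gmap_param _ 0 T L u ut) => // s y /inJ Js /inI Iy; exact: du.
Qed.

Lemma partialX_intT u ux : cont2 J I u -> cont2 J I ux -> partialX u ux ->
  partialX (intT u) (intT ux).
Proof.
move=> cu cux du t x /Jin Jt /Iin Ix.
apply: (@hasD_gmap_param _ 0 L T (fun x s => u s x) (fun x s => ux s x)) => //.
- exact: cont2_swap.
- exact: cont2_swap.
by move=> y s /inI Iy /inJ Js; exact: du.
Qed.

Lemma regX_intT j u : regX j u -> regX j (intT u).
Proof.
elim: j u => [|j IH] u ru; have [cu hu] := ru; split => //; try exact: cont2_intT.
case: hu => [ux dux rux]; exists (intT ux); last exact: IH.
by apply: partialX_intT => //; exact: regX_cont rux.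
Qed.

Lemma regX_intX j u : regX j u -> regX j.+1 (intX u).
Proof.
move=> ru; have cu := regX_cont ru; split; first exact: cont2_intX.
by exists u => //; exact: partialX_intX.
Qed.

Lemma reg_intX i j u : reg i j u -> reg i j (intX u).
Proof.
elim: i u => [|i IH] u ru; have [rx hu] := ru; split => //;
  try by apply: regX_le (regX_intX rx).
case: hu => [ut dut rut]; exists (intX ut); last exact: IH.
by apply: partialT_intX => //; [exact: regX_cont rx|exact: reg_cont rut].
Qed.

Lemma partialX_intT_eq u ut t x : cont2 J I ut -> partialT u ut -> J t -> I x ->
  u t x = u 0 x + intT ut t x.
Proof.
move=> cut du /Jin Jt Ix; apply: (@gmap_uniq _ T (u^~ x) (ut^~ x)) => //.
  exact: (cont2_col Ix cut).
by move=> s /inJ Js; exact: du.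
Qed.

(* Symmetry of second derivatives: differentiate [u t = u 0 + int_0^t ut] in [x]. *)
Lemma partial_schwarz u ux ut utx : cont2 J I ut -> cont2 J I utx -> partialT u ut ->
  partialX u ux -> partialX ut utx -> partialT ux utx.
Proof.
move=> cut cutx dut dux dutx.
have J0 : J 0 by apply: inJ; rewrite lexx ltW.
apply: (@partialT_eq (fun t x => ux 0 x + intT utx t x)); last first.
  move=> t x Jt Ix; have := hasDD (hasD_cst J (ux 0 x) t) (partialT_intT cutx Jt Ix).
  by rewrite add0r.
move=> t x Jt Ix.
apply: (@hasD_itv_uniq _ 0 L (u t) x _ _ L0 (Iin Ix)); last exact: dux.
apply: (@hasD_eq _ I (fun x => u 0 x + intT ut t x)) => //.
  by move=> y Iy; rewrite -partialX_intT_eq.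
by apply: hasDD; [exact: dux|exact: partialX_intT].
Qed.

(** * From joint continuity to curves in C^k *)

Section Ck_norm.

Lemma deriv_in_eq f g x : I x -> (forall y, I y -> f y = g y :> R) -> deriv_in I f x = deriv_in I g x.
Proof.
move=> Ix fg; rewrite /deriv_in; congr lim; apply/seteqP; split => P.
all: apply: near_eq_cvg; rewrite near_withinE; near=> y; move=> Iy; rewrite !fg //.
Unshelve. all: by end_near.
Qed.

Lemma derivn_in_eq n f g x : I x -> (forall y, I y -> f y = g y :> R) ->
  derivn_in I n f x = derivn_in I n g x.
Proof.
elim: n x => [|n IH] x Ix fg; first exact: fg.
by apply: deriv_in_eq => // y Iy; exact: IH.
Qed.

Lemma derivn_inS n f f' x : I x -> (forall y, I y -> hasD I f y (f' y)) ->
  derivn_in I n.+1 f x = derivn_in I n f' x.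
Proof.
move=> Ix df; rewrite /derivn_in iterSr; apply: derivn_in_eq => // y Iy.
apply: hasD_deriv_in (df y Iy); exact: (itv_acc L0 (Iin Iy)).
Qed.

Lemma smoothX_Ck j f : smoothX j f -> Ck I j f.
Proof.
elim: j f => [|j IH] f [cf hf].
  by split => // i; rewrite leqn0 => /eqP ->; exact/contwP.
case: hf => [f' df /IH[h1 h2]]; split => [[|i] x|[|i]] ij.
- by move=> Ix; exact: hasD_derivable_in (df x Ix).
- move=> Ix; have [l hl] := derivable_in_hasD (h1 i x ij Ix).
  apply: (@hasD_derivable_in _ _ _ _ l); apply: (hasD_eq Ix _ hl) => y Iy.
  by rewrite (derivn_inS _ Iy df).
- exact/contwP.
apply/contwP; apply: contw_eq (iffLR (contwP _ _) (h2 i ij)) => y Iy.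
by rewrite (derivn_inS _ Iy df).
Qed.

Lemma Ck_eq j f g : (forall y, I y -> f y = g y :> R) -> Ck I j f -> Ck I j g.
Proof.
move=> fg [h1 h2]; split => [i x ij Ix|i ij].
  have [l hl] := derivable_in_hasD (h1 i x ij Ix).
  apply: (@hasD_derivable_in _ _ _ _ l); apply: (hasD_eq Ix _ hl) => y Iy.
  exact: derivn_in_eq.
apply/contwP; apply: contw_eq (iffLR (contwP _ _) (h2 i ij)) => y Iy.
exact: derivn_in_eq.
Qed.

Lemma I_nonempty : I !=set0.
Proof. by exists 0; apply: inI; rewrite lexx ltW. Qed.

Lemma sup_norm_le f e : (forall x, I x -> `|f x| <= e) -> sup_norm I f <= e.
Proof.
move=> h; apply: ge_sup; first by have [x Ix] := I_nonempty; exists `|f x|, x.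
by move=> _ [x Ix <-]; exact: h.
Qed.

Lemma sup_norm_ge0 f : 0 <= sup_norm I f.
Proof.
rewrite /sup_norm; have [x Ix] := I_nonempty.
have [ub|nub] := pselect (has_ubound [set `|f x| | x in I]).
  by apply: (le_trans (normr_ge0 (f x))); apply: ub_le_sup => //; exists x.
by rewrite sup_out // => -[].
Qed.

(** Boundedness is required because the supremum of an unbounded set is a default value. *)
Lemma sup_norm_ub f x : (exists M, forall x, I x -> `|f x| <= M) -> I x -> `|f x| <= sup_norm I f.
Proof.
move=> [M hM] Ix; apply: ub_le_sup; last by exists x.
by exists M => _ [y Iy <-]; exact: hM.
Qed.

Lemma Ck_norm_le k f e : (forall i x, (i <= k)%N -> I x -> `|derivn_in I i f x| <= e) ->
  Ck_norm I k f <= k.+1%:R * e.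
Proof.
move=> h; rewrite /Ck_norm -[k.+1 in leRHS]card_ord mulr_natl -sumr_const.
apply: ler_sum => i _; apply: sup_norm_le => x Ix; apply: h => //.
by rewrite -ltnS.
Qed.

Lemma Ck_norm_ge0 k f : 0 <= Ck_norm I k f.
Proof. by apply: sumr_ge0 => i _; exact: sup_norm_ge0. Qed.

Lemma sup_norm_le_Ck_norm k f : sup_norm I f <= Ck_norm I k f.
Proof.
rewrite /Ck_norm big_ord_recl lerDl; apply: sumr_ge0 => i _; exact: sup_norm_ge0.
Qed.

Lemma regX_derivn_continuous k u t e : J t -> regX k u -> 0 < e ->
  exists2 d, 0 < d & forall s, J s -> `|s - t| < d ->
    forall i x, (i <= k)%N -> I x -> `|derivn_in I i (fun X => u s X - u t X) x| <= e.
Proof.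
move=> Jt; elim: k u => [|k IH] u [cu hu] e0.
  have [d d0 hd] := cont2_unif cJ cI cu e0; exists d => // s Js st i x.
  by rewrite leqn0 => /eqP -> Ix; apply: hd => //; rewrite subrr normr0.
case: hu => [ux dux rux]; have [d1 d10 h1] := IH ux rux e0.
have [d2 d20 h2] := cont2_unif cJ cI cu e0.
exists (Num.min d1 d2); first by rewrite lt_min d10.
move=> s Js; rewrite lt_min => /andP[s1 s2] [|i] x ik Ix.
  by apply: h2 => //; rewrite subrr normr0.
rewrite (@derivn_inS _ _ (fun X => ux s X - ux t X)) //; first exact: h1.
by move=> y Iy; apply: hasDB; exact: dux.
Qed.

(** By [partial_schwarz] the X-derivative of the quotient error of [u] is the quotient error of
    [ux], so induction on [k] applies. Each single error is an oscillation of the time derivative by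
    the mean value theorem, hence uniformly small. *)
Lemma regX_derivn_quotient k u ut t e : J t -> regX k u -> regX k ut -> partialT u ut -> 0 < e ->
  exists2 d, 0 < d & forall s, J s -> `|s - t| < d -> s != t ->
    forall i x, (i <= k)%N -> I x ->
      `|derivn_in I i (fun X => (u s X - u t X) / (s - t) - ut t X) x| <= e.
Proof.
move=> Jt + + + e0.
have base u' ut' : cont2 J I ut' -> partialT u' ut' -> exists2 d, 0 < d & forall s, J s -> `|s - t| < d ->
    s != t -> forall x, I x -> `|(u' s x - u' t x) / (s - t) - ut' t x| <= e.
  move=> cut du; have [d d0 hd] := cont2_unif cJ cI cut e0.
  exists d => // s Js st nst x Ix.
  have [c ct ->] : exists2 c, Num.min t s <= c <= Num.max t s & u' s x - u' t x = ut' c x * (s - t).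
    apply: (@mvt_conv _ J (u'^~ x) (ut'^~ x)); last by move=> z Jz; exact: du.
    move=> z; rewrite /= in_itv /= ge_min le_max; move/Jin/andP: Js => [? ?]; move/Jin/andP: Jt => [? ?].
    by move=> /andP[/orP[] ? /orP[] ?]; apply/andP; split; lra.
  rewrite mulfK ?subr_eq0 //; apply: hd => //; last by rewrite subrr normr0.
    apply: inJ; move: ct; rewrite ge_min le_max; move/Jin/andP: Js => [? ?]; move/Jin/andP: Jt => [? ?].
    by move=> /andP[/orP[] ? /orP[] ?]; apply/andP; split; lra.
  move: st ct; rewrite !ltr_norml ge_min le_max => /andP[? ?].
  by move=> /andP[/orP[] ? /orP[] ?]; apply/andP; split; lra.
elim: k u ut => [|k IH] u ut ru rut du.
  have [d d0 hd] := base u ut (regX_cont rut) du; exists d => // s Js st nst i x.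
  by rewrite leqn0 => /eqP -> Ix; exact: hd.
have [d2 d20 h2] := base u ut (regX_cont rut) du.
case: ru rut => [cu [ux dux rux]] [cut [utx dutx rutx]].
have dT : partialT ux utx := partial_schwarz cut (regX_cont rutx) du dux dutx.
have [d1 d10 h1] := IH ux utx rux rutx dT.
exists (Num.min d1 d2); first by rewrite lt_min d10.
move=> s Js; rewrite lt_min => /andP[s1 s2] nst [|i] x ik Ix; first exact: h2.
rewrite (@derivn_inS _ _ (fun X => (ux s X - ux t X) / (s - t) - utx t X)) //; first exact: h1.
move=> y Iy; apply: hasDB; last exact: dutx.
have := hasDM (hasDB (dux s y Js Iy) (dux t y Jt Iy)) (hasD_cst I (s - t)^-1 y).
by rewrite mulr0 addr0.
Qed.

Lemma regX_curve_continuous k u : regX k u -> curve_continuous (Ck_norm I k) T u.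
Proof.
move=> ru t /= tT; have Jt : J t by [].
apply/(limwP J (fun s => Ck_norm I k (fun X => u s X - u t X)) t 0) => e e0.
have e'0 : 0 < e / k.+1%:R by rewrite divr_gt0.
have [d d0 hd] := regX_derivn_continuous Jt ru e'0; exists d => // s Js.
rewrite /ball /= distrC subr0 => st; rewrite ger0_norm ?Ck_norm_ge0 //.
apply: (le_trans (Ck_norm_le (hd s Js st))).
by rewrite mulrC divfK.
Qed.

Lemma regX_curve_deriv k u ut t : regX k u -> regX k ut -> partialT u ut -> t \in `[0, T] ->
  curve_deriv (Ck_norm I k) T u t (ut t).
Proof.
move=> ru rut du tT; have Jt : J t by [].
apply/cvgrPdist_le => e e0; rewrite near_withinE nearE /dnbhs /within /=.
have e'0 : 0 < e / k.+1%:R by rewrite divr_gt0.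
have [d d0 hd] := regX_derivn_quotient Jt ru rut du e'0.
apply/nbhs_ballP; exists d => // s; rewrite /ball /= distrC => st nst Js.
rewrite sub0r normrN ger0_norm ?Ck_norm_ge0 //.
apply: (le_trans (Ck_norm_le (hd s Js st nst))).
by rewrite mulrC divfK.
Qed.

Lemma reg_Cm_curve m k u : reg m k u -> Cm_curve (Ck I k) (Ck_norm I k) T m u.
Proof.
elim: m u => [|m IH] u ru; have [rx hu] := ru; split.
- by move=> t tT; apply: smoothX_Ck; exact: regX_row rx.
- by split => //; exact: regX_curve_continuous.
- by move=> t tT; apply: smoothX_Ck; exact: regX_row rx.
split; first exact: regX_curve_continuous.
case: hu => [ut dut rut]; exists ut; last exact: IH.
by move=> t tT; apply: regX_curve_deriv => //; exact: reg_regX rut.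
Qed.

End Ck_norm.

End Regularity.


(** * Chain rule on a box, with derivatives relative to its sides *)

Section ChainRule.
Variables (R : realType) (n : nat) (D : 'I_n -> set R).
Hypothesis Dconv : forall i x y z, D i x -> D i y -> Num.min x y <= z <= Num.max x y -> D i z.
Hypothesis Dacc : forall i x, D i x ->
  forall d, 0 < d -> exists y, [/\ D i y, y != x & `|y - x| < d].
Implicit Types (F : 'rV[R]_n -> R) (v : R -> 'rV[R]_n).

Lemma subst_coordK (v : 'rV[R]_n) i : subst_coord v i (v 0 i) = v.
Proof. by apply/rowP => j; rewrite mxE; case: eqP => // ->. Qed.

Lemma subst_coord_twice (v : 'rV[R]_n) i y z : subst_coord (subst_coord v i y) i z = subst_coord v i z.
Proof. by apply/rowP => j; rewrite !mxE; case: eqP. Qed.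

Lemma subst_coord_same (v : 'rV[R]_n) i y : subst_coord v i y 0 i = y.
Proof. by rewrite mxE eqxx. Qed.

Lemma subst_coord_other (v : 'rV[R]_n) i j y : j != i -> subst_coord v i y 0 j = v 0 j.
Proof. by rewrite mxE => /negPf ->. Qed.

Lemma box_subst (v : 'rV[R]_n) i y : box D v -> D i y -> box D (subst_coord v i y).
Proof. by move=> bv Dy j; rewrite mxE; case: eqP => [->|_]. Qed.

Lemma partial_in_hasD F i (v : 'rV[R]_n) y :
  (forall w, box D w -> derivable_in (D i) (fun y => F (subst_coord w i y)) (w 0 i)) ->
  box D v -> D i y ->
  hasD (D i) (fun y => F (subst_coord v i y)) y (partial_in D i F (subst_coord v i y)).
Proof.
move=> dF bv Dy; have := dF _ (box_subst bv Dy); rewrite /partial_in subst_coord_same.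
rewrite (_ : (fun z => F (subst_coord (subst_coord v i y) i z)) = (fun z => F (subst_coord v i z))).
  by apply: deriv_in_hasD; exact: Dacc.
by apply/funext => z; rewrite subst_coord_twice.
Qed.

(** Induction on the list [l] of moving coordinates: the first one is frozen at its value at [x],
    and the remaining increment is a mean value in that coordinate alone. Only continuity of the
    partials along [l] enters, so coordinates that do not move may lack derivatives. *)
Lemma chain_row (E : set R) F (l : seq 'I_n) v (v' : 'I_n -> R) x : E x -> uniq l ->
  (forall s, E s -> box D (v s)) ->
  (forall i, i \in l -> hasD E (fun s => v s 0 i) x (v' i)) ->
  (forall i s, i \notin l -> E s -> v s 0 i = v x 0 i) ->
  (forall i w, i \in l -> box D w ->
    derivable_in (D i) (fun y => F (subst_coord w i y)) (w 0 i)) ->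
  (forall i, i \in l -> contw (box D) (partial_in D i F)) ->
  hasD E (F \o v) x (\sum_(i <- l) partial_in D i F (v x) * v' i).
Proof.
move=> Ex; elim: l v => [|i l IH] v.
  move=> _ bv _ hc _ _; rewrite big_nil.
  apply: (@hasD_eq _ E (fun=> F (v x))) (hasD_cst E _ x) => // s Es.
  by congr F; apply/rowP => i; rewrite [RHS]hc.
rewrite cons_uniq => /andP[il ul] bv hv hc dF cF.
have mi : i \in i :: l by rewrite mem_head.
have ml j : j \in l -> j \in i :: l by rewrite inE => ->; rewrite orbT.
pose v2 s := subst_coord (v s) i (v x 0 i).
have v2x : v2 x = v x by exact: subst_coordK.
have bx := bv _ Ex.
have h2 : hasD E (F \o v2) x (\sum_(j <- l) partial_in D j F (v x) * v' j).
  have := IH v2 ul; rewrite v2x; apply.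
  - by move=> s Es; apply: box_subst; [exact: bv|exact: bx].
  - move=> j jl; apply: (@hasD_eq _ E (fun s => v s 0 j)) => //; last by apply: hv; exact: ml.
    move=> s Es; rewrite subst_coord_other //.
    by apply: contraNneq il => <-.
  - move=> j s jl Es; rewrite [LHS]mxE; case: eqP => [-> //|/eqP ji].
    by apply: hc => //; rewrite inE negb_or ji.
  - by move=> j w /ml jl; exact: dF.
  - by move=> j /ml; exact: cF.
(* A mean value point for each [s]. It lies between the values of coordinate [i] at [x] and at [s],
   hence converges with them, and continuity of the partial derivative on the box gives the limit of
   the slope. *)
have [xi hxi] : {xi : R -> R & forall s, E s ->
    Num.min (v x 0 i) (v s 0 i) <= xi s <= Num.max (v x 0 i) (v s 0 i) /\
    F (v s) - F (v2 s) = partial_in D i F (subst_coord (v s) i (xi s)) * (v s 0 i - v x 0 i)}.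
  apply: (@boolp.choice _ _ (fun s c => E s ->
    Num.min (v x 0 i) (v s 0 i) <= c <= Num.max (v x 0 i) (v s 0 i) /\
    F (v s) - F (v2 s) = partial_in D i F (subst_coord (v s) i c) * (v s 0 i - v x 0 i))) => s.
  have [Es|nEs] := pselect (E s); last by exists 0.
  have bs := bv _ Es.
  have [c hc1 hc2] := @mvt_conv R (D i) (fun y => F (subst_coord (v s) i y))
    (fun y => partial_in D i F (subst_coord (v s) i y)) (v x 0 i) (v s 0 i)
    (fun z => @Dconv i _ _ z (bx i) (bs i))
    (fun z Dz => partial_in_hasD (fun w => dF i w mi) bs Dz).
  by exists c => _; split => //; move: hc2; rewrite subst_coordK.
rewrite big_cons.
have [q hq lq] := hv i mi.
have h1 : hasD E (fun s => F (v s) - F (v2 s)) x (partial_in D i F (v x) * v' i).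
  exists (fun s => partial_in D i F (subst_coord (v s) i (xi s)) * q s).
    move=> s Es; rewrite v2x subrr subr0 (hxi s Es).2 -mulrA; congr (_ * _).
    exact: hq.
  apply: limwM => //.
  apply: (@limw_comp R _ E _ (box D) (fun s => subst_coord (v s) i (xi s)) _ x (v x)).
  - move=> s Es; apply: box_subst; first exact: bv.
    exact: (@Dconv i _ _ _ (bx i) (bv _ Es i) (hxi s Es).1).
  - apply: limw_row => j.
    have [->|ji] := eqVneq j i; last first.
      rewrite [X in limw _ X](_ : _ = fun s => v s 0 j); last first.
        by apply/funext => s; rewrite subst_coord_other.
      have [jl|jl] := boolP (j \in i :: l); first exact: hasD_cont (hv j jl).
      apply: (@limw_eq R _ E (fun=> v x 0 j)); last exact: limw_cst.
      by move=> s Es; rewrite (hc j s jl Es).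
    rewrite [X in limw _ X](_ : _ = xi); last first.
      by apply/funext => s; rewrite subst_coord_same.
    apply/limwP => e e0.
    have /limwP/(_ e e0)[d d0 hd] := hasD_cont (hv i mi).
    exists d => // s Es sd; apply: le_trans (hd s Es sd).
    move: (hxi s Es).1; rewrite ge_min le_max => /andP[/orP[] h3 /orP[] h4].
    + by rewrite (_ : xi s = v x 0 i) ?subrr ?normr0 //; apply/le_anti/andP.
    + by rewrite !ger0_norm; lra.
    + by rewrite !ler0_norm; lra.
    + by rewrite (_ : xi s = v s 0 i) //; apply/le_anti/andP.
  - exact: (cF i mi _ bx).
by apply: (hasD_eq Ex _ (hasDD h1 h2)) => s Es; rewrite /= subrK.
Qed.

End ChainRule.

(** * Regularity of compositions within a stock of admissible words *)

Section OuterComposition.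
Variables (R : realType) (T L : R) (n : nat) (D : 'I_n -> set R).
Local Notation J := (`[0, T]%classic : set R).
Local Notation I := (`[0, L]%classic : set R).
Hypothesis Dconv : forall i x y z, D i x -> D i y -> Num.min x y <= z <= Num.max x y -> D i z.
Hypothesis Dacc : forall i x, D i x ->
  forall d, 0 < d -> exists y, [/\ D i y, y != x & `|y - x| < d].
Variables (A : pred (seq 'I_n)) (F : 'rV[R]_n -> R) (lT lX : seq 'I_n) (U : 'I_n -> R -> R -> R).
Variable fits : nat -> nat -> seq 'I_n -> bool.
Hypothesis FA : continuous_partials D A F.
Hypothesis fitsA : forall i j w, fits i j w -> A w.
Hypothesis fitsT : forall i j w a, fits i.+1 j w -> a \in lT -> fits i j (a :: w).
Hypothesis fitsX : forall i j w a, fits i j.+1 w -> a \in lX -> fits i j (a :: w).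
Hypothesis fits0 : forall i j w, fits i.+1 j w -> fits i j w.
Hypothesis ulT : uniq lT.
Hypothesis ulX : uniq lX.
Hypothesis UT : forall a t s x, a \notin lT -> J t -> J s -> I x -> U a t x = U a s x.
Hypothesis UX : forall a t x y, a \notin lX -> J t -> I x -> I y -> U a t x = U a t y.
Hypothesis UD : forall a t x, J t -> I x -> D a (U a t x).

Definition row_at t x : 'rV[R]_n := \row_a U a t x.
Local Notation FU w := (fun t x => mixed_partial D w F (row_at t x)).

Lemma row_at_box t x : J t -> I x -> box D (row_at t x).
Proof. by move=> Jt Ix a; rewrite mxE; exact: UD. Qed.

Lemma cont2_row_at w : A w -> (forall a, cont2 J I (U a)) -> cont2 J I (FU w).
Proof.
move=> Aw cU; apply: (@contw_comp R _ (J `*` I) _ (box D) (fun z => row_at z.1 z.2)).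
- by move=> z [Jt Ix]; exact: row_at_box.
- move=> z Kz; apply: limw_row => a.
  rewrite [X in limw _ X](_ : _ = fun z => U a z.1 z.2); last by apply/funext => y; rewrite mxE.
  by rewrite mxE; exact: cU.
by apply/contwP; exact: FA.2.
Qed.

Lemma partialX_row_at j w (Ux : 'I_n -> R -> R -> R) : fits 0 j.+1 w ->
  (forall a, a \in lX -> partialX T L (U a) (Ux a)) ->
  partialX T L (FU w) (fun t x => \sum_(a <- lX) FU (a :: w) t x * Ux a t x).
Proof.
move=> fw dU t x Jt Ix.
apply: (@chain_row R n D Dconv Dacc I (mixed_partial D w F) lX (row_at t) (fun a => Ux a t x)) => //.
- by move=> s Is; exact: row_at_box.
- move=> a al; rewrite [X in hasD _ X](_ : _ = U a t); last by apply/funext => y; rewrite mxE.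
  exact: dU.
- by move=> a s al Is; rewrite !mxE; exact: UX.
- by move=> a v al; apply: FA.1; exact: (fitsA (fitsX fw al)).
by move=> a al; apply/contwP; apply: (FA.2 (a :: w)); exact: (fitsA (fitsX fw al)).
Qed.

Lemma partialT_row_at i j w (Ut : 'I_n -> R -> R -> R) : fits i.+1 j w ->
  (forall a, a \in lT -> partialT T L (U a) (Ut a)) ->
  partialT T L (FU w) (fun t x => \sum_(a <- lT) FU (a :: w) t x * Ut a t x).
Proof.
move=> fw dU t x Jt Ix.
apply: (@chain_row R n D Dconv Dacc J (mixed_partial D w F) lT (row_at ^~ x) (fun a => Ut a t x)) => //.
- by move=> s Is; exact: row_at_box.
- move=> a al; rewrite [X in hasD _ X](_ : _ = (U a)^~ x); last by apply/funext => y; rewrite mxE.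
  exact: dU.
- by move=> a s al Is; rewrite !mxE; exact: UT.
- by move=> a v al; apply: FA.1; exact: (fitsA (fitsT fw al)).
by move=> a al; apply/contwP; apply: (FA.2 (a :: w)); exact: (fitsA (fitsT fw al)).
Qed.

(** One derivative in [X] turns the composition at the word [w] into a sum over [lX] of compositions
    at words with one more letter. [fits] records how many further derivatives the stock of words
    allows, which keeps the induction inside the assumption on [F]. *)
Lemma regX_comp j w : fits 0 j w -> (forall a, regX T L j (U a)) -> regX T L j (FU w).
Proof.
elim: j w => [|j IH] w fw rU; split => //; try by apply: cont2_row_at (fitsA fw) _ => a; have [] := rU a.
have [Ux hU] : {Ux : 'I_n -> R -> R -> R & forall a,
    partialX T L (U a) (Ux a) /\ regX T L j (Ux a)}.
  by apply: (@boolp.choice _ _ (fun a ux => partialX T L (U a) ux /\ regX T L j ux)) => a;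
     have [_ [ux]] := rU a; exists ux.
exists (fun t x => \sum_(a <- lX) FU (a :: w) t x * Ux a t x).
  by apply: (partialX_row_at fw) => a _; exact: (hU a).1.
apply: (@regX_sum _ _ _ _ _ _ (fun a t x => FU (a :: w) t x * Ux a t x)) => a al.
apply: regX_M; last exact: (hU a).2.
apply: IH; first exact: fitsX al.
by move=> b; apply: regX_le (rU b).
Qed.

Lemma reg_comp i j w : fits i j w -> (forall a, reg T L i j (U a)) -> reg T L i j (FU w).
Proof.
elim: i w => [|i IH] w fw rU.
  by split => //; apply: regX_comp => // a; exact: (reg_regX (rU a)).
split.
  apply: regX_comp => [|a]; last exact: (reg_regX (rU a)).
  by elim: i {IH rU} fw => [|i IH] /fits0 // /IH.
have [Ut hU] : {Ut : 'I_n -> R -> R -> R & forall a,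
    partialT T L (U a) (Ut a) /\ reg T L i j (Ut a)}.
  by apply: (@boolp.choice _ _ (fun a ut => partialT T L (U a) ut /\ reg T L i j ut)) => a;
     have [_ [ut]] := rU a; exists ut.
exists (fun t x => \sum_(a <- lT) FU (a :: w) t x * Ut a t x).
  by apply: (partialT_row_at fw) => a _; exact: (hU a).1.
apply: (@reg_sum _ _ _ _ _ _ _ (fun a t x => FU (a :: w) t x * Ut a t x)) => a al.
apply: reg_M; last exact: (hU a).2.
apply: IH; first exact: fitsT al.
by move=> b; apply: reg_le (rU b).
Qed.

End OuterComposition.

(** * The nutrient concentration as a function of the growth *)

Section FundamentalSolutions.
Variables (R : realType) (L : R).
Hypothesis L0 : 0 < L.
Local Notation I := (`[0, L]%classic : set R).
Implicit Types (a b : R -> R) (x y d n q al be : R).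
Let inI (x : R) : 0 <= x <= L -> I x. Proof. by rewrite /= in_itv. Qed.
Let Iin (x : R) : I x -> 0 <= x <= L. Proof. by rewrite /= in_itv. Qed.
Let LL : 0 <= L <= L. Proof. by rewrite lexx ltW. Qed.

Definition lin_sol a b (n0 q0 : R) : (R -> R) * (R -> R) :=
  get [set z : (R -> R) * (R -> R) | [/\ linsys L a b z.1 z.2, z.1 0 = n0, z.2 0 = q0,
    forall x, 0 <= x <= L -> n0 <= z.1 x & forall x, 0 <= x <= L -> q0 <= z.2 x]].

Definition coeff al be a b := [/\ contw I a, contw I b &
  forall x, 0 <= x <= L -> al <= a x <= be /\ al <= b x <= be].

Variables (al be : R).
Hypothesis al0 : 0 < al.
Hypothesis albe : al <= be.

Lemma lin_sol_spec a b n0 q0 : coeff al be a b -> 0 <= n0 -> 0 <= q0 ->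
  let z := lin_sol a b n0 q0 in [/\ linsys L a b z.1 z.2, z.1 0 = n0, z.2 0 = q0,
    forall x, 0 <= x <= L -> n0 <= z.1 x & forall x, 0 <= x <= L -> q0 <= z.2 x].
Proof.
move=> [ca cb hab] n00 q00; apply: (@getPex _ [set z : (R -> R) * (R -> R) | [/\ linsys L a b z.1 z.2, z.1 0 = n0, z.2 0 = q0,
    forall x, 0 <= x <= L -> n0 <= z.1 x & forall x, 0 <= x <= L -> q0 <= z.2 x]]).
have [|x xL|N [q h]] := linsys_exists L0 ca cb _ _ n00 q00; last by exists (N, q).
- by move=> x xL; have [/andP[h _] _] := hab x xL; exact: le_trans (ltW al0) h.
- by have [_ /andP[h _]] := hab x xL; exact: le_trans (ltW al0) h.
Qed.

Let M := expR (be * L).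

Lemma lin_sol_bound a b n0 q0 : coeff al be a b -> 0 <= n0 -> 0 <= q0 -> n0 + q0 = 1 ->
  forall x, 0 <= x <= L -> `|(lin_sol a b n0 q0).1 x| <= M /\ `|(lin_sol a b n0 q0).2 x| <= M.
Proof.
move=> cab n00 q00 nq x xL.
have [h e1 e2 g1 g2] := lin_sol_spec cab n00 q00.
have be0 : 0 <= be := le_trans (ltW al0) albe.
have := @linsys_bound _ _ L0 a b _ _ be be0 h _ _ x xL.
rewrite e1 e2 nq mul1r; apply => y yL.
  by split; [exact: le_trans (g1 y yL)|exact: le_trans (g2 y yL)].
by have [_ _ /(_ y yL)[/andP[_ ?] /andP[_ ?]]] := cab.
Qed.

Lemma lin_sol_wronskian a b : coeff al be a b -> forall x, 0 <= x <= L ->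
  (lin_sol a b 0 1).2 x * (lin_sol a b 1 0).1 x - (lin_sol a b 0 1).1 x * (lin_sol a b 1 0).2 x = 1.
Proof.
move=> cab x xL.
have [h1 e1 e2 _ _] := lin_sol_spec cab (lexx 0) ler01.
have [h2 e3 e4 _ _] := lin_sol_spec cab ler01 (lexx 0).
by rewrite (wronskian h1 h2 xL) e1 e2 e3 e4; ring.
Qed.

Lemma lin_sol_lipschitz : exists2 K, 0 <= K & forall a b a' b' d n0 q0,
  coeff al be a b -> coeff al be a' b' -> 0 <= d -> 0 <= n0 -> 0 <= q0 -> n0 + q0 = 1 ->
  (forall x, 0 <= x <= L -> `|a' x - a x| <= d /\ `|b' x - b x| <= d) ->
  forall x, 0 <= x <= L ->
    `|(lin_sol a' b' n0 q0).1 x - (lin_sol a b n0 q0).1 x| <= K * d /\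
    `|(lin_sol a' b' n0 q0).2 x - (lin_sol a b n0 q0).2 x| <= K * d.
Proof.
have M0 : 0 < M by exact: expR_gt0.
(* In the variation of constants each integrand has two terms of size [M ^+ 2 * d], so each integral
   is at most [2 * M ^+ 2 * L * d]; two such integrals are multiplied by fundamental solutions of
   size [M]. *)
exists (4 * M ^+ 3 * L).
  by rewrite mulr_ge0 ?ltW // mulr_gt0 // exprn_gt0.
move=> a b a' b' d n0 q0 cab cab' d0 n00 q00 nq hd x xL.
have [h e1 e2 _ _] := lin_sol_spec cab n00 q00.
have [h' e1' e2' _ _] := lin_sol_spec cab' n00 q00.
have [h1 _ _ _ _] := lin_sol_spec cab' (lexx 0) ler01.
have [h2 _ _ _ _] := lin_sol_spec cab' ler01 (lexx 0).
have B := lin_sol_bound cab n00 q00 nq.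
have B1 := lin_sol_bound cab' (lexx 0) ler01 (add0r 1).
have B2 := lin_sol_bound cab' ler01 (lexx 0) (addr0 1).
have [ca cb _] := cab; have [ca' cb' _] := cab'.
have [cN cq] := linsys_contw h.
have [cN1 cq1] := linsys_contw h1; have [cN2 cq2] := linsys_contw h2.
have := @linsys_perturb _ _ a b a' b' _ _ _ _ _ _ _ _ ca cb ca' cb' h h'
   (etrans e1' (esym e1)) (etrans e2' (esym e2)) h1 h2 (lin_sol_wronskian cab') x xL.
set N := (lin_sol a b n0 q0).1 in h e1 B cN *; set q := (lin_sol a b n0 q0).2 in h e2 B cq *.
set N1 := (lin_sol a' b' 0 1).1 in h1 B1 cN1 *; set q1 := (lin_sol a' b' 0 1).2 in h1 B1 cq1 *.
set N2 := (lin_sol a' b' 1 0).1 in h2 B2 cN2 *; set q2 := (lin_sol a' b' 1 0).2 in h2 B2 cq2 *.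
have term u v w z : contw I u -> contw I v -> contw I w -> contw I z ->
    (forall x, 0 <= x <= L -> `|u x| <= M) -> (forall x, 0 <= x <= L -> `|v x| <= M) ->
    (forall x, 0 <= x <= L -> `|w x| <= M) -> (forall x, 0 <= x <= L -> `|z x| <= M) ->
    `|gmap (fun x => u x * ((a' x - a x) * v x) - w x * ((b' x - b x) * z x)) x| <= 2 * M ^+ 2 * L * d /\
    `|gmap (fun x => w x * ((b' x - b x) * z x) - u x * ((a' x - a x) * v x)) x| <= 2 * M ^+ 2 * L * d.
  move=> cu cv cw cz bu bv bw bz.
  have E y : 0 <= y <= L -> `|u y * ((a' y - a y) * v y)| <= M ^+ 2 * d /\
      `|w y * ((b' y - b y) * z y)| <= M ^+ 2 * d.
    move=> yL; have [d1 d2] := hd y yL; split; rewrite !normrM.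
      rewrite (_ : M ^+ 2 * d = M * (d * M)); last by ring.
      by apply: ler_pM => //; [exact: bu|apply: ler_pM => //; exact: bv].
    rewrite (_ : M ^+ 2 * d = M * (d * M)); last by ring.
    by apply: ler_pM => //; [exact: bw|apply: ler_pM => //; exact: bz].
  have X : 2 * M ^+ 2 * d * x <= 2 * M ^+ 2 * L * d.
    rewrite (_ : 2 * M ^+ 2 * L * d = 2 * M ^+ 2 * d * L); last by ring.
    by rewrite ler_wpM2l ?(andP xL).2 // mulr_ge0 // mulr_ge0 // exprn_ge0 // ltW.
  have c1 : contw I (fun x => u x * ((a' x - a x) * v x)).
    by apply: contwM => //; apply: contwM => //; exact: contwB.
  have c2 : contw I (fun x => w x * ((b' x - b x) * z x)).
    by apply: contwM => //; apply: contwM => //; exact: contwB.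
  split; apply: le_trans X; apply: (@gmap_bound _ L) => //; try by apply: contwB.
    move=> y /E[p1 p2]; apply: (le_trans (ler_normB _ _)).
    by rewrite (_ : 2 * _ * d = M ^+ 2 * d + M ^+ 2 * d) ?lerD //; ring.
  move=> y /E[p1 p2]; apply: (le_trans (ler_normB _ _)).
  by rewrite (_ : 2 * _ * d = M ^+ 2 * d + M ^+ 2 * d) ?lerD //; ring.
have P u v e f : `|u| <= M -> `|v| <= M -> `|e| <= 2 * M ^+ 2 * L * d -> `|f| <= 2 * M ^+ 2 * L * d ->
    `|u * e + v * f| <= 4 * M ^+ 3 * L * d.
  move=> bu bv he hf; apply: (le_trans (ler_normD _ _)); rewrite !normrM.
  rewrite (_ : 4 * M ^+ 3 * L * d = M * (2 * M ^+ 2 * L * d) + M * (2 * M ^+ 2 * L * d)); last by ring.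
  by apply: lerD; apply: ler_pM.
have bq1 y : 0 <= y <= L -> `|q1 y| <= M by move=> /B1[].
have bq2 y : 0 <= y <= L -> `|q2 y| <= M by move=> /B2[].
have bN1 y : 0 <= y <= L -> `|N1 y| <= M by move=> /B1[].
have bN2 y : 0 <= y <= L -> `|N2 y| <= M by move=> /B2[].
have bN y : 0 <= y <= L -> `|N y| <= M by move=> /B[].
have bq y : 0 <= y <= L -> `|q y| <= M by move=> /B[].
have [g1 _] := term q1 q N1 N cq1 cq cN1 cN bq1 bq bN1 bN.
have [_ g2] := term q2 q N2 N cq2 cq cN2 cN bq2 bq bN2 bN.
by move=> [-> ->]; split; apply: P => //; [exact: bN2|exact: bN1|exact: bq2|exact: bq1].
Qed.

(** [N' = a q] with [a >= al] and [q >= 1]. This bounds the denominator of the boundary value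
    formula away from 0 uniformly in the coefficients. *)
Lemma lin_sol_end a b : coeff al be a b -> al * L <= (lin_sol a b 0 1).1 L.
Proof.
move=> cab; have [h e1 e2 g1 g2] := lin_sol_spec cab (lexx 0) ler01.
have [ca cb hab] := cab; have [cN cq] := linsys_contw h.
have c1 : contw I (fun x => a x * (lin_sol a b 0 1).2 x) by exact: contwM.
have -> := gmap_uniq c1 (fun x xL => (h x xL).1) LL.
rewrite e1 add0r; apply: (gmap_ge c1) => // x xL.
have [/andP[a1 _] _] := hab x xL; have g := g2 x xL.
by rewrite -[leLHS]mulr1; apply: ler_pM => //; exact: ltW.
Qed.

Definition nutrient_bvp a b (nL nR x : R) : R :=
  let z1 := lin_sol a b 0 1 in let z2 := lin_sol a b 1 0 in
  (nL * (z2.1 x * z1.1 L - z2.1 L * z1.1 x) + nR * z1.1 x) / z1.1 L.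

Definition nutrient_flux a b (nL nR x : R) : R :=
  let z1 := lin_sol a b 0 1 in let z2 := lin_sol a b 1 0 in
  (nL * (z2.2 x * z1.1 L - z2.1 L * z1.2 x) + nR * z1.2 x) / z1.1 L.

Section Boundary.
Variables (nL nR : R).
Hypothesis nL0 : 0 <= nL.
Hypothesis nR0 : 0 <= nR.

Lemma nutrient_bvp_spec a b : coeff al be a b ->
  let N := nutrient_bvp a b nL nR in let q := nutrient_flux a b nL nR in
  [/\ linsys L a b N q, N 0 = nL, N L = nR & forall x, 0 <= x <= L -> 0 <= N x <= nL + nR].
Proof.
move=> cab; have [h1 e1 e2 g1 g2] := lin_sol_spec cab (lexx 0) ler01.
have [h2 e3 e4 g3 g4] := lin_sol_spec cab ler01 (lexx 0).
have [ca cb hab] := cab.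
apply: (bvp_formula L0 nL0 nR0 _ _ h1 h2) => //.
- by move=> x xL; have [/andP[h _] _] := hab x xL; exact: le_trans (ltW al0) h.
- by move=> x xL; have [_ /andP[h _]] := hab x xL; exact: le_trans (ltW al0) h.
- by move=> x xL; apply: le_trans (g2 x xL).
by apply: lt_le_trans (lin_sol_end cab); rewrite mulr_gt0.
Qed.

Lemma nutrient_bvp_lipschitz : exists2 K, 0 <= K & forall a b a' b' d,
  coeff al be a b -> coeff al be a' b' -> 0 <= d ->
  (forall x, 0 <= x <= L -> `|a' x - a x| <= d /\ `|b' x - b x| <= d) ->
  forall x, 0 <= x <= L -> `|nutrient_bvp a' b' nL nR x - nutrient_bvp a b nL nR x| <= K * d.
Proof.
have [K K0 hK] := lin_sol_lipschitz.
have M0 : 0 < M by exact: expR_gt0.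
have l0 : 0 < al * L by exact: mulr_gt0.
(* The Lipschitz constant of the ratio of the first fundamental solution at [x] to its value at [L],
   through which alone the denominator enters. *)
pose rK := 2 * M * K / (al * L) ^+ 2.
have rK0 : 0 <= rK by rewrite /rK divr_ge0 ?exprn_ge0 ?(ltW l0) // mulr_ge0 // mulr_ge0 // ltW.
exists (nL * (K + (K * (M / (al * L)) + M * rK)) + nR * rK).
  have x1 : 0 <= K * (M / (al * L)) by rewrite mulr_ge0 // divr_ge0 // ltW.
  have x2 : 0 <= M * rK by rewrite mulr_ge0 // ltW.
  by rewrite addr_ge0 // mulr_ge0 // addr_ge0 // addr_ge0.
move=> a b a' b' d cab cab' d0 hd x xL.
have [D1 _] := hK a b a' b' d 0 1 cab cab' d0 (lexx 0) ler01 (add0r 1) hd x xL.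
have [D1L _] := hK a b a' b' d 0 1 cab cab' d0 (lexx 0) ler01 (add0r 1) hd L LL.
have [D2 _] := hK a b a' b' d 1 0 cab cab' d0 ler01 (lexx 0) (addr0 1) hd x xL.
have [D2L _] := hK a b a' b' d 1 0 cab cab' d0 ler01 (lexx 0) (addr0 1) hd L LL.
have [B1 _] := lin_sol_bound cab (lexx 0) ler01 (add0r 1) xL.
have [B1' _] := lin_sol_bound cab' (lexx 0) ler01 (add0r 1) xL.
have [B1L _] := lin_sol_bound cab (lexx 0) ler01 (add0r 1) LL.
have [B2L _] := lin_sol_bound cab ler01 (lexx 0) (addr0 1) LL.
have [B2L' _] := lin_sol_bound cab' ler01 (lexx 0) (addr0 1) LL.
have E := lin_sol_end cab; have E' := lin_sol_end cab'.
rewrite /nutrient_bvp.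
move: D1 D1L D2 D2L B1 B1' B1L B2L B2L' E E'.
set u := (lin_sol a b 0 1).1; set u' := (lin_sol a' b' 0 1).1.
set v := (lin_sol a b 1 0).1; set v' := (lin_sol a' b' 1 0).1.
move=> D1 D1L D2 D2L B1 B1' B1L B2L B2L' E E'.
have uL : 0 < u L by exact: lt_le_trans E.
have uL' : 0 < u' L by exact: lt_le_trans E'.
have rho : `|u' x / u' L - u x / u L| <= rK * d.
  rewrite (_ : _ - _ = ((u' x - u x) * u L - u x * (u' L - u L)) / (u L * u' L)); last by field; rewrite !gt_eqF.
  rewrite normrM (ger0_norm (ltW _ : 0 <= (u L * u' L)^-1)) ?invr_gt0 ?mulr_gt0 //.
  rewrite (_ : rK * d = (K * d * M + M * (K * d)) / (al * L) ^+ 2); last by rewrite /rK; ring.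
  apply: ler_pM => //; first by rewrite invr_ge0 mulr_ge0 // ltW.
    by apply: (le_trans (ler_normB _ _)); rewrite !normrM; apply: lerD; apply: ler_pM.
  by rewrite lef_pV2 ?posrE ?mulr_gt0 // ?exprn_gt0 // expr2 ler_pM // ltW.
have rb : `|u' x / u' L| <= M / (al * L).
  rewrite normrM; apply: ler_pM => //.
  by rewrite ger0_norm ?invr_ge0 ?(ltW uL') // lef_pV2 ?posrE.
rewrite (_ : _ - _ = nL * ((v' x - v x) - ((v' L - v L) * (u' x / u' L) + v L * (u' x / u' L - u x / u L)))
   + nR * (u' x / u' L - u x / u L)); last by field; rewrite !gt_eqF.
apply: (le_trans (ler_normD _ _)).
rewrite (_ : _ * d = nL * (K * d + (K * d * (M / (al * L)) + M * (rK * d))) + nR * (rK * d)); last by ring.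
rewrite !normrM (ger0_norm nL0) (ger0_norm nR0); apply: lerD; last exact: ler_wpM2l.
apply: ler_wpM2l => //; apply: (le_trans (ler_normB _ _)); apply: lerD => //.
by apply: (le_trans (ler_normD _ _)); rewrite !normrM; apply: lerD; apply: ler_pM => //; rewrite -normrM.
Qed.

End Boundary.

(** * Fundamental solutions with coefficients depending on time *)

Section InTime.
Variables (T : R).
Local Notation J := (`[0, T]%classic : set R).
Variables (a b : R -> R -> R).
Hypothesis cab : forall t, 0 <= t <= T -> coeff al be (a t) (b t).
Let Jin (t : R) : J t -> 0 <= t <= T. Proof. by rewrite /= in_itv. Qed.
Let cJ : compact J := @segment_compact R 0 T.
Let cI : compact I := @segment_compact R 0 L.

Section OneSolution.
Variables (n0 q0 : R).
Hypothesis n00 : 0 <= n0.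
Hypothesis q00 : 0 <= q0.
Hypothesis nq : n0 + q0 = 1.
Definition solN n0 q0 t x := (lin_sol (a t) (b t) n0 q0).1 x.
Definition solq n0 q0 t x := (lin_sol (a t) (b t) n0 q0).2 x.

Lemma sol_cont2 : cont2 J I a -> cont2 J I b ->
  cont2 J I (solN n0 q0) /\ cont2 J I (solq n0 q0).
Proof.
move=> ca cb; have [K K0 hK] := lin_sol_lipschitz.
have ex t e : J t -> 0 < e -> exists2 d, 0 < d & forall s, J s -> `|s - t| < d -> forall x, I x ->
    `|solN n0 q0 s x - solN n0 q0 t x| <= e /\ `|solq n0 q0 s x - solq n0 q0 t x| <= e.
  move=> Jt e0; pose e' := e / (K + 1); have e'0 : 0 < e' by rewrite divr_gt0 //; lra.
  have [d1 d10 h1] := cont2_unif cJ cI ca e'0; have [d2 d20 h2] := cont2_unif cJ cI cb e'0.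
  exists (Num.min d1 d2); first by rewrite lt_min d10.
  move=> s Js; rewrite lt_min => /andP[s1 s2] x /Iin xL.
  have Ke : K * e' <= e.
    by rewrite /e' mulrA ler_pdivrMr ?mulrDr; nra.
  have [|p1 p2] := hK (a t) (b t) (a s) (b s) e' n0 q0 (cab (Jin Jt)) (cab (Jin Js)) (ltW e'0) n00 q00 nq _ x xL.
    move=> y /inI Iy; split; [apply: h1|apply: h2] => //; by rewrite subrr normr0.
  by split; exact: le_trans Ke.
split; apply: cont2_build => t.
- move=> Jt; by have [/linsys_contw[]] := lin_sol_spec (cab (Jin Jt)) n00 q00.
- move=> e Jt e0; have [d d0 hd] := ex t e Jt e0; exists d => // s Js st x Ix.
  by have [] := hd s Js st x Ix.
- move=> Jt; by have [/linsys_contw[]] := lin_sol_spec (cab (Jin Jt)) n00 q00.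
move=> e Jt e0; have [d d0 hd] := ex t e Jt e0; exists d => // s Js st x Ix.
by have [] := hd s Js st x Ix.
Qed.

Lemma sol_regX j : regX T L j a -> regX T L j b ->
  regX T L j (solN n0 q0) /\ regX T L j (solq n0 q0).
Proof.
move=> ra rb; have [cN cq] := sol_cont2 (regX_cont ra) (regX_cont rb).
elim: j ra rb => [|j IH] ra rb; first by [].
have [rN rq] : regX T L j (solN n0 q0) /\ regX T L j (solq n0 q0).
  by apply: IH; [exact: regX_le ra|exact: regX_le rb].
split; split => //.
  exists (fun t x => a t x * solq n0 q0 t x).
    move=> t x Jt /Iin xL; have [h _ _ _ _] := lin_sol_spec (cab (Jin Jt)) n00 q00.
    by have [] := h x xL.
  by apply: regX_M => //; exact: regX_le ra.
exists (fun t x => b t x * solN n0 q0 t x).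
  move=> t x Jt /Iin xL; have [h _ _ _ _] := lin_sol_spec (cab (Jin Jt)) n00 q00.
  by have [] := h x xL.
by apply: regX_M => //; exact: regX_le rb.
Qed.

End OneSolution.

Local Notation N1 := (solN 0 1).
Local Notation q1 := (solq 0 1).
Local Notation N2 := (solN 1 0).
Local Notation q2 := (solq 1 0).

Section TimeDerivative.
Variables (at_ bt : R -> R -> R).
(** Coefficients of the variation of constants for the linearized system [N_t' = a q_t + a_t q],
    [q_t' = b N_t + b_t N] with zero initial values; [solNt] and [solqt] are its solution. *)
Definition sol_al n0 q0 t x :=
  gmap (fun y => q1 t y * solq n0 q0 t y * at_ t y) x - gmap (fun y => N1 t y * solN n0 q0 t y * bt t y) x.
Definition sol_be n0 q0 t x :=
  gmap (fun y => N2 t y * solN n0 q0 t y * bt t y) x - gmap (fun y => q2 t y * solq n0 q0 t y * at_ t y) x.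
Definition solNt n0 q0 t x := N2 t x * sol_al n0 q0 t x + N1 t x * sol_be n0 q0 t x.
Definition solqt n0 q0 t x := q2 t x * sol_al n0 q0 t x + q1 t x * sol_be n0 q0 t x.

(** [linsys_perturb] is applied with the system at the moving time [s] as the original and the one
    at [t] as the perturbation. The fundamental matrix is thus frozen at [t], and the solution at
    [s] only multiplies the increments [a s - a t] and [b s - b t], where its continuity
    suffices. *)
Lemma sol_partialT n0 q0 : 0 <= n0 -> 0 <= q0 -> n0 + q0 = 1 ->
  cont2 J I a -> cont2 J I b -> cont2 J I at_ -> cont2 J I bt ->
  partialT T L a at_ -> partialT T L b bt ->
  partialT T L (solN n0 q0) (solNt n0 q0) /\ partialT T L (solq n0 q0) (solqt n0 q0).
Proof.
move=> n00 q00 nq ca cb cat cbt da db.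
have [cN cq] := sol_cont2 n00 q00 nq ca cb.
suff H t x : J t -> I x -> hasD J ((solN n0 q0)^~ x) t (solNt n0 q0 t x) /\
    hasD J ((solq n0 q0)^~ x) t (solqt n0 q0 t x).
  by split => t x Jt Ix; have [] := H t x Jt Ix.
move=> Jt Ix; have xL := Iin Ix; have tT := Jin Jt.
have [h1 _ _ _ _] := lin_sol_spec (cab tT) (lexx 0) ler01.
have [h2 _ _ _ _] := lin_sol_spec (cab tT) ler01 (lexx 0).
have [cN1 cq1] := linsys_contw h1; have [cN2 cq2] := linsys_contw h2.
have inc g u at' : contw I g -> cont2 J I u -> cont2 J I at' -> partialT T L u at' ->
    forall p, cont2 J I p ->
    hasD J (fun s => gmap (fun y => g y * p s y * (u s y - u t y)) x) t
      (gmap (fun y => g y * p t y * at' t y) x).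
  move=> cg cu cu' du p cp.
  apply: (@gmap_increment_hasD _ T L (fun s y => g y * p s y)) => //.
  by apply: contwM => //; exact: cont2_snd.
pose al' s := gmap (fun y => q1 t y * solq n0 q0 s y * (a s y - a t y)) x -
  gmap (fun y => N1 t y * solN n0 q0 s y * (b s y - b t y)) x.
pose be' s := gmap (fun y => N2 t y * solN n0 q0 s y * (b s y - b t y)) x -
  gmap (fun y => q2 t y * solq n0 q0 s y * (a s y - a t y)) x.
have dal : hasD J al' t (sol_al n0 q0 t x).
  by apply: hasDB; exact: inc.
have dbe : hasD J be' t (sol_be n0 q0 t x).
  by apply: hasDB; exact: inc.
have E s : J s -> solN n0 q0 s x = solN n0 q0 t x + (N2 t x * al' s + N1 t x * be' s) /\
    solq n0 q0 s x = solq n0 q0 t x + (q2 t x * al' s + q1 t x * be' s).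
  move=> Js; have sT := Jin Js.
  have [h e1 e2 _ _] := lin_sol_spec (cab sT) n00 q00.
  have [h' e1' e2' _ _] := lin_sol_spec (cab tT) n00 q00.
  have := linsys_perturb (cont2_row Js ca) (cont2_row Js cb) (cont2_row Jt ca) (cont2_row Jt cb)
    h h' (etrans e1' (esym e1)) (etrans e2' (esym e2)) h1 h2 (lin_sol_wronskian (cab tT)) xL.
  set X1 := gmap _ x; set X2 := gmap _ x.
  have c1 (f g : R -> R -> R) (u : R -> R -> R) : contw I (f t) -> contw I (g s) -> cont2 J I u ->
      contw I (fun y => f t y * g s y * (u s y - u t y)).
    move=> cf cg cu; apply: contwM; first exact: contwM.
    by apply: contwB; [exact: cont2_row Js cu|exact: cont2_row Jt cu].
  have cNs := cont2_row Js cN; have cqs := cont2_row Js cq.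
  have -> : X1 = - al' s.
    rewrite /al' opprB (@gmapB _ L) //; try exact: c1.
    by rewrite /X1; congr gmap; apply/funext => y; rewrite /solN /solq; ring.
  have -> : X2 = - be' s.
    rewrite /be' opprB (@gmapB _ L) //; try exact: c1.
    by rewrite /X2; congr gmap; apply/funext => y; rewrite /solN /solq; ring.
  rewrite -/(solN n0 q0 t x) -/(solN n0 q0 s x) -/(solq n0 q0 t x) -/(solq n0 q0 s x).
  rewrite -/(N1 t x) -/(N2 t x) -/(q1 t x) -/(q2 t x) => -[h3 h4].
  split; first by rewrite -[LHS](subrK (solN n0 q0 t x)) -opprB h3; ring.
  by rewrite -[LHS](subrK (solq n0 q0 t x)) -opprB h4; ring.
split.
  apply: (@hasD_eq _ J (fun s => solN n0 q0 t x + (N2 t x * al' s + N1 t x * be' s))) => //.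
    by move=> s Js; rewrite (E s Js).1.
  have := hasDD (hasD_cst J (solN n0 q0 t x) t) (hasDD (hasDZ (N2 t x) dal) (hasDZ (N1 t x) dbe)).
  by rewrite add0r.
apply: (@hasD_eq _ J (fun s => solq n0 q0 t x + (q2 t x * al' s + q1 t x * be' s))) => //.
  by move=> s Js; rewrite (E s Js).2.
have := hasDD (hasD_cst J (solq n0 q0 t x) t) (hasDD (hasDZ (q2 t x) dal) (hasDZ (q1 t x) dbe)).
by rewrite add0r.
Qed.

End TimeDerivative.

(** The time derivative of one solution involves both fundamental solutions, so the induction on [i]
    is over all initial data at once. *)
Lemma sol_reg i j : reg T L i j a -> reg T L i j b -> forall n0 q0, 0 <= n0 -> 0 <= q0 -> n0 + q0 = 1 ->
  reg T L i j (solN n0 q0) /\ reg T L i j (solq n0 q0).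
Proof.
elim: i => [|i IH] ra rb n0 q0 n00 q00 nq.
  by have [r1 r2] := sol_regX n00 q00 nq (reg_regX ra) (reg_regX rb).
have [r1 r2] := sol_regX n00 q00 nq (reg_regX ra) (reg_regX rb).
have ra' : reg T L i j a by exact: reg_le ra.
have rb' : reg T L i j b by exact: reg_le rb.
have IHs := IH ra' rb'.
have [_ [at_ da rat]] := ra; have [_ [bt db rbt]] := rb.
have [dN dq] := sol_partialT n00 q00 nq (reg_cont ra) (reg_cont rb) (reg_cont rat) (reg_cont rbt) da db.
have [rN rq] := IHs n0 q0 n00 q00 nq.
have [rN1 rq1] := IHs 0 1 (lexx 0) ler01 (add0r 1).
have [rN2 rq2] := IHs 1 0 ler01 (lexx 0) (addr0 1).
have rI u : reg T L i j u -> reg T L i j (fun t x => gmap (u t) x) by exact: reg_intX.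
have ral : reg T L i j (sol_al at_ bt n0 q0).
  by apply: reg_B; apply: rI; do 2 apply: reg_M => //.
have rbe : reg T L i j (sol_be at_ bt n0 q0).
  by apply: reg_B; apply: rI; do 2 apply: reg_M => //.
split; split => //.
  by exists (solNt at_ bt n0 q0) => //; apply: reg_D; exact: reg_M.
by exists (solqt at_ bt n0 q0) => //; apply: reg_D; exact: reg_M.
Qed.

Variables (nL nR : R).

Lemma nutrient_reg i j : reg T L i j a -> reg T L i j b ->
  reg T L i j (fun t x => nutrient_bvp (a t) (b t) nL nR x) /\
  reg T L i j (fun t x => nutrient_flux (a t) (b t) nL nR x).
Proof.
move=> ra rb.
have [rN1 rq1] := sol_reg ra rb (lexx 0) ler01 (add0r 1).
have [rN2 rq2] := sol_reg ra rb ler01 (lexx 0) (addr0 1).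
have IL : I L by exact: inI.
have s1 := reg_slice j IL rN1; have s2 := reg_slice j IL rN2.
have sV : reg T L i j (fun t _ => (N1 t L)^-1).
  apply: reg_V s1 => t x /Jin tT _; rewrite gt_eqF //.
  by apply: lt_le_trans (lin_sol_end (cab tT)); exact: mulr_gt0.
have cst z : reg T L i j (fun _ _ => z) by exact: reg_cst.
split; apply: reg_M => //; apply: reg_D; apply: reg_M => //; apply: reg_B; exact: reg_M.
Qed.

Lemma nutrient_partialX nL' nR' : 0 <= nL' -> 0 <= nR' -> partialX T L
  (fun t x => nutrient_bvp (a t) (b t) nL' nR' x)
  (fun t x => a t x * nutrient_flux (a t) (b t) nL' nR' x).
Proof.
move=> h1 h2 t x /Jin tT /Iin xL; have [h _ _ _] := nutrient_bvp_spec h1 h2 (cab tT).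
by have [] := h x xL.
Qed.

End InTime.
End FundamentalSolutions.


Section Intervals.
Variable R : realType.
Implicit Types (x y z d q : R).

Lemma itv_conv (i : interval R) x y z : [set` i] x -> [set` i] y ->
  Num.min x y <= z <= Num.max x y -> [set` i] z.
Proof.
move=> ix iy; have H := @interval_is_interval R i.
rewrite ge_min le_max => /andP[/orP[h1|h1] /orP[h2|h2]].
- by rewrite (_ : z = x) //; apply/le_anti/andP.
- by apply: (H x y ix iy); rewrite h1.
- by apply: (H y x iy ix); rewrite h1.
- by rewrite (_ : z = y) //; apply/le_anti/andP.
Qed.

Lemma right_acc (D : set R) x : (forall y, x <= y -> D y) ->
  forall d, 0 < d -> exists y, [/\ D y, y != x & `|y - x| < d].
Proof.
move=> Dx d d0; exists (x + d / 2); split.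
- by apply: Dx; lra.
- by rewrite gt_eqF //; lra.
- by rewrite addrAC subrr add0r gtr0_norm; lra.
Qed.

Lemma hasD_pos_derive1 (f : R -> R) q l : 0 < q -> hasD `]0, +oo[ f q l -> derive1 f q = l.
Proof.
move=> q0 hf; have /hasD_is_derive/(_ hf) df : nbhs q (`]0, +oo[%classic : set R).
  apply/nbhs_ballP; exists q => // y; rewrite /ball /= in_itv /= andbT => h.
  by move: h; rewrite ltr_norml => /andP[? ?]; lra.
by rewrite derive1E; exact: derive_val.
Qed.

End Intervals.

(** * Consequences of the admissibility of the energy *)

Section EnergyFacts.
Variables (R : realType) (k m : nat) (L : R) (W : R -> R -> R).
Hypothesis m0 : (0 < m)%N.
Hypothesis L0 : 0 < L.
Hypothesis E : admissible_energy k m L W.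
Local Notation I := (`[0, L]%classic : set R).
Local Notation J := (`]0, +oo[%classic : set R).
Implicit Types (x y z d q s : R).
Let inI x : 0 <= x <= L -> I x. Proof. by rewrite /= in_itv. Qed.
Let inJ x : 0 < x -> J x. Proof. by rewrite /= in_itv /= andbT. Qed.
Let Jin x : J x -> 0 < x. Proof. by rewrite /= in_itv /= andbT. Qed.
Let inIb x : 0 <= x <= L -> x \in `[0, L]. Proof. by rewrite in_itv. Qed.

Lemma dom_W_conv (i : 'I_2) x y z : dom_W L i x -> dom_W L i y ->
  Num.min x y <= z <= Num.max x y -> dom_W L i z.
Proof. by case: i => [[|[|//]] hi]; exact: itv_conv. Qed.

Lemma dom_W_acc (i : 'I_2) x : dom_W L i x ->
  forall d, 0 < d -> exists y, [/\ dom_W L i y, y != x & `|y - x| < d].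
Proof.
case: i => [[|[|//]] hi].
  by rewrite /dom_W /= in_itv /= => xL; exact: itv_acc.
move=> /Jin x0; apply: right_acc => y xy; apply: inJ; exact: lt_le_trans xy.
Qed.

Lemma energy_W_cont2 : cont2 I J W.
Proof. exact: (within_box_cont2 (energy_cont E)). Qed.

Lemma energy_w1_cont2 : cont2 I J (dpW W).
Proof. exact: (within_box_cont2 (energy_dp_cont E)). Qed.

Lemma energy_hasD X q : 0 <= X <= L -> 0 < q -> hasD J (W X) q (dpW W X q).
Proof.
move=> XL q0; have [h _] := energy_C1 E (inIb XL).
have [l hl] := derivable_in_hasD (h 0%N q (ltn0Sn 0) (inJ q0)).
by rewrite /dpW (hasD_pos_derive1 q0 hl).
Qed.

(** Written as a mixed partial because the smoothness assumption is stated in that form; on the open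
    half-line it agrees with [derive1]. *)
Definition dppW X q := mixed_partial (dom_W L) [:: 1] (uncurry2 (dpW W)) (row2 X q).

Let smooth1 : ([pred w | (size w <= k + m)%N] [:: (1 : 'I_2)]).
Proof. by rewrite /= (leq_trans m0) // leq_addl. Qed.

Lemma row2_eta (v : 'rV[R]_2) : row2 (v 0 0) (v 0 1) = v.
Proof. by apply/rowP => -[[|[|//]] hi]; rewrite mxE /=; congr (v 0 _); exact: val_inj. Qed.

Lemma energy_w2_cont2 : cont2 I J dppW.
Proof.
apply: (@within_box_cont2 _ (dom_W L)).
have := (energy_dp_smooth E).2 _ smooth1.
rewrite (_ : uncurry2 dppW = mixed_partial (dom_W L) [:: 1] (uncurry2 (dpW W))) //.
by apply/funext => v; rewrite -[in RHS](row2_eta v).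
Qed.

Lemma energy_w1_hasD X q : 0 <= X <= L -> 0 < q -> hasD J (dpW W X) q (dppW X q).
Proof.
move=> XL q0; have bx : box (dom_W L) (row2 X q) by apply: box_row2; [exact: inI|exact: inJ].
have := @partial_in_hasD _ _ (dom_W L) dom_W_acc (uncurry2 (dpW W)) 1 (row2 X q) q
  (fun v => (energy_dp_smooth E).1 1 [::] v smooth1) bx (inJ q0).
have sub y : subst_coord (row2 X q) 1 y = row2 X y.
  by apply/rowP => -[[|[|//]] hi]; rewrite !mxE.
rewrite sub (_ : (fun y => _) = dpW W X) //.
by apply/funext => y; rewrite sub uncurry2_row2.
Qed.

Lemma energy_w2_gt0 X q : 0 <= X <= L -> 0 < q -> 0 < dppW X q.
Proof.
move=> XL q0; rewrite -(hasD_pos_derive1 q0 (energy_w1_hasD XL q0)).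
exact: (energy_dpp_gt0 E (inIb XL)).
Qed.

Let sub_J x y : 0 < x -> `[x, y]%classic `<=` J.
Proof. by move=> x0 z; rewrite /= in_itv /= => /andP[xz _]; apply: inJ; exact: lt_le_trans xz. Qed.

(** [W X] vanishes at 1 and blows up at 0 with [theta], so the chord from a small [p] to 1 has a
    slope below any given [s]; the mean value theorem finds a stretch with that stress. *)
Lemma energy_w1_low X s : 0 <= X <= L -> exists2 q, 0 < q & dpW W X q <= s.
Proof.
move=> XL; have [theta [_ th0 _ hW]] := energy_growth E.
move/cvgryPge : th0 => /(_ (Num.max (- s) 0)) th.
have near01 : \forall p \near 0^'+, (p : R) < 1 by exact: nbhs_right_lt.
have near0 : \forall p \near 0^'+, 0 < (p : R) by exact: nbhs_right_gt.
have [p [[hp p1] p0]] := @filter_ex _ _ (at_right_proper_filter (0 : R)) _ (filterI (filterI th near01) near0).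
have [c /andP[pc c1]] := @mvt _ p 1 (W X) (dpW W X)
  (fun x h => hasD_sub (sub_J p0) (energy_hasD XL (lt_le_trans p0 (andP h).1))) (ltW p1).
rewrite (energy_natural E (inIb XL)) => h.
have wp := hW X p (inIb XL) p0.
move: hp; rewrite ge_max => /andP[h1 h2].
exists c; first exact: lt_le_trans pc.
nra.
Qed.

(** The chord from 1 to a large [p] has slope [W X p / (p - 1)], at least [theta p / p] when [s] is
    positive, which exceeds any given [s]. *)
Lemma energy_w1_high X s : 0 <= X <= L -> exists2 q, 0 < q & s <= dpW W X q.
Proof.
move=> XL; have [theta [_ _ th hW]] := energy_growth E.
move/cvgryPge : th => /(_ s) th.
have near1 : \forall p \near +oo, 1 < (p : R) by exact: nbhs_pinfty_gt.
have [p [hp p1]] := @filter_ex _ _ proper_pinfty_nbhs _ (filterI th near1).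
have p0 : 0 < p by lra.
have [c /andP[pc c1]] := @mvt _ 1 p (W X) (dpW W X)
  (fun x h => hasD_sub (sub_J ltr01) (energy_hasD XL (lt_le_trans ltr01 (andP h).1))) (ltW p1).
rewrite (energy_natural E (inIb XL)) subr0 => h.
have wp := hW X p (inIb XL) p0; have wp0 := energy_ge0 E (inIb XL) p0.
exists c; first exact: lt_le_trans pc.
have [s0|s0] := leP s 0; first by nra.
by move: hp; rewrite ler_pdivlMr // => hp; nra.
Qed.

Lemma energy_w1_le X q r : 0 <= X <= L -> 0 < q -> q <= r -> dpW W X q <= dpW W X r.
Proof. exact: (w1_le energy_w1_hasD energy_w2_gt0). Qed.

End EnergyFacts.

(** * The stress and nutrient operators *)

Section Operators.
Variables (R : realType) (k m : nat) (T L l0 : R) (W : R -> R -> R) (D0 beta0 : R -> R) (nL nR : R).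
Hypothesis m0 : (0 < m)%N.
Hypothesis T0 : 0 < T.
Hypothesis L0 : 0 < L.
Hypothesis l00 : 0 < l0.
Hypothesis E : admissible_energy k m L W.
Hypothesis A : admissible_nutrient k m L D0 beta0 nL nR.
Local Notation I := (`[0, L]%classic : set R).
Local Notation J := (`]0, +oo[%classic : set R).
Local Notation K := (`[0, T]%classic : set R).
Local Notation P := (pinv_stress (dpW W)).
Implicit Types (x y z d q s c C : R) (G H : R -> R).
Let inI x : 0 <= x <= L -> I x. Proof. by rewrite /= in_itv. Qed.
Let Iin x : I x -> 0 <= x <= L. Proof. by rewrite /= in_itv. Qed.
Let inK x : 0 <= x <= T -> K x. Proof. by rewrite /= in_itv. Qed.
Let Kin x : K x -> 0 <= x <= T. Proof. by rewrite /= in_itv. Qed.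
Let inIb x : 0 <= x <= L -> x \in `[0, L]. Proof. by rewrite in_itv. Qed.
Let cK : compact K := @segment_compact R 0 T.
Let cI : compact I := @segment_compact R 0 L.

Let w1c := energy_w1_cont2 E.
Let w2c := energy_w2_cont2 m0 E.
Let w1d := energy_w1_hasD m0 L0 E.
Let w2p := energy_w2_gt0 m0 L0 E.
Let w1l := energy_w1_low E.
Let w1h := energy_w1_high E.

Definition stress_op G : R := get [set s | total_length L (dpW W) G s = l0].

Lemma stress_op_spec G : contw I G -> (forall x, 0 <= x <= L -> 0 < G x) ->
  total_length L (dpW W) G (stress_op G) = l0.
Proof.
move=> cG G0; apply: (@getPex _ [set s | total_length L (dpW W) G s = l0]).
exact: (total_length_exists L0 w1c w2c w1d w2p w1l w1h l00).
Qed.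

Lemma stress_op_bounds c C : 0 < c -> c <= C ->
  exists a b, forall G, between L c C G -> a <= stress_op G <= b.
Proof.
move=> c0 cC; have [a [b hab]] := stress_bounds L0 w1c w2c w1d w2p w1l w1h l00 c0 cC.
exists a, b => G bG; apply: (hab G) => //.
by have [cG G0] := between_pos c0 bG; exact: stress_op_spec.
Qed.

Lemma stress_op_lipschitz c C : 0 < c -> c <= C ->
  exists2 k, 0 <= k & forall G H d, between L c C G -> between L c C H -> 0 <= d ->
    (forall x, 0 <= x <= L -> `|G x - H x| <= d) -> `|stress_op G - stress_op H| <= k * d.
Proof.
move=> c0 cC; have [k0 k00 hk] := stress_lipschitz L0 w1c w2c w1d w2p w1l w1h l00 c0 cC.
exists k0 => // G H d bG bH d0 hd; have [cG G0] := between_pos c0 bG; have [cH H0] := between_pos c0 bH.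
by apply: (hk G H) => //; exact: stress_op_spec.
Qed.

Lemma stretch_facts G : contw I G -> (forall x, 0 <= x <= L -> 0 < G x) ->
  let p x := P x (stress_op G) in [/\ contw I p, forall x, 0 <= x <= L -> 0 < p x,
   forall x, 0 <= x <= L -> dpW W x (p x) = stress_op G & gmap (fun x => p x * G x) L = l0].
Proof.
move=> cG G0 p; split.
- exact: (cont2_col (X := stress_op G) Logic.I (pinv_cont w1c w1d w2p w1l w1h)).
- by move=> x xL; exact: (pinv_gt0 w1c w1d w2p w1l w1h).
- by move=> x xL; exact: (pinvE w1c w1d w2p w1l w1h).
exact: stress_op_spec.
Qed.

Lemma stress_opE G : contw I G -> (forall x, 0 <= x <= L -> 0 < G x) ->
  stress L l0 W G = stress_op G.
Proof.
move=> cG G0; have [cp p0 ps pl] := stretch_facts cG G0.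
apply: (stressE L0 (energy_W_cont2 E) _ (energy_hasD E) (energy_w1_le m0 L0 E) _ cG G0 cp p0 ps pl).
  by move=> X q XL q0; exact: (energy_ge0 E (inIb XL)).
by move=> X XL; exact: (energy_convex E (inIb XL)).
Qed.

(** One order is lost, since the top weak derivative is merely bounded. Below the top the weak
    derivative has a continuous representative, of which [f] is a primitive. As m is positive, this
    puts the data in C^k. *)
Lemma Wjinfty_smoothX n j (f : R -> R) : (j < n)%N -> Wjinfty n 0 L f -> smoothX L j f.
Proof.
elim: n j f => [//|n IH] j f jn [_ [/contwP cf [g wg Wg]]].
case: j jn => [|j] jn; split => //.
have sg : smoothX L j g by exact: IH Wg.
have cg : contw I g by case: (j) sg => [|?] [].
exists g => // x Ix.
apply: (@hasD_eq _ I (fun x => f 0 + gmap g x)) => //.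
  by move=> y /Iin yL; rewrite [RHS](weak_deriv_gmap L0 cf (integrable_oo_contw cg) wg).
have := hasDD (hasD_cst I (f 0) x) (hasD_gmap cg (Iin Ix)).
by rewrite add0r.
Qed.

Lemma D0_smooth : smoothX L k D0.
Proof. by apply: Wjinfty_smoothX (nutrient_D_smooth A); rewrite -addn1 leq_add2l. Qed.

Lemma beta0_smooth : smoothX L k beta0.
Proof. by apply: Wjinfty_smoothX (nutrient_beta_smooth A); rewrite -addn1 leq_add2l. Qed.

Let cD0 : contw I D0. Proof. by case: (k) D0_smooth => [|?] []. Qed.
Let cbeta0 : contw I beta0. Proof. by case: (k) beta0_smooth => [|?] []. Qed.
Let D0_gt0 x : 0 <= x <= L -> 0 < D0 x.
Proof.
have [a [b [a0 b0 h]]] := nutrient_D_bounds A.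
by move=> xL; have /andP[h1 _] := h x (inIb xL); exact: lt_le_trans h1.
Qed.
Let beta0_gt0 x : 0 <= x <= L -> 0 < beta0 x.
Proof.
have [a [b [a0 b0 h]]] := nutrient_beta_bounds A.
by move=> xL; have /andP[h1 _] := h x (inIb xL); exact: lt_le_trans h1.
Qed.

Definition nutrient_op G x :=
  nutrient_bvp L (fun x => G x / D0 x) (fun x => beta0 x * G x) nL nR x.

Lemma coeff_between c C : 0 < c -> c <= C -> exists al be, [/\ 0 < al, al <= be &
  forall G, between L c C G -> coeff L al be (fun x => G x / D0 x) (fun x => beta0 x * G x)].
Proof.
move=> c0 cC; have [Dm [DM [Dm0 DM0 hD]]] := nutrient_D_bounds A.
have [bm [bM [bm0 bM0 hb]]] := nutrient_beta_bounds A.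
have C0 : 0 < C by exact: lt_le_trans cC.
exists (Num.min (c / DM) (bm * c)), (Num.max (C / Dm) (bM * C)).
have LL : 0 <= L <= L by rewrite lexx ltW.
split.
- by rewrite lt_min divr_gt0 ?mulr_gt0.
- rewrite ge_min !le_max; apply/orP; right; apply/orP; right.
  have /andP[h1 h2] := hb L (inIb LL).
  by apply: ler_pM => //; [exact: ltW|exact: ltW|exact: le_trans h2].
move=> G [cG hG]; split.
- by apply: contwM => //; apply: contwV => // x /Iin/D0_gt0; exact: lt0r_neq0.
- exact: contwM.
move=> x xL; have /andP[g1 g2] := hG x xL.
have /andP[d1 d2] := hD x (inIb xL); have /andP[b1 b2] := hb x (inIb xL).
have G0 : 0 < G x by exact: lt_le_trans g1.
have x0 := D0_gt0 xL; have y0 := beta0_gt0 xL.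
split; rewrite ge_min le_max; apply/andP; split.
- apply/orP; left; apply: ler_pM => //; [exact: ltW|by rewrite invr_ge0 ltW|].
  by rewrite lef_pV2 ?posrE.
- apply/orP; left; apply: ler_pM => //; [exact: ltW|by rewrite invr_ge0 ltW|].
  by rewrite lef_pV2 ?posrE.
- by apply/orP; right; apply: ler_pM => //; exact: ltW.
by apply/orP; right; apply: ler_pM => //; exact: ltW.
Qed.

Lemma pos_between G : contw I G -> (forall x, 0 <= x <= L -> 0 < G x) ->
  exists c C, [/\ 0 < c, c <= C & between L c C G].
Proof.
move=> cG G0; have [M M0 hM] := compact_bound cI cG.
have [c c0 hc] := compact_pos_bound cI cG (fun x Ix => G0 x (Iin Ix)).
have B x : I x -> c <= G x <= M.
  by move=> Ix; rewrite hc //; have := hM x Ix; rewrite ler_norml => /andP[].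
have I0 : I 0 by apply: inI; rewrite lexx ltW.
exists c, M; split => //; first by have /andP[h1 h2] := B 0 I0; exact: le_trans h2.
Qed.

Lemma nutrient_op_bounds G : contw I G -> (forall x, 0 <= x <= L -> 0 < G x) ->
  contw I (nutrient_op G) /\ forall x, 0 <= x <= L -> 0 <= nutrient_op G x <= nL + nR.
Proof.
move=> cG G0; have [c [C [c0 cC bG]]] := pos_between cG G0.
have [al [be [al0 albe hab]]] := coeff_between c0 cC.
have [h _ _ hb] := nutrient_bvp_spec L0 al0 (nutrient_left_ge0 A) (nutrient_right_ge0 A) (hab G bG).
by split => //; have [] := linsys_contw h.
Qed.

Lemma nutrient_opE G x : contw I G -> (forall x, 0 <= x <= L -> 0 < G x) -> 0 <= x <= L ->
  nutrient L l0 W D0 beta0 nL nR G x = nutrient_op G x.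
Proof.
move=> cG G0 xL; have [c [C [c0 cC bG]]] := pos_between cG G0.
have [al [be [al0 albe hab]]] := coeff_between c0 cC.
have [h N0 NL _] := nutrient_bvp_spec L0 al0 (nutrient_left_ge0 A) (nutrient_right_ge0 A) (hab G bG).
have [cp p0 ps pl] := stretch_facts cG G0.
apply: (nutrientE L0 l00 (energy_W_cont2 E) _ (energy_hasD E) (energy_w1_le m0 L0 E) _ cG G0 cp p0 ps pl cD0 _ cbeta0 _ h N0 NL xL) => //.
  by move=> X q XL q0; exact: (energy_ge0 E (inIb XL)).
by move=> X XL; exact: (energy_convex E (inIb XL)).
Qed.

Lemma nutrient_op_lipschitz c C : 0 < c -> c <= C ->
  exists2 k, 0 <= k & forall G H d, between L c C G -> between L c C H -> 0 <= d ->
    (forall x, 0 <= x <= L -> `|G x - H x| <= d) ->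
    forall x, 0 <= x <= L -> `|nutrient_op G x - nutrient_op H x| <= k * d.
Proof.
move=> c0 cC; have [al [be [al0 albe hab]]] := coeff_between c0 cC.
have [k0 k00 hk] := nutrient_bvp_lipschitz L0 al0 albe (nutrient_left_ge0 A) (nutrient_right_ge0 A).
have [Dm [DM [Dm0 DM0 hD]]] := nutrient_D_bounds A.
have [bm [bM [bm0 bM0 hb]]] := nutrient_beta_bounds A.
have M0 : 0 <= Dm^-1 + bM by rewrite addr_ge0 ?invr_ge0 ?ltW.
exists (k0 * (Dm^-1 + bM)); first exact: mulr_ge0.
move=> G H d bG bH d0 hd x xL; rewrite -mulrA.
apply: (hk _ _ _ _ _ (hab H bH) (hab G bG)) => //; first exact: mulr_ge0.
move=> y yL; have dy := hd y yL.
have /andP[d1 d2] := hD y (inIb yL); have /andP[b1 b2] := hb y (inIb yL).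
have x0 := D0_gt0 yL; have y0 := beta0_gt0 yL.
split.
  rewrite -mulrBl normrM mulrC; apply: ler_pM => //.
  rewrite (ger0_norm (ltW _)) ?invr_gt0 // -[leLHS]addr0 lerD ?(ltW bM0) //.
  by rewrite lef_pV2 ?posrE.
rewrite -mulrBr normrM; apply: ler_pM => //.
by rewrite (gtr0_norm y0) -[leLHS]add0r lerD // invr_ge0 ltW.
Qed.

Section InTime.
Variable G : R -> R -> R.
Hypothesis G0 : forall t x, 0 <= t <= T -> 0 <= x <= L -> 0 < G t x.

Lemma between_in_time : cont2 K I G -> exists c C, [/\ 0 < c, c <= C &
  forall t, 0 <= t <= T -> between L c C (G t)].
Proof.
move=> cG; have [M M0 hM] := cont2_bound cK cI cG.
have Gp (z : R * R) : (K `*` I) z -> 0 < G z.1 z.2 by move=> [/Kin h1 /Iin h2]; exact: G0.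
have [c c0 hc] := compact_pos_bound (compact_setX cK cI) cG Gp.
have B t x : K t -> I x -> c <= G t x <= M.
  move=> Kt Ix; rewrite (hc (t, x)) //; have := hM t x Kt Ix; rewrite ler_norml => /andP[] //.
have I0 : I 0 by apply: inI; rewrite lexx ltW.
have K0 : K 0 by apply: inK; rewrite lexx ltW.
exists c, M; split => //; first by have /andP[h1 h2] := B 0 0 K0 I0; exact: le_trans h2.
by move=> t /inK Kt; split; [exact: cont2_row Kt cG|move=> x /inI; exact: B].
Qed.

Lemma stress_op_contw : cont2 K I G -> contw K (fun t => stress_op (G t)).
Proof.
move=> cG; have [c [C [c0 cC bG]]] := between_in_time cG.
have [k0 k00 hk] := stress_op_lipschitz c0 cC.
move=> t Kt; apply/(limwP K) => e e0.
have e'0 : 0 < e / (k0 + 1) by rewrite divr_gt0 //; lra.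
have [d d0 hd] := cont2_unif cK cI cG e'0.
exists d => // s Ks; rewrite /ball /= distrC => st.
apply: (@le_trans _ _ (k0 * (e / (k0 + 1)))).
  apply: hk; [exact/bG/Kin|exact/bG/Kin|exact: ltW|].
  by move=> x /inI Ix; apply: hd => //; rewrite subrr normr0.
by rewrite mulrA ler_pdivrMr ?mulrDr; nra.
Qed.

Let pi t x := P x (stress_op (G t)).

(** Only the second argument of [dppW] moves in time, and spatial order 0 is asked for: the word of
    length 1 followed by at most [m - 1] further letters stays within the smoothness of the
    energy. *)
Lemma dppW_reg i (p : R -> R -> R) : (i < m)%N ->
  (forall t x, 0 <= t <= T -> 0 <= x <= L -> 0 < p t x) ->
  reg T L i 0 p -> reg T L i 0 (fun t x => dppW L W x (p t x)).
Proof.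
move=> im p0 rp.
pose U (a : 'I_2) : R -> R -> R := if a == 0 then (fun _ x => x) else p.
have U1 a : a != 0 -> U a = p by rewrite /U => /negPf ->.
apply: (@reg_eq _ T L i 0 (fun t x => mixed_partial (dom_W L) [:: 1] (uncurry2 (dpW W)) (row_at U t x))).
  move=> t x Kt Ix; congr mixed_partial; apply/rowP => a; rewrite !mxE.
  by case: a => [[|[|//]] ha].
apply: (@reg_comp R T L 2 (dom_W L) (@dom_W_conv _ L) (dom_W_acc L0)
  [pred w | (size w <= k + m)%N] (uncurry2 (dpW W)) [:: 1] [:: 0; 1] U
  (fun i j w => (size w + i + j <= k + m)%N) (energy_dp_smooth E)) => //.
- by move=> i' j w /=; lia.
- by move=> i' j w a /=; lia.
- by move=> i' j w a /=; lia.
- by move=> i' j w; lia.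
- by move=> a t s x; rewrite inE /U => a1 _ _ _; case: a a1 => [[|[|//]] ha].
- by move=> a t x y; case: a => [[|[|//]] ha].
- move=> a t x Kt Ix; case: a => [[|[|//]] ha]; rewrite /U /=; first exact: Ix.
  by rewrite /dom_W /= in_itv /= andbT p0 ?Kin ?Iin.
- by rewrite addn0 add1n; apply: leq_trans (leq_addl _ _).
move=> a; rewrite /U; case: eqP => _ //.
by apply: (@reg_snd _ T L i 0 (fun x => x)); exact: smoothX_id.
Qed.

(** The stress sees the growth through integrals in [X], so spatial order 0 is enough. Order [i] of
    the stress and of the stretch makes the quotient in [stress_hasD] regular of order [i], which is
    order [i + 1] of the stress and then, by the chain rule, of the stretch. *)
Lemma stress_op_reg i : (i <= m)%N -> reg T L i 0 G ->
  reg T L i 0 (fun t _ => stress_op (G t)) /\ reg T L i 0 pi.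
Proof.
have cS := stress_op_contw.
have Kb (t : R) : K t -> `[0, T]%classic t by [].
have cpi : cont2 K I G -> cont2 K I pi.
  by move=> cG; exact: (stretch_cont2 w1c w1d w2p w1l w1h (cS cG)).
elim: i => [|i IH] im rG.
  have cG := reg_cont rG.
  by split; split => //; split => //; [exact: cont2_fst (cS cG)|exact: cpi].
have [rS rpi] : reg T L i 0 (fun t _ => stress_op (G t)) /\ reg T L i 0 pi.
  by apply: IH; [exact: ltnW|exact: reg_le rG].
have cG := reg_cont rG; have [_ [Gt dG rGt']] := rG; have rGt : reg T L i 0 Gt := rGt'; have cGt := reg_cont rGt.
have pi0 t x : 0 <= t <= T -> 0 <= x <= L -> 0 < pi t x.
  by move=> _ xL; exact: (pinv_gt0 w1c w1d w2p w1l w1h).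
have rw2 := dppW_reg im pi0 rpi.
have w20 t x : K t -> I x -> dppW L W x (pi t x) != 0.
  by move=> Kt Ix; apply: lt0r_neq0; apply: w2p; [exact: Iin|apply: pi0; [exact: Kin|exact: Iin]].
have rw2V := reg_V w20 rw2.
have IL : I L by apply: inI; rewrite lexx ltW.
pose num t := gmap (fun x => Gt t x * pi t x) L.
pose den t := gmap (fun x => G t x / dppW L W x (pi t x)) L.
have rG' : reg T L i 0 G by exact: reg_le rG.
have rnum : reg T L i 0 (fun t _ => num t).
  by apply: (reg_slice 0 IL (u := intX (fun t x => Gt t x * pi t x))); apply: reg_intX; exact: (reg_M rGt rpi).
have rden : reg T L i 0 (fun t _ => den t).
  by apply: (reg_slice 0 IL (u := intX (fun t x => G t x / dppW L W x (pi t x)))); apply: reg_intX; exact: (reg_M rG' rw2V).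
have den0 t : K t -> 0 < den t.
  move=> Kt; have ck : contw I (fun x => G t x / dppW L W x (pi t x)).
    exact: (cont2_row Kt (reg_cont (reg_M rG' rw2V))).
  have Kt' := Kin Kt.
  have [a a0 ha] := compact_pos_bound cI ck (fun x Ix => divr_gt0 (G0 Kt' (Iin Ix)) (w2p (Iin Ix) (pi0 t x Kt' (Iin Ix)))).
  apply: (@lt_le_trans _ _ (a * L)); first exact: mulr_gt0.
  by apply: (gmap_ge ck) => [x /inI|]; [exact: ha|exact: Iin].
have rSt : reg T L i 0 (fun t _ => - num t / den t).
  apply: reg_M; first exact: reg_N.
  by apply: reg_V rden => t x Kt _; rewrite gt_eqF // den0.
have dS t : 0 <= t <= T -> hasD K (fun t => stress_op (G t)) t (- num t / den t).
  apply: (stress_hasD L0 w1c w2c w1d w2p w1l w1h cG cGt G0) => //.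
  - exact: cS.
  by move=> s /[dup] sT /inK Ks; apply: stress_op_spec => [|x xL]; [exact: cont2_row Ks cG|exact: G0].
split; split.
- exact: reg_regX rS.
- by exists (fun t _ => - num t / den t) => // t x /Kin tT _; exact: dS.
- exact: reg_regX rpi.
exists (fun t x => - num t / den t * (dppW L W x (pi t x))^-1); last exact: reg_M.
by move=> t x /Kin tT /Iin xL; exact: (stretch_hasD w1c w1d w2p w1l w1h tT xL (dS t tT)).
Qed.

Lemma stress_op_reg_any i j : (i <= m)%N -> reg T L i 0 G -> reg T L i j (fun t _ => stress_op (G t)).
Proof.
move=> im rG; have I0 : I 0 by apply: inI; rewrite lexx ltW.
exact: (reg_slice j I0 (stress_op_reg im rG).1).
Qed.

Let GD_reg i j : (j <= k)%N -> reg T L i j G ->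
  reg T L i j (fun t x => G t x / D0 x) /\ reg T L i j (fun t x => beta0 x * G t x).
Proof.
move=> jk rG.
have rX n f : smoothX L n f -> forall n', (n' <= n)%N -> reg T L i n' (fun _ x => f x).
  by move=> sf n' n'n; apply: reg_le (reg_snd T i sf).
split; apply: reg_M => //; last exact: rX beta0_smooth _ jk.
apply: (@reg_V _ T L i j (fun _ x => D0 x)); last exact: rX D0_smooth _ jk.
by move=> t x _ /Iin/D0_gt0; exact: lt0r_neq0.
Qed.

Lemma nutrient_op_reg i j : (j <= k)%N -> reg T L i j G ->
  reg T L i j (fun t x => nutrient_op (G t) x).
Proof.
move=> jk rG; have [c [C [c0 cC bG]]] := between_in_time (reg_cont rG).
have [al [be [al0 albe hab]]] := coeff_between c0 cC.
have [ra rb] := GD_reg jk rG.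
exact: (nutrient_reg L0 al0 albe (fun t tT => hab _ (bG t tT)) nL nR ra rb).1.
Qed.

(** The gain of one derivative in [X]: by the first equation of the system the X-derivative of the
    concentration is [(G / D0) q], as regular as [G] itself. *)
Lemma nutrient_op_partialX j : (j <= k)%N -> regX T L j G ->
  exists2 Nx, partialX T L (fun t x => nutrient_op (G t) x) Nx & regX T L j Nx.
Proof.
move=> jk rG; have rG' : reg T L 0 j G by [].
have [c [C [c0 cC bG]]] := between_in_time (reg_cont rG').
have [al [be [al0 albe hab]]] := coeff_between c0 cC.
have [ra rb] := GD_reg jk rG'.
have cab t tT := hab _ (bG t tT).
have [_ rq] := nutrient_reg L0 al0 albe cab nL nR ra rb.
exists (fun t x => G t x / D0 x * nutrient_flux L (fun x => G t x / D0 x) (fun x => beta0 x * G t x) nL nR x).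
  by apply: (nutrient_partialX L0 al0 cab (nutrient_left_ge0 A) (nutrient_right_ge0 A)).
by apply: (@regX_M _ T L _ (fun t x => G t x / D0 x)); [exact: reg_regX ra|exact: reg_regX rq].
Qed.

End InTime.
End Operators.

(** * The growth equation *)

Section ScalarComparison.
Variables (R : realType) (T : R) (f f' : R -> R).
Hypothesis T0 : 0 < T.
Local Notation J := (`[0, T]%classic : set R).
Implicit Types (x y t s d e : R).

(* At the last time [s] before [t] with [f s >= 0] the function would have to be decreasing. *)
Lemma nonneg_of_repelling : (forall t, 0 <= t <= T -> hasD J f t (f' t)) ->
  0 <= f 0 -> (forall t, 0 <= t <= T -> f t = 0 -> 0 < f' t) ->
  forall t, 0 <= t <= T -> 0 <= f t.
Proof.
move=> df f00 rep t /andP[t0 tT]; rewrite leNgt; apply/negP => ft.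
pose A := [set s | 0 <= s <= t /\ 0 <= f s].
have A0 : A 0 by split => //; rewrite lexx t0.
have Aub : ubound A t by move=> s [/andP[]].
have supA : has_sup A by split; [exists 0|exists t].
set s := sup A.
have st : s <= t by apply: ge_sup => //; exists 0.
have s0 : 0 <= s by apply: ub_le_sup => //; exists t.
have sT : 0 <= s <= T by rewrite s0 (le_trans st).
have cf := hasD_cont (df s sT).
have inJ r : 0 <= r <= t -> J r by rewrite /= in_itv /= => /andP[-> rt]; rewrite (le_trans rt).
have fs : 0 <= f s.
  rewrite leNgt; apply/negP => fs; have e0 : 0 < - f s / 2 by lra.
  have [d d0 hd] := (limwP _ _ _ _).1 cf _ e0.
  have [r Ar rs] := sup_adherent d0 supA.
  have [rt fr] := Ar; have rs' : r <= s by apply: ub_le_sup => //; exists t.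
  have := hd r (inJ r rt); rewrite /ball /= ger0_norm ?subr_ge0 // -/s in rs *.
  by move=> /(_ ltac:(lra)); rewrite ler_norml => /andP[_ ?]; lra.
have st' : s < t by rewrite lt_neqAle st andbT; apply: contraTneq fs => ->; rewrite -ltNge.
suff [r [sr rt fr]] : exists r, [/\ s < r, r <= t & 0 <= f r].
  have : r <= s by apply: ub_le_sup; [exists t|split => //; rewrite rt (le_trans s0) // ltW].
  by rewrite leNgt sr.
have [e [e0 he]] : exists e, 0 < e /\ forall r, s < r -> r <= t -> r < s + e -> 0 <= f r.
  move: fs; rewrite le_eqVlt => /orP[/eqP fs|fs].
    have p : 0 < f' s / 2 by rewrite divr_gt0 // rep.
    have [d d0 hd] := (hasDe _ _ _ _).1 (df s sT) _ p.
    exists d; split => // r sr rt rd.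
    have := hd r (inJ r _); rewrite gtr0_norm ?subr_gt0 // -fs subr0.
    move=> /(_ ltac:(by rewrite rt (le_trans s0) // ltW) ltac:(lra)).
    by rewrite ler_norml => /andP[h _]; nra.
  have p : 0 < f s / 2 by lra.
  have [d d0 hd] := (limwP _ _ _ _).1 cf _ p.
  exists d; split => // r sr rt rd.
  have := hd r (inJ r _); rewrite /ball /= ltr0_norm ?subr_lt0 //.
  move=> /(_ ltac:(by rewrite rt (le_trans s0) // ltW) ltac:(lra)).
  by rewrite ler_norml => /andP[h _]; lra.
have [h|h] := leP t (s + e / 2).
  by exists t; split => //; apply: he => //; lra.
by exists (s + e / 2); split; [lra|exact: ltW|apply: he; lra].
Qed.

End ScalarComparison.

Lemma contw_unif_limit (R : realType) (U : pseudoMetricType R) (A : set U) (u : U -> R) :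
  (forall e, 0 < e -> exists2 v, contw A v & forall z, A z -> `|v z - u z| <= e) -> contw A u.
Proof.
move=> h z Az; apply/limwP => e e0; have e30 : 0 < e / 3 by lra.
have [v cv hv] := h _ e30; have /limwP/(_ _ e30)[d d0 hd] := cv z Az.
exists d => // y Ay zy; have h1 := hv y Ay; have h2 := hv z Az; have h3 := hd y Ay zy.
move: h1 h2 h3; rewrite !ler_norml => /andP[? ?] /andP[? ?] /andP[? ?].
by apply/andP; split; lra.
Qed.

(** * The growth law and its barriers *)

Section GrowthLawFacts.
Variables (R : realType) (k m : nat) (T L : R) (calG : R -> R -> R -> R -> R).
Hypothesis m0 : (0 < m)%N.
Hypothesis L0 : 0 < L.
Hypothesis T0 : 0 < T.
Hypothesis A : admissible_growth_law k m T L calG.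
Local Notation I := (`[0, L]%classic : set R).
Local Notation J := (`[0, T]%classic : set R).
Implicit Types (x y z t s d g n : R) (w : seq 'I_4).
Let inI x : 0 <= x <= L -> I x. Proof. by rewrite /= in_itv. Qed.

Lemma dom_G_conv (i : 'I_4) x y z : dom_G L i x -> dom_G L i y ->
  Num.min x y <= z <= Num.max x y -> dom_G L i z.
Proof. by case: i => [[|[|[|[|//]]]] hi] //; exact: itv_conv. Qed.

Lemma dom_G_acc (i : 'I_4) x : dom_G L i x ->
  forall d, 0 < d -> exists y, [/\ dom_G L i y, y != x & `|y - x| < d].
Proof.
case: i => [[|[|[|[|//]]]] hi]; rewrite /dom_G /=.
- rewrite in_itv /= andbT => x0; apply: right_acc => y xy.
  by rewrite /= in_itv /= andbT (lt_le_trans x0).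
- by move=> _; exact: right_acc.
- rewrite in_itv /= andbT => x0; apply: right_acc => y xy.
  by rewrite /= in_itv /= andbT (le_trans x0).
by rewrite in_itv /= => xL; exact: itv_acc.
Qed.

Lemma box_row4 g s n x : 0 < g -> 0 <= n -> 0 <= x <= L -> box (dom_G L) (row4 g s n x).
Proof.
move=> g0 n0 xL i; rewrite mxE; case: i => [[|[|[|[|//]]]] hi] //=.
all: by rewrite /dom_G /= in_itv /= ?andbT.
Qed.

Lemma uncurry4_row4 g s n x : uncurry4 calG (row4 g s n x) = calG g s n x.
Proof. by rewrite /uncurry4 !mxE. Qed.

(* [fits i j w]: the derivative along [w] can be differentiated [i] more times
   in [t] and [j] more times in [X], each time producing one letter. *)
Definition fits i j w := [&& (count_mem vG w + count_mem vN w + i + j <= (k + m).-1)%N,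
  (count_mem vS w + i <= m.-1)%N & (count_mem vX w + j <= k)%N].

Definition calG_partial w g s n x := mixed_partial (dom_G L) w (uncurry4 calG) (row4 g s n x).

Definition growth_args (G : R -> R -> R) (S : R -> R) (N : R -> R -> R) (a : 'I_4) : R -> R -> R :=
  nth (fun _ x => x) [:: G; (fun t _ => S t); N] a.

Lemma row_at_growth_args G S N t x : row_at (growth_args G S N) t x = row4 (G t x) (S t) (N t x) x.
Proof. by apply/rowP => -[[|[|[|[|//]]]] hi]; rewrite !mxE. Qed.

Lemma calG_partial_reg i j w G S N : fits i j w ->
  (forall t x, J t -> I x -> 0 < G t x) -> (forall t x, J t -> I x -> 0 <= N t x) ->
  reg T L i j G -> reg T L i j (fun t _ => S t) -> reg T L i j N ->
  reg T L i j (fun t x => calG_partial w (G t x) (S t) (N t x) x).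
Proof.
move=> fw G0 N0 rG rS rN.
apply: (@reg_eq _ T L i j (fun t x => mixed_partial (dom_G L) w (uncurry4 calG) (row_at (growth_args G S N) t x))).
  by move=> t x Jt Ix; rewrite row_at_growth_args.
apply: (@reg_comp R T L 4 (dom_G L) dom_G_conv dom_G_acc
  (orders_cont k m) (uncurry4 calG) [:: vG; vS; vN] [:: vG; vN; vX] (growth_args G S N)
  fits (growth_partials A)) => //.
- move=> i' j' v /and3P[h1 h2 h3]; apply/and3P; split.
  + by rewrite -addnA in h1; exact: leq_trans (leq_addr _ _) h1.
  + exact: leq_trans (leq_addr _ _) h2.
  + exact: leq_trans (leq_addr _ _) h3.
- move=> i' j' v a /and3P[h1 h2 h3]; rewrite !inE => /or3P[] /eqP ->; apply/and3P; rewrite /=;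
  move: (count_mem vG v) (count_mem vN v) (count_mem vS v) (count_mem vX v) h1 h2 h3 => ? ? ? ? h1 h2 h3;
  by split; lia.
- move=> i' j' v a /and3P[h1 h2 h3]; rewrite !inE => /or3P[] /eqP ->; apply/and3P; rewrite /=;
  move: (count_mem vG v) (count_mem vN v) (count_mem vS v) (count_mem vX v) h1 h2 h3 => ? ? ? ? h1 h2 h3;
  by split; lia.
- move=> i' j' v /and3P[h1 h2 h3]; apply/and3P.
  move: (count_mem vG v) (count_mem vN v) (count_mem vS v) (count_mem vX v) h1 h2 h3 => ? ? ? ? h1 h2 h3.
  by split; lia.
- by move=> a t s x; case: a => [[|[|[|[|//]]]] ha].
- by move=> a t x y; case: a => [[|[|[|[|//]]]] ha].
- move=> a t x Jt Ix; case: a => [[|[|[|[|//]]]] ha] //.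
    by rewrite /dom_G /growth_args /= in_itv /= andbT G0.
  by rewrite /dom_G /growth_args /= in_itv /= andbT N0.
move=> a; case: a => [[|[|[|[|//]]]] ha] //.
by apply: (@reg_snd _ T L i j (fun x => x)); exact: smoothX_id.
Qed.

Lemma calG_cont2 G S N : cont2 J I G -> contw J S -> cont2 J I N ->
  (forall t x, J t -> I x -> 0 < G t x) -> (forall t x, J t -> I x -> 0 <= N t x) ->
  cont2 J I (fun t x => calG (G t x) (S t) (N t x) x).
Proof.
move=> cG cS cN G0 N0.
have r0 u : cont2 J I u -> reg T L 0 0 u by [].
have f0 : fits 0 0 [::] by [].
have := reg_cont (calG_partial_reg f0 G0 N0 (r0 _ cG) (r0 _ (cont2_fst cS)) (r0 _ cN)).
by apply: cont2_eq => t x Jt Ix; rewrite /calG_partial /= uncurry4_row4.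
Qed.

Lemma calG_lipschitz c C a b M : 0 < c -> c <= C -> a <= b -> 0 <= M ->
  exists2 K, 0 <= K & forall x g s n g' s' n', 0 <= x <= L ->
    c <= g <= C -> a <= s <= b -> 0 <= n <= M -> c <= g' <= C -> a <= s' <= b -> 0 <= n' <= M ->
    `|calG g s n x - calG g' s' n' x| <= K * (`|g - g'| + `|s - s'| + `|n - n'|).
Proof.
move=> c0 cC ab M0.
(* The Lipschitz assumption asks for nondegenerate intervals, so each upper end is raised by 1. *)
have [||||K hK] := @growth_lip _ _ _ _ _ _ A c (C + 1) a (b + 1) 0 (M + 1) [::]; rewrite ?lexx //=.
- by rewrite c0 /=; lra.
- by lra.
- by lra.
exists `|K| => // x g s n g' s' n' xL gc sa nM gc' sa' nM'.
have [|||||||_] := hK x g s n g' s' n'; rewrite ?in_itv //=.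
- by move: gc => /andP[-> ?] /=; lra.
- by move: sa => /andP[-> ?] /=; lra.
- by move: nM => /andP[-> ?] /=; lra.
- by move: gc' => /andP[-> ?] /=; lra.
- by move: sa' => /andP[-> ?] /=; lra.
- by move: nM' => /andP[-> ?] /=; lra.
rewrite !uncurry4_row4 => /le_trans; apply; apply: ler_wpM2r; last exact: ler_norm.
by rewrite !addr_ge0.
Qed.

Lemma bounded_on_ex (f : R -> R) (B : set R) : [bounded f X | X in B] ->
  exists M, forall x, B x -> `|f x| <= M.
Proof.
move=> [M0 [_ h]]; exists (M0 + 1) => x Bx; apply: h Bx.
by rewrite ltrDl.
Qed.

Lemma barrier_hasD h u : locally_lipschitz_op L h -> barrier_solution T L h u ->
  forall t x, 0 <= t <= T -> 0 <= x <= L -> hasD J (u^~ x) t (h (u t x) x).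
Proof.
move=> [hop _] [_ up ud _] t x tT xL.
have tb : t \in `[0, T] by rewrite in_itv.
apply/hasD_ratio; apply/cvgrPdist_le => e e0.
have /cvgrPdist_le/(_ e e0) := ud t tb.
rewrite !near_withinE; apply: filterS => s hs st Js.
have := hs st Js; rewrite sub0r normrN distrC => /(le_trans _); apply.
apply: (le_trans _ (ler_norm _)).
apply: (sup_norm_ub (f := fun X => (u s X - u t X) / (s - t) - pointwise_op h (u t) X)); last exact: inI.
have sb : s \in `[0, T] by [].
have [[_ /bounded_on_ex[M1 h1]] _] := up s sb.
have [[_ /bounded_on_ex[M2 h2]] _] := up t tb.
have [_ /bounded_on_ex[M3 h3]] := hop _ (up t tb).
exists ((M1 + M2) * `|(s - t)^-1| + M3) => y Iy.
apply: (le_trans (ler_normB _ _)); apply: lerD; last exact: h3.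
rewrite normrM ler_wpM2r //; apply: (le_trans (ler_normB _ _)).
by apply: lerD; [exact: h1|exact: h2].
Qed.

Lemma barrier_bounds : exists G0 G1 u0 u1 c C, [/\ 0 < c, c <= C,
  forall t x, 0 <= t <= T -> 0 <= x <= L -> c <= u0 t x /\ u1 t x <= C,
  forall t x, 0 <= t <= T -> 0 <= x <= L -> [/\ u0 t x <= u1 t x,
    hasD J (u0^~ x) t (G0 (u0 t x) x) & hasD J (u1^~ x) t (G1 (u1 t x) x)] &
  (forall x, 0 <= x <= L -> u0 0 x = 1 /\ u1 0 x = 1) /\
  forall g s n x, 0 < g -> 0 <= n -> 0 <= x <= L -> G0 g x < calG g s n x < G1 g x].
Proof.
have [G0 [G1 [_ [op0 op1] [u0 [u1 [b0 b1 lt01 hinf hsup]]] hG]]] := growth_barriers A.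
have b00 x : 0 <= x <= L -> u0 0 x = 1 by move=> xL; case: b0 => _ _ _ -> //; rewrite in_itv.
have b10 x : 0 <= x <= L -> u1 0 x = 1 by move=> xL; case: b1 => _ _ _ -> //; rewrite in_itv.
have le01 t x : 0 <= t <= T -> 0 <= x <= L -> u0 t x <= u1 t x.
  move=> /andP[]; rewrite le_eqVlt => /orP[/eqP <- _ xL|t0 tT xL]; first by rewrite b00 ?b10.
  by apply/ltW/lt01; rewrite in_itv /= ?t0.
have I0 : (0 : R) <= 0 <= L by apply/andP; split => //; exact: ltW.
have J0 : (0 : R) <= 0 <= T by apply/andP; split => //; exact: ltW.
have lb t x : 0 <= t <= T -> 0 <= x <= L ->
    (ereal_inf [set (u0 z.1 z.2)%:E | z in `[0%R, T] `*` `[0%R, L]] <= (u0 t x)%:E)%E.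
  by move=> tT xL; apply: ereal_inf_lbound; exists (t, x) => //; split; rewrite /= in_itv.
have ub t x : 0 <= t <= T -> 0 <= x <= L ->
    ((u1 t x)%:E <= ereal_sup [set (u1 z.1 z.2)%:E | z in `[0%R, T] `*` `[0%R, L]])%E.
  by move=> tT xL; apply: ereal_sup_ubound; exists (t, x) => //; split; rewrite /= in_itv.
(* The infimum is finite because it is positive and at most the value at (0, 0); the supremum is
   treated in the same way. *)
move: hinf lb; set e := ereal_inf _; case: e => [c| |] // c0 lb; last first.
  by have := lb 0 0 J0 I0; rewrite leye_eq.
move: hsup ub; set e := ereal_sup _; case: e => [C| |] // C0 ub; last first.
  by have := ub 0 0 J0 I0; rewrite leeNy_eq.
exists G0, G1, u0, u1, c, C; split => //.
- have := lb 0 0 J0 I0; have := ub 0 0 J0 I0; rewrite !lee_fin => h1 h2.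
  by apply: (le_trans h2); apply: le_trans h1; exact: le01.
- by move=> t x tT xL; split; rewrite -lee_fin; [exact: lb|exact: ub].
- move=> t x tT xL; split; first exact: le01.
    exact: barrier_hasD.
  exact: barrier_hasD.
split; first by move=> x xL; rewrite b00 ?b10.
by move=> g s n x g0 n0 xL; apply: hG => //; rewrite in_itv.
Qed.

End GrowthLawFacts.


(** * Differentiability of the solution in X *)

Section SpaceDerivative.
Variables (R : realType) (k m : nat) (T L c C : R) (calG : R -> R -> R -> R -> R).
Hypothesis m0 : (0 < m)%N.
Hypothesis k0 : (0 < k)%N.
Hypothesis L0 : 0 < L.
Hypothesis T0 : 0 < T.
Hypothesis A : admissible_growth_law k m T L calG.
Local Notation I := (`[0, L]%classic : set R).
Local Notation J := (`[0, T]%classic : set R).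
Implicit Types (x y t d e g r h : R).
Let inI x : 0 <= x <= L -> I x. Proof. by rewrite /= in_itv. Qed.
Let Iin x : I x -> 0 <= x <= L. Proof. by rewrite /= in_itv. Qed.
Let inJ x : 0 <= x <= T -> J x. Proof. by rewrite /= in_itv. Qed.
Let Jin x : J x -> 0 <= x <= T. Proof. by rewrite /= in_itv. Qed.
Let cJ : compact J := @segment_compact R 0 T.
Let cI : compact I := @segment_compact R 0 L.

Lemma calG_partial_contw (U : topologicalType) (B : set U) (g s n x : U -> R) w :
  orders_cont k m w -> contw B g -> contw B s -> contw B n -> contw B x ->
  (forall z : U, B z -> 0 < g z) -> (forall z : U, B z -> 0 <= n z) ->
  (forall z : U, B z -> 0 <= x z <= L) ->
  contw B (fun z : U => calG_partial L calG w (g z) (s z) (n z) (x z)).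
Proof.
move=> ow cg cs cn cx g0 n0 xL.
apply: (@contw_comp R _ B _ (box (dom_G L)) (fun z : U => row4 (g z) (s z) (n z) (x z))).
- by move=> z Bz; apply: box_row4; [exact: g0|exact: n0|exact: xL].
- move=> z Bz; apply: limw_row => -[[|[|[|[|//]]]] hi].
  + rewrite [X in limw _ X](_ : _ = g); last by apply/funext => y; rewrite mxE.
    by rewrite mxE; exact: cg.
  + rewrite [X in limw _ X](_ : _ = s); last by apply/funext => y; rewrite mxE.
    by rewrite mxE; exact: cs.
  + rewrite [X in limw _ X](_ : _ = n); last by apply/funext => y; rewrite mxE.
    by rewrite mxE; exact: cn.
  + rewrite [X in limw _ X](_ : _ = x); last by apply/funext => y; rewrite mxE.
    by rewrite mxE; exact: cx.
by apply/contwP; exact: (growth_partials A).2.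
Qed.

Let oG : orders_cont k m [:: vG].
Proof. by rewrite /orders_cont /=; have := m0; have := k0; lia. Qed.
Let oN : orders_cont k m [:: vN].
Proof. by rewrite /orders_cont /=; have := m0; have := k0; lia. Qed.
Let oX : orders_cont k m [:: vX].
Proof. by rewrite /orders_cont /=; have := m0; have := k0; lia. Qed.

Variables (u n nx : R -> R -> R) (s : R -> R).
Hypothesis c0 : 0 < c.
Hypothesis ucont : cont2 J I u.
Hypothesis ub : forall t x, 0 <= t <= T -> 0 <= x <= L -> c <= u t x <= C.
Hypothesis scont : contw J s.
Hypothesis ncont : cont2 J I n.
Hypothesis nxcont : cont2 J I nx.
Hypothesis n0 : forall t x, 0 <= t <= T -> 0 <= x <= L -> 0 <= n t x.
Hypothesis dn : partialX T L n nx.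
Hypothesis u00 : forall x, 0 <= x <= L -> u 0 x = 1.
Hypothesis du : partialT T L u (fun t x => calG (u t x) (s t) (n t x) x).

Definition coefG t g x := calG_partial L calG [:: vG] g (s t) (n t x) x.
Definition coefX t g x := calG_partial L calG [:: vN] g (s t) (n t x) x * nx t x +
  calG_partial L calG [:: vX] g (s t) (n t x) x.

(** The mean value theorem along the path that interpolates the growth and the position linearly and
    takes the concentration at the interpolated position. The stress is constant along it, so no
    derivative in the stress appears; for m = 1 there is none. A single [r] serves all
    coefficients. *)
Lemma path_mvt t x y : 0 <= t <= T -> 0 <= x <= L -> 0 <= y <= L ->
  let g r := u t x + r * (u t y - u t x) in let z r := x + r * (y - x) in
  exists2 r, 0 <= r <= 1 &
    calG (u t y) (s t) (n t y) y - calG (u t x) (s t) (n t x) x =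
    coefG t (g r) (z r) * (u t y - u t x) + coefX t (g r) (z r) * (y - x).
Proof.
move=> tT xL yL g z.
have conv (a b p q r : R) : 0 <= r <= 1 -> a <= p <= b -> a <= q <= b -> a <= p + r * (q - p) <= b.
  by move=> /andP[? ?] /andP[? ?] /andP[? ?]; apply/andP; split; nra.
pose v r := row4 (g r) (s t) (n t (z r)) (z r).
pose v' r (i : 'I_4) := nth 0 [:: u t y - u t x; 0; nx t (z r) * (y - x); y - x] i.
have zL r : 0 <= r <= 1 -> 0 <= z r <= L by move=> r1; exact: conv.
have g0 r : 0 <= r <= 1 -> 0 < g r.
  move=> r1; have /andP[h _] := conv _ _ _ _ r r1 (ub tT xL) (ub tT yL).
  exact: lt_le_trans h.
have inE1 r : `[0, 1]%classic r -> 0 <= r <= 1 by rewrite /= in_itv.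
have dlin (p q r : R) : hasD `[0, 1] (fun r => p + r * q) r q.
  have := hasDD (hasD_cst `[0, 1] p r) (hasDM (hasD_id `[0, 1] r) (hasD_cst `[0, 1] q r)).
  by rewrite mulr0 addr0 add0r mul1r.
have dz r : 0 <= r <= 1 -> hasD `[0, 1] (fun r => n t (z r)) r (nx t (z r) * (y - x)).
  move=> r1; apply: (@hasD_comp _ `[0, 1] I (n t) z); first by move=> q /inE1/zL/inI.
    exact: dlin.
  by apply: dn; [exact: inJ|exact/inI/zL].
have dpsi r : 0 <= r <= 1 -> hasD `[0, 1] (uncurry4 calG \o v) r
    (\sum_(i <- [:: vG; vN; vX]) partial_in (dom_G L) i (uncurry4 calG) (v r) * v' r i).
  move=> r1; apply: (chain_row (@dom_G_conv _ L) (dom_G_acc L0)) => //.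
  - by move=> q /inE1 q1; apply: box_row4; [exact: g0|apply: n0 => //; exact: zL|exact: zL].
  - move=> i; rewrite !inE => /or3P[] /eqP ->.
    + rewrite [X in hasD _ X](_ : _ = g); last by apply/funext => q; rewrite mxE.
      exact: dlin.
    + rewrite [X in hasD _ X](_ : _ = (fun r => n t (z r))); last by apply/funext => q; rewrite mxE.
      exact: dz.
    + rewrite [X in hasD _ X](_ : _ = z); last by apply/funext => q; rewrite mxE.
      exact: dlin.
  - by move=> i q; case: i => [[|[|[|[|//]]]] hi] //; rewrite !mxE.
  - move=> i w; rewrite !inE => /or3P[] /eqP -> bw.
    + exact: (growth_partials A).1 [::] w oG bw.
    + exact: (growth_partials A).1 [::] w oN bw.
    + exact: (growth_partials A).1 [::] w oX bw.
  move=> i; rewrite !inE => /or3P[] /eqP ->; apply/contwP.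
  - exact: (growth_partials A).2 [:: vG] oG.
  - exact: (growth_partials A).2 [:: vN] oN.
  - exact: (growth_partials A).2 [:: vX] oX.
have [r r1] := mvt dpsi ler01.
rewrite /= !uncurry4_row4 subr0 mulr1 /g /z !mul1r !mul0r !addr0 !(addrC x) !subrK (addrC (u t x)) subrK.
move=> ->; exists r => //.
by rewrite !big_cons big_nil /coefG /coefX /v' /calG_partial /= addr0; ring.
Qed.

Let a t x := coefG t (u t x) x.
Let b t x := coefX t (u t x) x.
(* Duhamel's formula for the solution of [v_t = a v + b], [v = 0] at [t = 0],
   the equation obtained by differentiating the growth equation in [X]. *)
Definition space_deriv t x := expR (intT a t x) * intT (fun t x => b t x / expR (intT a t x)) t x.
Local Notation V := space_deriv.

Let u0 t x : J t -> I x -> 0 < u t x.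
Proof. by move=> /Jin tT /Iin xL; have /andP[h _] := ub tT xL; exact: lt_le_trans h. Qed.

Lemma coef_cont2 : cont2 J I a /\ cont2 J I b.
Proof.
have P w : orders_cont k m w ->
    cont2 J I (fun t x => calG_partial L calG w (u t x) (s t) (n t x) x).
  move=> ow; apply: (@calG_partial_contw _ (J `*` I) (fun z => u z.1 z.2) (fun z => s z.1)
    (fun z => n z.1 z.2) (fun z => z.2)) => //.
  - exact: cont2_fst scont.
  - exact: contw_snd.
  - by move=> z [Jz Iz]; exact: u0.
  - by move=> z [/Jin h1 /Iin h2]; exact: n0.
  - by move=> z [_ /Iin].
split; first exact: P.
by apply: contwD; [apply: contwM => //; exact: P|exact: P].
Qed.

Let Ecf : cont2 J I (fun t x => expR (intT a t x)).
Proof.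
apply: (contw_comp_continuous (cont2_intT coef_cont2.1)); exact: continuous_expR.
Qed.

Let bE_cont : cont2 J I (fun t x => b t x / expR (intT a t x)).
Proof.
apply: contwM; first exact: coef_cont2.2.
by apply: contwV => // z _; rewrite gt_eqF // expR_gt0.
Qed.

Lemma space_deriv_cont2 : cont2 J I V.
Proof. by apply: contwM => //; exact: cont2_intT. Qed.

Lemma space_deriv_hasD t x : J t -> I x -> hasD J (V^~ x) t (a t x * V t x + b t x).
Proof.
move=> Jt Ix.
have dE : hasD J (fun t => expR (intT a t x)) t (expR (intT a t x) * a t x).
  apply: (@hasD_comp _ J setT expR (fun t => intT a t x)) => //; last exact: hasD_expR.
  exact: (partialT_intT coef_cont2.1 Jt Ix).
have := hasDM dE (partialT_intT bE_cont Jt Ix).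
congr (hasD _ _ _ _); rewrite /space_deriv.
by field; rewrite gt_eqF // expR_gt0.
Qed.

(** The remainder of the first order expansion in [X] vanishes at time 0 and solves the linearized
    equation up to an error small relative to [|y - x|], so Gronwall's inequality makes it
    [o(|y - x|)] at every time. *)
Lemma space_deriv_partialX : partialX T L u V.
Proof.
have [ca cb] := coef_cont2.
(* The growth is an independent variable in [c, C], because the interpolated value on the path is
   not a value of [u]. Compactness makes the coefficients uniformly continuous. *)
pose K3 := (J `*` `[c, C]%classic) `*` I : set (R * R * R).
have cK3 : compact K3.
  by apply: compact_setX => //; apply: compact_setX => //; exact: segment_compact.
have P w : orders_cont k m w ->
    contw K3 (fun z => calG_partial L calG w z.1.2 (s z.1.1) (n z.1.1 z.2) z.2).
  move=> ow; have c1 : contw K3 (fun z => z.1.1).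
    by apply: continuous_contw => z; apply: (cvg_comp fst fst); exact: cvg_fst.
  have c2 : contw K3 (fun z => z.1.2).
    by apply: continuous_contw => z; apply: (cvg_comp fst snd); [exact: cvg_fst|exact: cvg_snd].
  have c3 : contw K3 (fun z => z.2) by apply: continuous_contw => z; exact: cvg_snd.
  apply: (@calG_partial_contw _ K3 (fun z => z.1.2) (fun z => s z.1.1) (fun z => n z.1.1 z.2) (fun z => z.2)) => //.
  - by apply: (contw_comp (B := J) (f := fun z : R * R * R => z.1.1)) => // z [[]].
  - by apply: (cont2_comp ncont c1 c3) => z [[]].
  - by move=> z [[_ +] _]; rewrite /= in_itv /= => /andP[h _]; exact: lt_le_trans h.
  - by move=> z [[/Jin h1 _] /Iin h2]; exact: n0.
  - by move=> z [_ /Iin].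
have cG : contw K3 (fun z => coefG z.1.1 z.1.2 z.2) by exact: P.
have cX : contw K3 (fun z => coefX z.1.1 z.1.2 z.2).
  apply: contwD; last exact: P.
  apply: contwM; first exact: P.
  have c1 : contw K3 (fun z => z.1.1).
    by apply: continuous_contw => z; apply: (cvg_comp fst fst); exact: cvg_fst.
  have c3 : contw K3 (fun z => z.2) by apply: continuous_contw => z; exact: cvg_snd.
  by apply: (cont2_comp nxcont c1 c3) => z [[]].
have [M M0 hM] := cont2_bound cJ cI ca.
have [B B0 hB] := cont2_bound cJ cI space_deriv_cont2.
pose lam := M + 1; have lam0 : 0 < lam by rewrite /lam; lra.
move=> t x Jt Ix; have tT := Jin Jt; have xL := Iin Ix.
apply/hasDe => e e0.
pose E := expR (2 * lam * T); have E0 : 0 < E by exact: expR_gt0.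
(* The second entry makes Gronwall's bound [e1 * (1 + B) / lam * E] at most [e]; the first lets
   [lam = M + 1] absorb [M + e1]. *)
pose e1 := Num.min 1 (e * lam / ((1 + B) * E)).
have B1 : 0 < 1 + B by lra.
have e10 : 0 < e1 by rewrite /e1 lt_min ltr01 divr_gt0 // mulr_gt0.
have e11 : e1 <= 1 by rewrite /e1 ge_min lexx.
have e12 : e1 * (1 + B) / lam * E <= e.
  have : e1 <= e * lam / ((1 + B) * E) by rewrite /e1 ge_min lexx orbT.
  rewrite ler_pdivlMr ?mulr_gt0 // => h.
  by rewrite mulrAC ler_pdivrMr // -mulrA.
have [d1 d10 h1] := compact_unif cK3 cG e10.
have [d2 d20 h2] := compact_unif cK3 cX e10.
pose d := Num.min d1 d2; have d0 : 0 < d by rewrite lt_min d10.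
have [d3 d30 h3] := cont2_unif cJ cI ucont (divr_gt0 d0 (ltr0n _ 2)).
exists (Num.min d d3); first by rewrite lt_min d0.
move=> y Iy; rewrite lt_min => /andP[yd yd3]; have yL := Iin Iy.
pose D r := u r y - u r x - V r x * (y - x).
pose D' r := (calG (u r y) (s r) (n r y) y - calG (u r x) (s r) (n r x) x) -
  (a r x * V r x + b r x) * (y - x).
have D0 : D 0 = 0 by rewrite /D !u00 // /space_deriv /intT !gmap0 mulr0 mul0r !subrr.
have hD r : 0 <= r <= T -> hasD J D r (D' r).
  move=> rT; have Jr := inJ rT; apply: hasDB; first by apply: hasDB; exact: du.
  have := hasDM (space_deriv_hasD Jr Ix) (hasD_cst J (y - x) r).
  by rewrite mulr0 addr0.
have bD r : 0 <= r <= T -> `|D' r| <= lam * `|D r| + e1 * (1 + B) * `|y - x|.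
  move=> rT; have Jr := inJ rT.
  have [q q1 hq] := path_mvt rT xL yL.
  have /andP[q0 q01] := q1.
  pose g := u r x + q * (u r y - u r x); pose z := x + q * (y - x).
  have close p p' : `|p' - p| < d -> ball p d (p + q * (p' - p)).
    move=> pd; rewrite /ball /= opprD addrA subrr add0r normrN normrM ger0_norm //.
    by apply: le_lt_trans pd; rewrite -[leRHS]mul1r ler_wpM2r.
  have cz : ball x d z by exact: close.
  have cg : ball (u r x) d g.
    apply: close; have := h3 r r y x Jr Jr Iy Ix; rewrite subrr normr0 => /(_ d30 yd3).
    by move=> h; apply: (le_lt_trans h); lra.
  have conv (a0 b0 p q0' : R) : a0 <= p <= b0 -> a0 <= q0' <= b0 -> a0 <= p + q * (q0' - p) <= b0.
    by move=> /andP[? ?] /andP[? ?]; apply/andP; split; nra.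
  have K1 : K3 (r, u r x, x) by split => //; split => //=; rewrite in_itv /= ub.
  have K2 : K3 (r, g, z).
    split; first by split => //=; rewrite in_itv /=; apply: conv; exact: ub.
    by apply: inI; exact: conv.
  have cb1 d' : d <= d' -> ball (r, u r x, x) d' (r, g, z).
    move=> dd; split; first split.
    + by apply: ballxx; exact: lt_le_trans dd.
    + exact: le_ball dd _ cg.
    + exact: le_ball dd _ cz.
  have n1 := h1 _ _ K1 K2 (cb1 d1 ltac:(by rewrite /d ge_min lexx)).
  have n2 := h2 _ _ K1 K2 (cb1 d2 ltac:(by rewrite /d ge_min lexx orbT)).
  rewrite distrC in n1; rewrite distrC in n2.
  have -> : D' r = a r x * D r + (coefG r g z - a r x) * (u r y - u r x) + (coefX r g z - b r x) * (y - x).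
    by rewrite /D' hq -/g -/z /D; ring.
  have nu : `|u r y - u r x| <= `|D r| + B * `|y - x|.
    rewrite (_ : u r y - u r x = D r + V r x * (y - x)); last by rewrite /D; ring.
    by apply: (le_trans (ler_normD _ _)); rewrite lerD2l normrM ler_wpM2r // hB.
  apply: (le_trans (ler_normD _ _)).
  apply: (@le_trans _ _ (M * `|D r| + e1 * (`|D r| + B * `|y - x|) + e1 * `|y - x|)).
    apply: lerD; last by rewrite normrM ler_wpM2r.
    apply: (le_trans (ler_normD _ _)); rewrite !normrM; apply: lerD; first by rewrite ler_wpM2r // hM.
    by apply: ler_pM.
  have Dr0 := normr_ge0 (D r); rewrite /lam; nra.
have cc : 0 <= e1 * (1 + B) * `|y - x| by rewrite mulr_ge0 // mulr_ge0 // ltW.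
have := gronwall lam0 cc D0 hD bD tT; rewrite -/(D t) => h.
apply: (le_trans h); apply: (@le_trans _ _ (e1 * (1 + B) * `|y - x| / lam * E)).
  rewrite ler_wpM2l //; first by rewrite mulr_ge0 // invr_ge0 ltW.
  by rewrite ler_expR ler_wpM2l ?(andP tT).2 // mulr_ge0 // ltW.
rewrite (_ : _ * E = e1 * (1 + B) / lam * E * `|y - x|); last by ring.
exact: ler_wpM2r.
Qed.

End SpaceDerivative.


(** * Existence, uniqueness and regularity for the growth equation *)

Section GrowthODE.
Variables (R : realType) (k m : nat) (T L : R) (calG : R -> R -> R -> R -> R).
Hypothesis m0 : (0 < m)%N.
Hypothesis L0 : 0 < L.
Hypothesis T0 : 0 < T.
Hypothesis A : admissible_growth_law k m T L calG.
Local Notation I := (`[0, L]%classic : set R).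
Local Notation J := (`[0, T]%classic : set R).
Implicit Types (x y z t s d e g n c C : R) (G H : R -> R) (u v : R -> R -> R).
Let inI x : 0 <= x <= L -> I x. Proof. by rewrite /= in_itv. Qed.
Let Iin x : I x -> 0 <= x <= L. Proof. by rewrite /= in_itv. Qed.
Let inJ x : 0 <= x <= T -> J x. Proof. by rewrite /= in_itv. Qed.
Let Jin x : J x -> 0 <= x <= T. Proof. by rewrite /= in_itv. Qed.
Let cJ : compact J := @segment_compact R 0 T.
Let cI : compact I := @segment_compact R 0 L.
Let I0 : I 0. Proof. by rewrite /= in_itv /= lexx ltW. Qed.
Let J0 : J 0. Proof. by rewrite /= in_itv /= lexx ltW. Qed.

(* [S G] and [N G] stand for the stress and the nutrient concentration under the growth [G]. *)
Variables (S : (R -> R) -> R) (N : (R -> R) -> R -> R) (NM : R).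
Hypothesis S_bounds : forall c C, 0 < c -> c <= C ->
  exists a b, forall G, between L c C G -> a <= S G <= b.
Hypothesis S_lip : forall c C, 0 < c -> c <= C ->
  exists2 K, 0 <= K & forall G H d, between L c C G -> between L c C H -> 0 <= d ->
    (forall x, 0 <= x <= L -> `|G x - H x| <= d) -> `|S G - S H| <= K * d.
Hypothesis N_bounds : forall G, contw I G -> (forall x, 0 <= x <= L -> 0 < G x) ->
  contw I (N G) /\ forall x, 0 <= x <= L -> 0 <= N G x <= NM.
Hypothesis N_lip : forall c C, 0 < c -> c <= C ->
  exists2 K, 0 <= K & forall G H d, between L c C G -> between L c C H -> 0 <= d ->
    (forall x, 0 <= x <= L -> `|G x - H x| <= d) ->
    forall x, 0 <= x <= L -> `|N G x - N H x| <= K * d.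
Hypothesis S_reg : forall u, (forall t x, 0 <= t <= T -> 0 <= x <= L -> 0 < u t x) ->
  forall i j, (i <= m)%N -> reg T L i 0 u -> reg T L i j (fun t _ => S (u t)).
Hypothesis N_reg : forall u, (forall t x, 0 <= t <= T -> 0 <= x <= L -> 0 < u t x) ->
  forall i j, (j <= k)%N -> reg T L i j u -> reg T L i j (fun t x => N (u t) x).
Hypothesis N_partialX : forall u, (forall t x, 0 <= t <= T -> 0 <= x <= L -> 0 < u t x) ->
  forall j, (j <= k)%N -> regX T L j u ->
  exists2 Nx, partialX T L (fun t x => N (u t) x) Nx & regX T L j Nx.

Definition growth_rhs G x := calG (G x) (S G) (N G x) x.

Lemma NM_ge0 : 0 <= NM.
Proof.
have [||_ h] := N_bounds (G := fun=> 1); [exact: contw_cst|by []|].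
by have /andP[h1 h2] := h 0 (Iin I0); exact: le_trans h2.
Qed.

Lemma growth_rhs_lipschitz c C : 0 < c -> c <= C ->
  exists2 K, 0 <= K & forall G H d x, between L c C G -> between L c C H -> 0 <= d ->
    (forall x, 0 <= x <= L -> `|G x - H x| <= d) -> 0 <= x <= L ->
    `|growth_rhs G x - growth_rhs H x| <= K * d.
Proof.
move=> c0 cC; have [a [b hab]] := S_bounds c0 cC.
have [K1 K10 h1] := S_lip c0 cC; have [K2 K20 h2] := N_lip c0 cC.
have ab : a <= b.
  have /hab /andP[p q] : between L c C (fun=> c).
    by split; [exact: contw_cst|move=> x _; rewrite lexx cC].
  exact: le_trans q.
have [K3 K30 h3] := calG_lipschitz A c0 cC ab NM_ge0.
exists (K3 * (1 + K1 + K2)); first by rewrite mulr_ge0 // !addr_ge0.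
move=> G H d x bG bH d0 hd xL.
have [cG G0] := between_pos c0 bG; have [cH H0] := between_pos c0 bH.
have [_ nG] := N_bounds cG G0; have [_ nH] := N_bounds cH H0.
apply: (le_trans (h3 x _ _ _ _ _ _ xL (bG.2 x xL) (hab _ bG) (nG x xL) (bH.2 x xL) (hab _ bH) (nH x xL))).
rewrite -mulrA; apply: ler_wpM2l => //; rewrite !mulrDl mul1r.
by apply: lerD; [apply: lerD; [exact: hd|exact: h1]|exact: h2].
Qed.

Lemma growth_rhs_cont2 u : cont2 J I u ->
  (forall t x, 0 <= t <= T -> 0 <= x <= L -> 0 < u t x) ->
  cont2 J I (fun t x => growth_rhs (u t) x).
Proof.
move=> cu u0; have ru : reg T L 0 0 u by [].
have rS := S_reg u0 0 (leq0n m) ru; have rN := N_reg u0 (leq0n k) ru.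
have cS : contw J (fun t => S (u t)) := cont2_col I0 (reg_cont rS).
have cN : cont2 J I (fun t x => N (u t) x) := reg_cont rN.
refine (calG_cont2 m0 L0 T0 A cu cS cN _ _).
  by move=> t x Jt Ix; apply: u0; [exact: Jin|exact: Iin].
move=> t x Jt Ix; have tT := Jin Jt.
have [_ h] := N_bounds (cont2_row Jt cu) (fun x => u0 t x tT).
by have /andP[] := h x (Iin Ix).
Qed.

Section Clamped.
Variables (c C : R).
Hypothesis c0 : 0 < c.
Hypothesis cC : c <= C.

Definition cl (G : R -> R) : R -> R := fun x => clamp c C (G x).

Lemma cl_between G : contw I G -> between L c C (cl G).
Proof.
move=> cG; split; last by move=> x xL; exact: clamp_itv.
by apply: (contw_comp_continuous cG); exact: continuous_clamp.
Qed.

Lemma cl_cont2 u : cont2 J I u -> cont2 J I (fun t => cl (u t)).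
Proof.
by move=> cu; apply: (contw_comp_continuous cu (g := clamp c C)); exact: continuous_clamp.
Qed.

Lemma clamped_solution : exists u, [/\ cont2 J I u, forall x, 0 <= x <= L -> u 0 x = 1 &
  partialT T L u (fun t x => growth_rhs (cl (u t)) x)].
Proof.
have [K K0 hK] := growth_rhs_lipschitz c0 cC.
(* Twice the Lipschitz constant, with [K + 1] for [K] so that the rate is positive. *)
pose lam := 2 * (K + 1); have lam0 : 0 < lam by rewrite /lam; lra.
pose w (z : R * R) := expR (lam * z.1).
have w0 (z : R * R) : (J `*` I) z -> 0 < w z by move=> _; exact: expR_gt0.
pose cur (f : R * R -> R) : R -> R -> R := fun t x => f (t, x).
pose V : set (R * R -> R) := [set f | contw (J `*` I) f].
have Vcur f : V f -> cont2 J I (cur f).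
  by move=> Vf; apply: contw_eq Vf => -[t x].
pose F f t x := growth_rhs (cl (cur f t)) x.
have cF f : V f -> cont2 J I (F f).
  move=> Vf; apply: (@growth_rhs_cont2 (fun t => cl (cur f t))); first exact/cl_cont2/Vcur.
  by move=> t x tT xL; have /andP[h _] := clamp_itv (cur f t x) cC; exact: lt_le_trans h.
pose Phi f (z : R * R) := 1 + intT (F f) z.1 z.2.
have VPhi f : V f -> V (Phi f).
  by move=> Vf; apply: contwD; [exact: contw_cst|exact: (cont2_intT (cF f Vf))].
have V1 : V (fun=> 1) by exact: contw_cst.
have [M M0 hM] := compact_bound (compact_setX cJ cI) (VPhi _ V1).
have [|z Kz|f g d Vf Vg d0 hfg z Kz|fn f Vn hn|v Vv hv] :=
    @fixpoint R (R * R)%type (J `*` I) w w0 V Phi (fun=> 1) (M + 1) V1 VPhi.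
- by lra.
- apply: (@le_trans _ _ (M + 1)).
    by apply: (le_trans (ler_normB _ _)); rewrite normr1 lerD2r; exact: hM.
  rewrite -[leLHS]mulr1; apply: ler_wpM2l; first lra.
  rewrite /w -[leLHS]expR0 ler_expR mulr_ge0 ?(ltW lam0) //.
  by case: z Kz => t x [/Jin /andP[]].
- case: z Kz => t x [/= Jt Ix]; have tT := Jin Jt; have xL := Iin Ix.
  have -> : Phi f (t, x) - Phi g (t, x) = gmap ((F f)^~ x) t - gmap ((F g)^~ x) t.
    by rewrite /Phi /intT /=; ring.
  have cFf := cont2_col Ix (cF f Vf); have cFg := cont2_col Ix (cF g Vg).
  rewrite /w /=; have -> : d / 2 = (K + 1) * d / lam.
    by rewrite /lam; field; rewrite lt0r_neq0 //; lra.
  apply: (@hasD_exp_bound _ T (fun t => gmap ((F f)^~ x) t - gmap ((F g)^~ x) t)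
    (fun t => F f t x - F g t x)) => //.
  + by rewrite !gmap0 subrr.
  + by rewrite mulr_ge0 //; lra.
  + by move=> s sT; apply: hasDB; exact: hasD_gmap.
  move=> s sT; have Js := inJ sT.
  have e0 : 0 <= d * expR (lam * s) by rewrite mulr_ge0 // expR_ge0.
  apply: (@le_trans _ _ (K * (d * expR (lam * s)))).
    apply: hK => //.
    + by apply: cl_between; exact: cont2_row Js (Vcur f Vf).
    + by apply: cl_between; exact: cont2_row Js (Vcur g Vg).
    move=> y yL; apply: (le_trans (clamp_dist _ _ cC)).
    by apply: (hfg (s, y)); split => //; exact: inI.
  by rewrite -[leRHS]mulrA ler_wpM2r // lerDl.
- apply: contw_unif_limit => e e0.
  have [B B0 hB] : exists2 B, 0 < B & forall z : R * R, (J `*` I) z -> w z <= B.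
    exists (expR (lam * T)); first exact: expR_gt0.
    by move=> [t x] [/Jin /andP[_ tT] _]; rewrite ler_expR ler_wpM2l // ltW.
  have eB : 0 < e / B by rewrite divr_gt0.
  have [n h] := hn _ eB; exists (fn n); [exact: Vn|move=> z Kz].
  apply: (le_trans (h z Kz)); rewrite mulrAC ler_pdivrMr // ler_wpM2l ?hB //.
  exact: ltW.
exists (cur v); split; first exact: Vcur.
  move=> x xL; have <- : Phi v (0, x) = cur v 0 x by apply: hv; split; [exact: J0|exact: inI].
  by rewrite /Phi /intT /= gmap0 addr0.
apply: (@partialT_eq _ T L (fun t x => 1 + intT (F v) t x)).
  by move=> t x Jt Ix; have := hv (t, x) (conj Jt Ix).
move=> t x Jt Ix.
have := hasDD (hasD_cst J 1 t) (partialT_intT (cF v Vv) Jt Ix).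
by rewrite add0r.
Qed.

Lemma solution_uniq u v : (forall t, 0 <= t <= T -> between L c C (u t)) ->
  (forall t, 0 <= t <= T -> between L c C (v t)) ->
  (forall x, 0 <= x <= L -> u 0 x = v 0 x) ->
  partialT T L u (fun t x => growth_rhs (u t) x) -> partialT T L v (fun t x => growth_rhs (v t) x) ->
  forall t x, 0 <= t <= T -> 0 <= x <= L -> u t x = v t x.
Proof.
move=> bu bv uv0 du dv t x tT xL.
have [K K0 hK] := growth_rhs_lipschitz c0 cC.
pose lam := 2 * (K + 1); have lam0 : 0 < lam by rewrite /lam; lra.
pose w (z : R * R) := expR (lam * z.1).
have w0 (z : R * R) : (J `*` I) z -> 0 < w z by move=> _; exact: expR_gt0.
pose f (z : R * R) := u z.1 z.2 - v z.1 z.2.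
have C0 : 0 <= C by rewrite (le_trans (ltW c0)).
(* Both functions lie in [c, C], so [C] is a first bound of the difference; every bound can be
   halved, hence the difference vanishes. *)
have := @halving R (R * R)%type (J `*` I) w w0 f C 0 (lexx 0) C0 _ _ (t, x) (conj (inJ tT) (inI xL)).
rewrite mulr0 mul0r normr_le0 => h; apply/eqP; rewrite -subr_eq0; apply: h => {t x tT xL}.
  move=> [t x] [/= /Jin tT /Iin xL]; rewrite /f /w /=.
  apply: (@le_trans _ _ (C * 1)).
    have /andP[? ?] := (bu t tT).2 x xL; have /andP[? ?] := (bv t tT).2 x xL.
    by have c0' := c0; rewrite ler_norml; apply/andP; split; lra.
  apply: ler_wpM2l => //; rewrite -[leLHS]expR0 ler_expR mulr_ge0 ?(ltW lam0) //.
  by have /andP[] := tT.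
move=> d d0 hd [t x] [/= Jt Ix]; have tT := Jin Jt; have xL := Iin Ix.
rewrite addr0 /f /w /=; have -> : d / 2 = (K + 1) * d / lam.
  by rewrite /lam; field; rewrite lt0r_neq0 //; lra.
apply: (@hasD_exp_bound _ T (fun t => u t x - v t x)
  (fun t => growth_rhs (u t) x - growth_rhs (v t) x)) => //.
- by rewrite uv0 // subrr.
- by rewrite mulr_ge0 //; lra.
- by move=> s /inJ Js; apply: (@hasDB _ J (u^~ x) (v^~ x)); [exact: du|exact: dv].
move=> s sT; have e0 : 0 <= d * expR (lam * s) by rewrite mulr_ge0 // expR_ge0.
apply: (@le_trans _ _ (K * (d * expR (lam * s)))).
  apply: hK => //; [exact: bu|exact: bv|].
  by move=> y yL; apply: (hd (s, y)); split; [exact: inJ|exact: inI].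
by rewrite -[leRHS]mulrA ler_wpM2r // lerDl.
Qed.

End Clamped.

(** [S] and [N] take functions on the whole line, so agreement on [0, L] has to be transferred to
    them; the Lipschitz estimate with distance 0 does it. *)
Lemma growth_rhs_eq c C G H x : 0 < c -> c <= C -> between L c C G -> between L c C H ->
  (forall x, 0 <= x <= L -> G x = H x) -> 0 <= x <= L -> growth_rhs G x = growth_rhs H x.
Proof.
move=> c0 cC bG bH GH xL; have [K K0 hK] := growth_rhs_lipschitz c0 cC.
have := hK G H 0 x bG bH (lexx 0) _ xL; rewrite mulr0 normr_le0 subr_eq0 => h; apply/eqP/h.
by move=> y yL; rewrite GH // subrr normr0.
Qed.

(** The barriers lie in [c, C], so where the clamped solution touches one of them the clamp is the
    identity at that point. The stress and concentration of the clamped growth are still nonlocal,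
    but the strict inequalities between the laws hold for all their values, so the scalar comparison
    applies at each [x] separately. *)
Lemma solution_exists : exists u c C, [/\ 0 < c, c <= C,
  cont2 J I u /\ (forall t, 0 <= t <= T -> between L c C (u t)),
  forall x, 0 <= x <= L -> u 0 x = 1 & partialT T L u (fun t x => growth_rhs (u t) x)].
Proof.
have [G0 [G1 [u0 [u1 [c [C [c0 cC hb hu [hi hG]]]]]]]] := barrier_bounds L0 T0 A.
have [u [cu ui du]] := clamped_solution c0 cC.
have clb t tT : between L c C (cl c C (u t)) := cl_between cC (cont2_row (inJ tT) cu).
have Nge t x : 0 <= t <= T -> 0 <= x <= L -> 0 <= N (cl c C (u t)) x.
  move=> tT xL; have [h1 h2] := between_pos c0 (clb t tT).
  by have [_ /(_ x xL) /andP[]] := N_bounds h1 h2.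
have low t x : 0 <= t <= T -> 0 <= x <= L -> u0 t x <= u t x.
  move=> + xL; move: t; suff H : forall t, 0 <= t <= T -> 0 <= u t x - u0 t x by move=> t /H; rewrite subr_ge0.
  apply: (@nonneg_of_repelling _ T (fun t => u t x - u0 t x)
    (fun t => growth_rhs (cl c C (u t)) x - G0 (u0 t x) x)).
  - move=> t tT; apply: (@hasDB _ J (u^~ x) (u0^~ x)); first by apply: du; [exact: inJ|exact: inI].
    by have [] := hu t x tT xL.
  - by rewrite ui // (hi x xL).1 subrr.
  move=> t tT /eqP; rewrite subr_eq0 => /eqP e; rewrite subr_gt0 /growth_rhs.
  have [h1 h2] := hb t x tT xL; have [h3 _ _] := hu t x tT xL.
  have -> : cl c C (u t) x = u0 t x by rewrite /cl e clamp_id // h1 (le_trans h3).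
  by have /andP[] := hG (u0 t x) (S (cl c C (u t))) _ x (lt_le_trans c0 h1) (Nge t x tT xL) xL.
have upp t x : 0 <= t <= T -> 0 <= x <= L -> u t x <= u1 t x.
  move=> + xL; move: t; suff H : forall t, 0 <= t <= T -> 0 <= u1 t x - u t x by move=> t /H; rewrite subr_ge0.
  apply: (@nonneg_of_repelling _ T (fun t => u1 t x - u t x)
    (fun t => G1 (u1 t x) x - growth_rhs (cl c C (u t)) x)).
  - move=> t tT; apply: (@hasDB _ J (u1^~ x) (u^~ x)); last by apply: du; [exact: inJ|exact: inI].
    by have [] := hu t x tT xL.
  - by rewrite ui // (hi x xL).2 subrr.
  move=> t tT /eqP; rewrite subr_eq0 => /eqP e; rewrite subr_gt0 /growth_rhs.
  have [h1 h2] := hb t x tT xL; have [h3 _ _] := hu t x tT xL.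
  have -> : cl c C (u t) x = u1 t x by rewrite /cl -e clamp_id // h2 (le_trans h1).
  by have /andP[] := hG (u1 t x) (S (cl c C (u t))) _ x (lt_le_trans c0 (le_trans h1 h3)) (Nge t x tT xL) xL.
have B t : 0 <= t <= T -> between L c C (u t).
  move=> tT; split; first exact: cont2_row (inJ tT) cu.
  move=> x xL; have [h1 h2] := hb t x tT xL.
  by rewrite (le_trans h1 (low t x tT xL)) (le_trans (upp t x tT xL) h2).
exists u, c, C; split => //.
move=> t x Jt Ix; have := du t x Jt Ix.
have tT := Jin Jt; have xL := Iin Ix.
rewrite (growth_rhs_eq c0 cC (clb t tT) (B t tT) _ xL) // => y yL.
by rewrite /cl clamp_id //; exact: (B t tT).2.
Qed.

Section Bootstrap.
Variables (u : R -> R -> R) (c C : R).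
Hypothesis c0 : 0 < c.
Hypothesis ucont : cont2 J I u.
Hypothesis ub : forall t, 0 <= t <= T -> between L c C (u t).
Hypothesis u01 : forall x, 0 <= x <= L -> u 0 x = 1.
Hypothesis du : partialT T L u (fun t x => growth_rhs (u t) x).

Let upos t x : 0 <= t <= T -> 0 <= x <= L -> 0 < u t x.
Proof. by move=> tT xL; have [_ h] := between_pos c0 (ub tT); exact: h. Qed.
Let upos' t x : J t -> I x -> 0 < u t x.
Proof. by move=> /Jin tT /Iin xL; exact: upos. Qed.
Let Nge t x : 0 <= t <= T -> 0 <= x <= L -> 0 <= N (u t) x.
Proof.
move=> tT xL; have [h1 h2] := between_pos c0 (ub tT).
by have [_ /(_ x xL) /andP[]] := N_bounds h1 h2.
Qed.
Let Nge' t x : J t -> I x -> 0 <= N (u t) x.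
Proof. by move=> /Jin tT /Iin xL; exact: Nge. Qed.

(** If [u] has [j] derivatives in [X], the concentration has [j + 1], so the coefficients of the
    linearized equation and Duhamel's formula have [j]; this formula being the X-derivative of [u],
    one order is gained. *)
Lemma solution_regX j : (j <= k)%N -> regX T L j u.
Proof.
elim: j => [//|j IH] jk; have ru := IH (ltnW jk).
have k0 : (0 < k)%N by exact: leq_ltn_trans jk.
have ru0 : reg T L 0 j u by [].
have rS := S_reg upos j (leq0n m) (reg_le (leq0n 0) (leq0n j) ru0).
have rN := N_reg upos (ltnW jk) ru0.
have [nx dn rnx] := N_partialX upos (ltnW jk) ru.
have rnx0 : reg T L 0 j nx by [].
have cS : contw J (fun t => S (u t)) := cont2_col I0 (reg_cont rS).
have ub' t x : 0 <= t <= T -> 0 <= x <= L -> c <= u t x <= C.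
  by move=> tT; exact: (ub tT).2.
pose n t x := N (u t) x; pose s t := S (u t).
split; first exact: ucont.
exists (space_deriv L calG u n nx s).
  exact: (space_deriv_partialX m0 k0 L0 T0 A c0 ucont ub' cS (reg_cont rN) (regX_cont rnx) Nge dn u01 du).
have P w : fits k m 0 j w -> regX T L j (fun t x => calG_partial L calG w (u t x) (s t) (n t x) x).
  by move=> fw; exact: reg_regX (calG_partial_reg m0 L0 T0 A fw upos' Nge' ru0 rS rN).
have fG : fits k m 0 j [:: vG] by apply/and3P; split; have := m0; rewrite /=; lia.
have fN : fits k m 0 j [:: vN] by apply/and3P; split; have := m0; rewrite /=; lia.
have fX : fits k m 0 j [:: vX] by apply/and3P; split; have := m0; rewrite /=; lia.
have rE : regX T L j (fun t x => expR (intT (fun t x => coefG L calG n s t (u t x) x) t x)).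
  by apply: regX_exp; apply: regX_intT; exact: P.
apply: regX_M => //; apply: regX_intT; apply: regX_M.
  by apply: regX_D; [apply: regX_M => //; exact: P|exact: P].
by apply: regX_V rE => t x _ _; rewrite gt_eqF // expR_gt0.
Qed.

(** With [i] at most [m - 1], [i] time and [k] space derivatives differentiate the law at most
    [k + m - 1] times in G and N, [m - 1] times in S and [k] times in X: the available orders
    exactly. *)
Lemma growth_rhs_reg i : (i < m)%N -> reg T L i k u -> reg T L i k (fun t x => growth_rhs (u t) x).
Proof.
move=> im ru.
have rS := S_reg upos k (ltnW im) (reg_le (leqnn i) (leq0n k) ru).
have rN := N_reg upos (leqnn k) ru.
have f0 : fits k m i k [::] by apply/and3P; split; have := m0; rewrite /=; lia.
apply: reg_eq (calG_partial_reg m0 L0 T0 A f0 upos' Nge' ru rS rN) => t x _ _.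
by rewrite /calG_partial /= uncurry4_row4.
Qed.

Lemma solution_reg i : (i <= m)%N -> reg T L i k u.
Proof.
elim: i => [|i IH] im; first by split => //; exact: solution_regX.
split; first exact: solution_regX.
exists (fun t x => growth_rhs (u t) x); first exact: du.
by apply: growth_rhs_reg => //; apply: IH; exact: ltnW.
Qed.

End Bootstrap.

Lemma growth_ode : exists u,
  [/\ forall t x, 0 <= t <= T -> 0 <= x <= L -> 0 < u t x,
      forall x, 0 <= x <= L -> u 0 x = 1,
      reg T L m k u /\ regX T L k (fun t x => growth_rhs (u t) x),
      partialT T L u (fun t x => growth_rhs (u t) x) &
  forall v, cont2 J I v -> (forall t x, 0 <= t <= T -> 0 <= x <= L -> 0 < v t x) ->
    (forall x, 0 <= x <= L -> v 0 x = 1) -> partialT T L v (fun t x => growth_rhs (v t) x) ->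
    forall t x, 0 <= t <= T -> 0 <= x <= L -> v t x = u t x].
Proof.
have [u [c [C [c0 cC [cu ub] u01 du]]]] := solution_exists.
exists u; split => //.
- by move=> t x tT xL; have [_ h] := between_pos c0 (ub t tT); exact: h.
- split; first exact: (solution_reg c0 cu ub u01 du (leqnn m)).
  apply: (@reg_regX _ T L 0); apply: (growth_rhs_reg c0 ub m0).
  exact: (solution_reg c0 cu ub u01 du (leq0n m)).
move=> v cv v0 v01 dv.
(* A competing solution has bounds of its own, by compactness; uniqueness is applied in the smallest
   interval containing both pairs of bounds. *)
have [c' [C' [c'0 c'C' vb]]] := between_in_time T0 L0 v0 cv.
have minc : 0 < Num.min c c' by rewrite lt_min c0.
have le : Num.min c c' <= Num.max C C' by rewrite ge_min !le_max cC.
apply: (solution_uniq minc le) => //.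
- move=> t tT; have [h1 h2] := vb t tT; split => // x xL; have /andP[h3 h4] := h2 x xL.
  by rewrite ge_min le_max h3 h4 !orbT.
- move=> t tT; have [h1 h2] := ub t tT; split => // x xL; have /andP[h3 h4] := h2 x xL.
  by rewrite ge_min le_max h3 h4.
by move=> x xL; rewrite v01 // u01.
Qed.

End GrowthODE.


(** * Curves in C^k read as functions of (t, X) *)

Section Curves.
Variables (R : realType) (k : nat) (T L : R).
Hypothesis L0 : 0 < L.
Local Notation I := (`[0, L]%classic : set R).
Local Notation J := (`[0, T]%classic : set R).
Implicit Types (f g : R -> R) (u : R -> R -> R).
Let cI : compact I := @segment_compact R 0 L.

Lemma Ck_contw f : Ck I k f -> contw I f.
Proof. by move=> [_ h]; apply/contwP; exact: (h 0%N). Qed.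

Lemma contw_le_Ck_norm f (x : R) : contw I f -> I x -> `|f x| <= Ck_norm I k f.
Proof.
move=> cf Ix; apply: le_trans (sup_norm_le_Ck_norm L0 k f).
by apply: sup_norm_ub => //; have [M _ hM] := compact_bound cI cf; exists M.
Qed.

Lemma Ck_norm_eq f g : (forall x, I x -> f x = g x) -> Ck_norm I k f = Ck_norm I k g.
Proof.
move=> fg; apply: eq_bigr => i _; congr sup; apply/seteqP; split => _ [x Ix <-]; exists x => //.
  by rewrite (derivn_in_eq _ Ix fg).
by rewrite (derivn_in_eq _ Ix fg).
Qed.

Lemma curve_deriv_eq u t f g : (forall x, I x -> f x = g x) ->
  curve_deriv (Ck_norm I k) T u t f -> curve_deriv (Ck_norm I k) T u t g.
Proof.
move=> fg; rewrite /curve_deriv.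
rewrite (_ : (fun s => Ck_norm I k (fun X => (u s X - u t X) / (s - t) - f X)) =
  (fun s => Ck_norm I k (fun X => (u s X - u t X) / (s - t) - g X))) //.
by apply/funext => s; apply: Ck_norm_eq => x Ix; rewrite fg.
Qed.

(** The C^k norm dominates the sup norm, so continuity of the curve is continuity in time uniform in
    [X], as [cont2_build] asks. *)
Lemma curve_continuous_cont2 u : (forall t, J t -> contw I (u t)) ->
  curve_continuous (Ck_norm I k) T u -> cont2 J I u.
Proof.
move=> cu hu; apply: cont2_build => // t e Jt e0.
have /(limwP J (fun s => Ck_norm I k (fun X => u s X - u t X)))/(_ e e0)[d d0 hd] := hu t Jt.
exists d => // s Js st x Ix; have := hd s Js; rewrite /ball /= distrC => /(_ st).
rewrite subr0 => /(le_trans (ler_norm _)); apply: le_trans.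
by apply: (@contw_le_Ck_norm (fun X => u s X - u t X)) => //; apply: contwB; exact: cu.
Qed.

Lemma curve_deriv_hasD u t f (x : R) : (forall t, J t -> contw I (u t)) -> J t -> contw I f ->
  curve_deriv (Ck_norm I k) T u t f -> I x -> hasD J (u^~ x) t (f x).
Proof.
move=> cu Jt cf hu Ix; apply/hasD_ratio; apply/cvgrPdist_le => e e0.
have /cvgrPdist_le/(_ e e0) := hu.
rewrite !near_withinE; apply: filterS => s hs st Js.
have := hs st Js; rewrite sub0r normrN distrC => /(le_trans (ler_norm _)); apply: le_trans.
apply: (@contw_le_Ck_norm (fun X => (u s X - u t X) / (s - t) - f X)) => //.
apply: contwB => //; apply: contwM; first by apply: contwB; exact: cu.
exact: contw_cst.
Qed.

End Curves.

Theorem theorem5p6 (R : realType) (k m : nat) (T L0 l0 : R)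
    (W : R -> R -> R) (D0 beta0 : R -> R) (nL nR : R)
    (calG : R -> R -> R -> R -> R) :
  (1 <= m)%N -> 0 < T -> 0 < L0 -> 0 < l0 ->
  admissible_energy k m L0 W ->
  admissible_nutrient k m L0 D0 beta0 nL nR ->
  admissible_growth_law k m T L0 calG ->
  exists2 G : R -> R -> R,
    growth_solution L0 l0 W D0 beta0 nL nR calG k m T G &
    forall H : R -> R -> R,
      growth_solution L0 l0 W D0 beta0 nL nR calG k m T H ->
      forall t X : R, t \in `[0, T] -> X \in `[0, L0] -> H t X = G t X.
Proof.
move=> m0 T0 L00 l00 E An Ag.
pose S := stress_op L0 l0 W; pose N := nutrient_op L0 D0 beta0 nL nR.
(* On positive continuous growths the objects chosen in the statement are the explicit operators, so
   existence and uniqueness both transfer through this identity. *)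
have rhsE (G : R -> R) x : contw `[0, L0] G -> (forall x, 0 <= x <= L0 -> 0 < G x) -> 0 <= x <= L0 ->
    growth_op L0 l0 W D0 beta0 nL nR calG G x = growth_rhs calG S N G x.
  move=> cG G0 xL; rewrite /growth_op (stress_opE m0 L00 l00 E cG G0).
  by rewrite (nutrient_opE m0 L00 l00 E An cG G0 xL).
have [u [upos u01 [ru rF] du uniq]] := growth_ode m0 L00 T0 Ag
  (stress_op_bounds m0 L00 l00 E) (stress_op_lipschitz m0 L00 l00 E)
  (nutrient_op_bounds m0 L00 An) (nutrient_op_lipschitz m0 L00 An)
  (fun u u0 i j => stress_op_reg_any m0 T0 L00 l00 E u0 j)
  (fun u u0 i j jk => nutrient_op_reg m0 T0 L00 An u0 jk)
  (fun u u0 j jk => nutrient_op_partialX m0 T0 L00 An u0 jk).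
have cu := reg_cont ru.
have tP (t : R) : t \in `[0, T] -> 0 <= t <= T by rewrite in_itv.
have xP (x : R) : x \in `[0, L0] -> 0 <= x <= L0 by rewrite in_itv.
exists u.
  split.
  - exact: reg_Cm_curve.
  - by move=> t x /tP tT /xP xL; exact: upos.
  - move=> t tb; have Jt : `[0, T]%classic t by []; have tT := tP t tb.
    have FE x : `[0, L0]%classic x -> growth_rhs calG S N (u t) x = growth_op L0 l0 W D0 beta0 nL nR calG (u t) x.
      by move=> /xP xL; rewrite rhsE //; [exact: cont2_row Jt cu|move=> z zL; exact: upos].
    split.
      by apply: (Ck_eq FE); apply: (smoothX_Ck L00); exact: (regX_row Jt rF).
    apply: (curve_deriv_eq FE).
    exact: (regX_curve_deriv T0 L00 (reg_regX ru) rF du tb).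
  by move=> x /xP; exact: u01.
move=> H [HC Hpos Hd H01] t x /tP tT /xP xL.
have [HCk Hc] : (forall t : R, t \in `[0, T] -> Ck `[0, L0] k (H t)) /\
    curve_continuous (Ck_norm `[0, L0] k) T H by case: (m) HC => [|m'] [? []].
have cH (s : R) : `[0, T]%classic s -> contw `[0, L0] (H s) by move=> Js; exact: (Ck_contw (HCk s Js)).
apply: uniq => //.
  exact: curve_continuous_cont2 Hc.
move=> s y Js Iy; have [hCk hd] := Hd s Js.
have := curve_deriv_hasD L00 cH Js (Ck_contw hCk) hd Iy.
rewrite rhsE; [by []|exact: cH| |exact: xP].
by move=> z zL; apply: Hpos => //; rewrite in_itv.
Qed.
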